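(* Let $0\le t_0<T$. On the event $\{\tau>t_0\}$, the time-$t_0$ value $\Pi^{(\mathrm{WD})}_{t_0}$ of the write-down CoCo is (almost surely) $$\Pi^{(\mathrm{WD})}_{t_0}=Ke^{-\int_{t_0}^{T}r_v\,dv}\bigl(1-P_{t_0}(T,b)\bigr)E^{*}_{t_0}(T,1)+\sum_{i=1}^{M}c_i e^{-\int_{t_0}^{t_i}r_v\,dv}\bigl(1-P_{t_0}(t_i,b)\bigr)E^{*}_{t_0}(t_i,1)\mathbf 1_{\{t_0<t_i\}}+\varpi(1-w)K\int_{t_0}^{T}e^{-\int_{t_0}^{s}r_v\,dv}E^{*}_{t_0}(s,1)\,d_sP_{t_0}(s,b),$$ where $d_s$ denotes the Lebesgue–Stieltjes differential in the time variable $s$.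
   Context: **Driving processes (risk-neutral measure).** Work on a filtered probability space with filtration $\mathbb F=(\mathscr F_t)_{t\ge0}$ satisfying the usual conditions and a risk-neutral probability $\mathsf P^*$ (expectation $\mathsf E^*$). Under $\mathsf P^*$ the following are mutually independent: a standard Brownian motion $W^*$; a compound Poisson process $J_t=\sum_{k=1}^{N_{1,t}}A_k$, where $N_1$ has intensity $\lambda_1>0$ and the $A_k$ are i.i.d. Erlang with shape $\alpha\in\{1,2,\dots\}$ and rate $\beta>0$ (density $\beta^\alpha x^{\alpha-1}e^{-\beta x}/(\alpha-1)!$, $x\ge0$), independent of $N_1$; a compound Poisson process with Poisson counting process $N_2$ of intensity $\lambda_2>0$ and i.i.d. jumps $V_k\sim\mathcal N(\mu_V,\sigma_V^2)$, $\mu_V\in\mathbb R$, $\sigma_V>0$; a unit-intensity Poisson process $N_3$. All driving processes, including $N_{3,\Lambda}$ below, are $\mathbb F$-adapted; $\mathbb F$ is the (enlarged) natural filtration generated by them. The increments of $W^*$, $J$ and the $N_2$-compound process after any time $t_0$ are independent of $\mathscr F_{t_0}$. **Intervention intensity.** $\lambda_{3,t}=\lambda^{(1)}_{3,t}+\lambda^{(2)}_{3,t}$, with $\lambda^{(1)}_{3,t}=(\kappa^{(1)}t+\varsigma^{(1)}W^*_t)^2$ and $d\lambda^{(2)}_{3,t}=-\kappa^{(2)}\lambda^{(2)}_{3,t-}dt+\varsigma^{(2)}\,d\sum_{k=1}^{N_{2,t}}h(V_k^-)$, where $\kappa^{(1)},\kappa^{(2)},\varsigma^{(2)},\lambda^{(2)}_{3,0}>0$,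 $\varsigma^{(1)}<0$, $x^-=-\min\{x,0\}$, and $h:\mathbb R_+\to\mathbb R_+$ is a given increasing function. Put $\Lambda_t=\int_0^t\lambda_{3,s}ds$; $N_{3,\Lambda_t}$ is the time-changed Poisson process (a Cox process with intensity $\lambda_3$). **CET1 ratio and triggers.** The CET1 ratio $B$ satisfies $1-B_t=\frac1\pi\arctan\bigl(J_t-\cot(\pi(1-B_0))-\lambda_1\alpha t/\beta\bigr)+\frac12$ with $B_0\in(0,1)$. Given a threshold $\underline B\in(0,B_0)$, let $b=\cot(\pi\underline B)+\cot(\pi(1-B_0))$ (this is the corresponding upper barrier for $J_t-\lambda_1\alpha t/\beta$). Let $T>0$ be the expiry, $\tau_1=\inf\{t\in(0,T]:B_t<\underline B\}$, $\tau_3=\inf\{t\ge0:N_{3,\Lambda_t}=1\}$, and let the default time be $\tau=\inf\{t\in(0,T]:B_t<\underline B\text{ or }N_{3,\Lambda_t}=1\}$ (the smaller of $\tau_1,\tau_3$ when it is at most $T$, else $\infty$; $\inf\emptyset=\infty$). **Functions.** $\bar J_t=\sup_{s\in[0,t]}\{J_s-\lambda_1\alpha s/\beta\}$; $P_{t_0}(t,x)=\mathsf P^*[\bar J_t>x\mid\mathscr F_{t_0}]$; $E^*_{t_0}(t,u)=\mathsf E^*\bigl[e^{-u\int_{t_0}^t\lambda_{3,v}dv}\mid\mathscr F_{t_0}\bigr]$, $u\ge0$. **Write-down CoCo.** The short rate $r$ is deterministic (possibly time-varying). The CoCo has face value $K$, coupons $c_1,\dots,c_M$ at dates $t_1,\dots,t_M\in(0,T]$.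 Coupon $c_i$ is paid at $t_i$ if $\tau>t_i$; $K$ is paid at $T$ if $\tau>T$; if $\tau\le T$, the CoCo terminates at $\tau$ paying $KR$ with recovery rate $R=\varpi(1-w)\mathbf 1_{\{\tau_1<\tau_3\}}$, where $\varpi\in(0,1]$ and $w\in[0,1]$ are constants. Its time-$t_0$ value on $\{\tau>t_0\}$ is the $\mathsf P^*$-conditional expectation given $\mathscr F_{t_0}$ of all its cash flows after $t_0$, each discounted from its payment time $t$ by $e^{-\int_{t_0}^{t}r_vdv}$. *)

(* Defs.v *)
From HB Require Import structures.
From mathcomp Require Export all_boot all_order all_algebra.
From mathcomp Require Export finmap.
From mathcomp Require Export all_classical all_reals all_analysis.

Set Implicit Arguments.
Unset Strict Implicit.
Unset Printing Implicit Defensive.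

Import Order.TTheory GRing.Theory Num.Theory.
Import numFieldNormedType.Exports.

Local Open Scope classical_set_scope.
Local Open Scope ring_scope.

Section sigma_algebras.
Context {d : measure_display} {Omega : measurableType d} {R : realType}.
Variable P : probability Omega R.
Implicit Types (F G H : set (set Omega)).

Definition sigma_gen {d'} {U : measurableType d'} {I : Type}
    (D : set I) (X : I -> Omega -> U) : set (set Omega) :=
  <<s \bigcup_(i in D) g_sigma_algebra_preimage (X i) >>.

Definition independent G H : Prop :=
  forall A B, G A -> H B -> P (A `&` B) = (P A * P B)%E.

Definition mutually_independent {I : choiceType} (G : I -> set (set Omega)) :
    Prop :=
  forall (s : {fset I}) (A : I -> set Omega), (forall i, i \in s -> G i (A i)) ->
    P (\bigcap_(i in [set` s]) A i) = (\prod_(i <- s) P (A i))%E.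

Definition has_law {d'} {U : measurableType d'} (X : Omega -> U)
    (mu : set U -> \bar R) : Prop :=
  measurable_fun setT X /\
  forall B, measurable B -> P (X @^-1` B) = mu B.

(* Y is a version of the conditional expectation of X given G; the conditional
   probability of an event is the case where X is its indicator. *)
Definition is_cond_exp G (X Y : Omega -> R) : Prop :=
  [/\ P.-integrable setT (EFin \o X),
      P.-integrable setT (EFin \o Y),
      g_sigma_algebra_preimage Y `<=` G &
      forall A, G A ->
        (\int[P]_(w in A) (Y w)%:E = \int[P]_(w in A) (X w)%:E)%E].

Record is_filtration_usual (F : R -> set (set Omega)) : Prop := {
  filtration_sigma : forall t, 0 <= t -> sigma_algebra setT (F t);
  filtration_sub : forall t, 0 <= t -> F t `<=` measurable;
  filtration_mono : forall s t, 0 <= s -> s <= t -> F s `<=` F t;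
  filtration_complete : measure_is_complete P;
  filtration_null : P.-negligible `<=` F 0;
  filtration_rcont :
    forall t, 0 <= t -> \bigcap_(s in [set s | t < s]) F s `<=` F t }.

Definition usual_augmentation (F : R -> set (set Omega)) (t : R) :
    set (set Omega) :=
  \bigcap_(s in [set s | t < s]) <<s F s `|` P.-negligible >>.

End sigma_algebras.

(* Processes are indexed by all of R; only times t >= 0 are ever constrained
   or used. *)
Section processes.
Context {d : measure_display} {Omega : measurableType d} {R : realType}.
Variable P : probability Omega R.

Record is_brownian_motion (W : R -> Omega -> R) : Prop := {
  bm_measurable : forall t, 0 <= t -> measurable_fun setT (W t);
  bm_start : {ae P, forall w, W 0 w = 0};
  bm_continuous :
    {ae P, forall w, {within `[0, +oo[, continuous (fun t => W t w)}};
  bm_law : forall s t, 0 <= s -> s < t ->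
    has_law P (W t \- W s) (normal_prob 0 (Num.sqrt (t - s)));
  bm_independent : forall s t, 0 <= s -> s < t ->
    independent P (sigma_gen `[0, s] W)
                  (g_sigma_algebra_preimage (W t \- W s)) }.

Record is_poisson_process (rate : R) (N : R -> Omega -> nat) : Prop := {
  poisson_measurable : forall t, 0 <= t -> measurable_fun setT (N t);
  poisson_start : {ae P, forall w, N 0 w = 0%N};
  poisson_nondecreasing :
    {ae P, forall w, forall s t, 0 <= s -> s <= t -> (N s w <= N t w)%N};
  poisson_rcont :
    {ae P, forall w, forall t, 0 <= t -> N s w @[s --> t^'+] --> N t w};
  poisson_law : forall s t (k : nat), 0 <= s -> s < t ->
    P [set w | (N t w - N s w)%N = k]
      = (poisson_pmf (rate * (t - s)) k)%:E;
  poisson_independent : forall s t, 0 <= s -> s < t ->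
    independent P (sigma_gen `[0, s] N)
                  (g_sigma_algebra_preimage (fun w => (N t w - N s w)%N)) }.

(* Jumps are numbered from 0: [A k] is the (k+1)-st one. *)
Definition compound (N : R -> Omega -> nat) (A : nat -> Omega -> R)
    (t : R) (w : Omega) : R :=
  \sum_(k < N t w) A k w.

Record is_compound_poisson (rate : R) (mu : set R -> \bar R)
    (N : R -> Omega -> nat) (A : nat -> Omega -> R) : Prop := {
  compound_counting : is_poisson_process rate N;
  compound_law : forall k, has_law P (A k) mu;
  compound_independent : mutually_independent P
    (fun o : option nat => if o is Some k then g_sigma_algebra_preimage (A k)
                           else sigma_gen `[0, +oo[ N) }.

Definition cadlag (x : R -> R) : Prop :=
  (forall t, 0 <= t -> x s @[s --> t^'+] --> x t) /\
  (forall t, 0 < t -> cvg (x s @[s --> t^'-])).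

End processes.

Definition erlang_pdf {R : realType} (alpha : nat) (beta x : R) : R :=
  if 0 <= x then
    beta ^+ alpha * x ^+ alpha.-1 * expR (- (beta * x)) / alpha.-1`!%:R
  else 0.

Definition erlang_prob {R : realType} (alpha : nat) (beta : R) (U : set R) :
    \bar R :=
  (\int[lebesgue_measure]_(x in U) (erlang_pdf alpha beta x)%:E)%E.

Definition cot {R : realType} (x : R) : R := cos x / sin x.

Definition neg_part {R : realType} (x : R) : R := - Order.min x 0.

Record coco_params (R : realType) := CoCoParams {
  lam1 : R; alpha : nat; beta : R;
  lam2 : R; muV : R; sigV : R;
  kap1 : R; vsig1 : R;
  kap2 : R; vsig2 : R; lam20 : R; jump_effect : R -> R;
  B0 : R; Bmin : R;
  expiry : R;
  face : R;
  ncoupon : nat; coupon : 'I_ncoupon -> R; coupon_date : 'I_ncoupon -> R;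
  varpi : R; writedown : R;
  rate : R -> R }.
Arguments coupon {R} _ _.
Arguments coupon_date {R} _ _.

Record admissible {R : realType} (p : coco_params R) : Prop := {
  lam1_gt0 : 0 < lam1 p;
  alpha_gt0 : (0 < alpha p)%N;
  beta_gt0 : 0 < beta p;
  lam2_gt0 : 0 < lam2 p;
  sigV_gt0 : 0 < sigV p;
  kap1_gt0 : 0 < kap1 p;
  vsig1_lt0 : vsig1 p < 0;
  kap2_gt0 : 0 < kap2 p;
  vsig2_gt0 : 0 < vsig2 p;
  lam20_gt0 : 0 < lam20 p;
  jump_effect_ge0 : forall x, 0 <= x -> 0 <= jump_effect p x;
  jump_effect_incr : forall x y, 0 <= x -> x <= y -> jump_effect p x <= jump_effect p y;
  B0_01 : 0 < B0 p < 1;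
  Bmin_B0 : 0 < Bmin p < B0 p;
  expiry_gt0 : 0 < expiry p;
  coupon_date_itv : forall i, 0 < coupon_date p i <= expiry p;
  varpi_itv : 0 < varpi p <= 1;
  writedown_itv : 0 <= writedown p <= 1;
  rate_integrable : (@lebesgue_measure R).-integrable
    `[0, expiry p] (EFin \o rate p) }.

Section model.
Context {d : measure_display} {Omega : measurableType d} {R : realType}.

(* [intensity2] is the jump component of the intervention intensity. *)
Record drivers := Drivers {
  brownian : R -> Omega -> R;
  count1 : R -> Omega -> nat; jump1 : nat -> Omega -> R;
  count2 : R -> Omega -> nat; jump2 : nat -> Omega -> R;
  unit_poisson : R -> Omega -> nat;
  intensity2 : R -> Omega -> R }.

Variables (P : probability Omega R) (p : coco_params R) (X : drivers).

Definition procJ : R -> Omega -> R := compound (count1 X) (jump1 X).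

Definition procY : R -> Omega -> R := compound (count2 X) (jump2 X).

Definition Jcomp (t : R) (w : Omega) : R :=
  procJ t w - lam1 p * (alpha p)%:R * t / beta p.

Definition Jbar (t : R) (w : Omega) : R :=
  sup [set Jcomp s w | s in `[0, t]].

Definition lambda3 (t : R) (w : Omega) : R :=
  (kap1 p * t + vsig1 p * brownian X t w) ^+ 2 + intensity2 X t w.

Definition cumulative_intensity (s t : R) (w : Omega) : R :=
  \int[lebesgue_measure]_(v in `[s, t]) lambda3 v w.

Definition N3Lambda (t : R) (w : Omega) : nat :=
  unit_poisson X (cumulative_intensity 0 t w) w.

(* Integrated form of
   dx_t = - kap2 x_(t-) dt + vsig2 d(sum_(k <= N2_t) h(V_k^-)),
   x = intensity2, h = jump_effect. *)
Definition jump_intensity_eq : Prop :=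
  {ae P, forall w, cadlag (fun t => intensity2 X t w) /\
    forall t, 0 <= t ->
      intensity2 X t w =
        lam20 p
        - kap2 p * \int[lebesgue_measure]_(s in `]0, t])
                      lim (intensity2 X u w @[u --> s^'-])
        + vsig2 p *
          compound (count2 X)
            (fun k w' => jump_effect p (neg_part (jump2 X k w'))) t w}.

Definition CET1 (t : R) (w : Omega) : R :=
  1 - (pi^-1 * atan (procJ t w - cot (pi * (1 - B0 p))
                     - lam1 p * (alpha p)%:R * t / beta p) + 2^-1).

Definition barrier : R := cot (pi * Bmin p) + cot (pi * (1 - B0 p)).

Definition tau1 (w : Omega) : \bar R :=
  ereal_inf [set t%:E | t in [set t | 0 < t <= expiry p /\ CET1 t w < Bmin p]].

Definition tau3 (w : Omega) : \bar R :=
  ereal_inf [set t%:E | t in [set t : R | 0 <= t /\ N3Lambda t w = 1%N]].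

Definition tau (w : Omega) : \bar R :=
  ereal_inf [set t%:E | t in [set t | 0 < t <= expiry p /\
                                (CET1 t w < Bmin p \/ N3Lambda t w = 1%N)]].

(* Independence of the two compound Poisson processes from the other drivers
   is expressed on their counting processes together with their jumps. *)
Record drivers_spec : Prop := {
  W_bm : is_brownian_motion P (brownian X);
  J_cp : is_compound_poisson P (lam1 p) (erlang_prob (alpha p) (beta p))
           (count1 X) (jump1 X);
  Y_cp : is_compound_poisson P (lam2 p) (normal_prob (muV p) (sigV p))
           (count2 X) (jump2 X);
  N3_pp : is_poisson_process P 1 (unit_poisson X);
  intensity2_eq : jump_intensity_eq;
  drivers_independent : mutually_independent P
    (tnth [tuple sigma_gen `[0, +oo[ (brownian X);
                 <<s sigma_gen `[0, +oo[ (count1 X) `|` sigma_gen setT (jump1 X) >>;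
                 <<s sigma_gen `[0, +oo[ (count2 X) `|` sigma_gen setT (jump2 X) >>;
                 sigma_gen `[0, +oo[ (unit_poisson X)]) }.

Definition natural_filtration (t : R) : set (set Omega) :=
  <<s sigma_gen `[0, t] (brownian X) `|` sigma_gen `[0, t] procJ `|`
      sigma_gen `[0, t] procY `|` sigma_gen `[0, t] N3Lambda >>.

Definition future_increments (t : R) : set (set Omega) :=
  <<s sigma_gen `[t, +oo[ (fun u => brownian X u \- brownian X t) `|`
      sigma_gen `[t, +oo[ (fun u => procJ u \- procJ t) `|`
      sigma_gen `[t, +oo[ (fun u => procY u \- procY t) >>.

(* The unit-intensity process itself is not adapted: only N3Lambda is observed. *)
Record filtration_spec (F : R -> set (set Omega)) : Prop := {
  F_usual : is_filtration_usual P F;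
  F_enlarged :
    forall t, 0 <= t -> F t = usual_augmentation P natural_filtration t;
  F_increments :
    forall t, 0 <= t -> independent P (F t) (future_increments t) }.

Definition discount (t0 t : R) : R :=
  expR (- \int[lebesgue_measure]_(v in `[t0, t]) rate p v).

Definition recovery (w : Omega) : R :=
  varpi p * (1 - writedown p) * (tau1 w < tau3 w)%E%:R.

Definition cash_flows (t0 : R) (w : Omega) : R :=
  \sum_(i < ncoupon p) coupon p i * discount t0 (coupon_date p i)
     * (t0 < coupon_date p i)%R%:R * ((coupon_date p i)%:E < tau w)%E%:R
  + face p * discount t0 (expiry p) * ((expiry p)%:E < tau w)%E%:R
  + face p * recovery w * discount t0 (fine (tau w))
     * (t0%:E < tau w <= (expiry p)%:E)%E%:R.

(* [Pf x w t] is a version of P[Jbar_t > x | G], for G = F_t0, that is regular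
   in time: for every x and w, t |-> Pf x w t is nondecreasing and
   right-continuous, hence has a Lebesgue-Stieltjes measure. *)
Definition is_crossing_prob (G : set (set Omega))
    (Pf : R -> Omega -> cumulative R R) : Prop :=
  forall t x, 0 <= t ->
    is_cond_exp P G (\1_[set w | x < Jbar t w]) (fun w => Pf x w t).

(* [Ef t u] is a version of E[exp(- u \int_t0^t lambda3) | G], for G = F_t0,
   right-continuous in t. *)
Definition is_survival_transform (G : set (set Omega)) (t0 : R)
    (Ef : R -> R -> Omega -> R) : Prop :=
  (forall t u, t0 <= t -> 0 <= u ->
    is_cond_exp P G (fun w => expR (- (u * cumulative_intensity t0 t w)))
      (Ef t u)) /\
  (forall u w t, 0 <= u -> t0 <= t -> Ef s u w @[s --> t^'+] --> Ef t u w).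

End model.
Arguments drivers {d} Omega R.

(* Main.v *)
(* Up to null sets, {tau > t} = {sup_[0,t] Jcomp <= b} /\ {N3Lambda_t = 0}, since the
   loss process only decreases between its jumps and the jumps of a Poisson process
   have size 1.  Let A be in F_t0.  On {N3Lambda_s = 0} with s > t0 the event A agrees
   with one generated by W, N2, V and the losses up to s, so the unit Poisson process,
   independent of the other drivers, can be integrated out: the indicator of
   {N3Lambda_t = 0} becomes 1_{N3Lambda_t0 = 0} exp(- int_t0^t lambda3).  In the same
   way the losses after t0 are independent of A and of the intensity, which turns the
   indicator of {Jbar_t' <= b} into 1 - P_t0(t', b).  Hence, for t0 <= t' <= t,
   E[1_A 1_{Jbar_t' <= b} 1_{N3Lambda_t = 0}]
     = E[1_A 1_{N3Lambda_t0 = 0} (1 - P_t0(t', b)) E_t0(t, 1)].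
   With t' = t this values the coupons and the face.  The recovery payment is the limit
   over grids t0 = s_0 < ... < s_n = T of
   sum_i D(s_i) (1_{Jbar_s_(i-1) <= b} - 1_{Jbar_s_i <= b}) 1_{N3Lambda_s_i = 0},
   whose valuation is a Stieltjes sum for D(s) E_t0(s, 1) d_s P_t0(s, b). *)
Require Import Defs.
From mathcomp Require Import ring lra measurable_realfun.

Set Implicit Arguments.
Unset Strict Implicit.
Unset Printing Implicit Defensive.

Import Order.TTheory GRing.Theory Num.Theory.
Import numFieldNormedType.Exports.

Local Open Scope classical_set_scope.
Local Open Scope ring_scope.

(** * Riemann sums and bounded convergence *)

(** The filtration is right-continuous, so an event of [F t0] is described by the sources only up to
    each [s > t0], never at [t0] itself. Identities at [t0] are therefore proved at times decreasing
    to [t0] and carried over by right-continuity of the paths. Integrating out the unit Poisson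
    process means evaluating it at a random clock; integrating out later losses means evaluating
    their law at the random headroom below the barrier. The lemma [freeze] covers both. For the
    clock to be independent of the unit Poisson process, the intensity must be measurable with
    respect to the Brownian motion and the second compound process, which the Euler scheme extracts
    from the pathwise equation. [Pf] and [Ef] are versions, tied to the model only almost surely at
    each fixed time. Grid sums involve countably many times, hence one null set, and regularity in
    time does the rest. Conditional probabilities are clipped to [0, 1] so that bounded convergence
    applies throughout. *)

Section grid.
Context {R : realType}.
Implicit Types (a b y : R) (v : nat -> R).

Definition gridpt a b (n i : nat) : R := a + (b - a) * (i%:R / n%:R).

(** Open on the left and closed on the right, the shape to which a Lebesgue-Stieltjes measure gives
    the plain increment of a right-continuous function. *)
Definition cell a b n i : set R := `]gridpt a b n i, gridpt a b n i.+1]%classic.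

Definition stepfun a b n v y := \sum_(i < n) v i * \1_(cell a b n i) y.

Lemma gridpt0 a b n : gridpt a b n 0 = a.
Proof. by rewrite /gridpt mul0r mulr0 addr0. Qed.

Lemma gridptn a b n : (0 < n)%N -> gridpt a b n n = b.
Proof.
by move=> n0; rewrite /gridpt divff ?pnatr_eq0 -?lt0n// mulr1 subrKC.
Qed.

Lemma gridptS a b n i :
  gridpt a b n i.+1 = gridpt a b n i + (b - a) / n%:R.
Proof. by rewrite /gridpt -natr1; ring. Qed.

Lemma gridpt_le a b n i j : a <= b -> (i <= j)%N ->
  gridpt a b n i <= gridpt a b n j.
Proof.
move=> ab ij; rewrite lerD2l ler_wpM2l ?subr_ge0//.
by rewrite ler_wpM2r ?invr_ge0// ler_nat.
Qed.

Lemma gridpt_ge a b n i : a <= b -> a <= gridpt a b n i.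
Proof. by move=> ab; rewrite -[leLHS](gridpt0 a b n) gridpt_le. Qed.

Lemma gridpt_itv a b n i : a <= b -> (0 < n)%N -> (i <= n)%N ->
  a <= gridpt a b n i <= b.
Proof.
move=> ab n0 i_n; rewrite gridpt_ge//= -[leRHS](gridptn a b n0).
exact: gridpt_le.
Qed.

Lemma gridpt_cell a b n y : (0 < n)%N -> a < y <= b ->
  exists i, (i < n)%N /\ gridpt a b n i < y <= gridpt a b n i.+1.
Proof.
move=> n0 /andP[ay yb].
have ex : exists k, y <= gridpt a b n k.+1.
  by exists n.-1; rewrite prednK// gridptn.
(* The least index whose right end reaches [y]: minimality puts the left end strictly below [y]. *)
case: (ex_minnP ex) => k yk kmin; exists k; split.
  rewrite -[n in (_ < n)%N]prednK// ltnS; apply: kmin.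
  by rewrite prednK// gridptn.
rewrite yk andbT; case: k kmin {yk} => [|k] kmin; first by rewrite gridpt0.
by rewrite ltNge; apply/negP => /kmin; rewrite ltnn.
Qed.

Lemma stepfun_cell a b n i y v : a <= b -> (i < n)%N ->
  gridpt a b n i < y <= gridpt a b n i.+1 -> stepfun a b n v y = v i.
Proof.
move=> ab i_n iy.
rewrite /stepfun (bigD1 (Ordinal i_n))//= indicE mem_set ?mulr1; last first.
  by rewrite /cell/= in_itv.
rewrite big1 ?addr0// => j ji; rewrite indicE memNset ?mulr0//.
rewrite /cell/= in_itv/= => /andP[jy yj]; case/andP: iy => iy yi.
have [ij|ij|/eqP] := ltngtP i j; last by move=> e; move: ji; rewrite -val_eqE/= eq_sym e.
- by have := le_lt_trans yi (le_lt_trans (gridpt_le n ab ij) jy); rewrite ltxx.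
- by have := le_lt_trans yj (le_lt_trans (gridpt_le n ab ij) iy); rewrite ltxx.
Qed.

Lemma stepfunE a b n y : (0 < n)%N -> a < y <= b ->
  exists i, [/\ (i < n)%N, gridpt a b n i < y <= gridpt a b n i.+1 &
    forall v, stepfun a b n v y = v i].
Proof.
move=> n0 aby; have [i [i_n iy]] := gridpt_cell n0 aby; exists i; split=> // v.
by apply: stepfun_cell => //; case/andP: aby => /ltW /le_trans; apply.
Qed.

Lemma cell_ptE a b n i y : a <= b -> (0 < n)%N ->
    gridpt a b n i < y <= gridpt a b n i.+1 ->
  `|gridpt a b n i.+1 - y| <= (b - a) / n%:R /\
  `|gridpt a b n i - y| <= (b - a) / n%:R.
Proof.
move=> ab n0; rewrite gridptS => /andP[]; move: (gridpt a b n i) => p.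
have : 0 <= (b - a) / n%:R by rewrite divr_ge0// subr_ge0.
by move: (_ / _) => e e0 py yp; split; rewrite ler_norml; lra.
Qed.

Lemma mesh_cvg0 a b : (b - a) / n%:R @[n --> \oo] --> (0 : R).
Proof.
rewrite -(mulr0 (b - a)); apply: cvgMr.
apply/gtr0_cvgV0; last exact: cvgr_idn.
by near=> n; rewrite ltr0n; near: n; exact: nbhs_infty_gt.
Unshelve. all: by end_near. Qed.

(** Only the cell containing [y] contributes, so it is enough to control one value per grid as the
    mesh shrinks. *)
Lemma stepfun_cvg a b y (v : nat -> nat -> R) (l : R) : a < y <= b ->
  (forall e : R, 0 < e -> exists2 dl : R, 0 < dl & forall n i, (i < n)%N ->
     gridpt a b n i < y <= gridpt a b n i.+1 -> (b - a) / n%:R < dl ->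
     `|v n i - l| <= e) ->
  stepfun a b n (v n) y @[n --> \oo] --> l.
Proof.
move=> aby H; apply/cvgrPdist_le => e e0; have [dl dl0 {}H] := H _ e0.
have h0 := mesh_cvg0 a b; move/cvgrPdist_lt : h0 => /(_ _ dl0) h0.
near=> n.
have n0 : (0 < n)%N by near: n; exact: nbhs_infty_gt.
have [i [i_n iy ->]] := stepfunE n0 aby.
rewrite distrC; apply: H => //.
have : `|0 - (b - a) / n%:R| < dl by near: n.
by rewrite sub0r normrN; apply: le_lt_trans; exact: ler_norm.
Unshelve. all: by end_near. Qed.

(** Right end points approach [y] from the right or equal it; the second case is separate because
    [y^'+] omits [y]. *)
Lemma stepfun_right_cvg a b y (v : R -> R) : a < y <= b ->
  v x @[x --> y^'+] --> v y ->
  stepfun a b n (fun i => v (gridpt a b n i.+1)) y @[n --> \oo] --> v y.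
Proof.
move=> aby vy; apply: stepfun_cvg => // e e0.
move/cvgrPdist_le : vy => /(_ _ e0) [dl /= dl0 H]; exists dl => // n i i_n iy dln.
have ab : a <= b by case/andP: aby => /ltW /le_trans; apply.
case/andP : (iy) => _; rewrite le_eqVlt => /predU1P[<-|yi].
  by rewrite subrr normr0 ltW.
rewrite distrC; apply: H => //=; rewrite distrC.
by apply: le_lt_trans dln; have [] := cell_ptE ab (leq_ltn_trans (leq0n _) i_n) iy.
Qed.

(** Left end points are strictly below [y], so sampling there produces left limits, as in the drift
    of the intensity equation. *)
Lemma stepfun_left_cvg a b y (v : R -> R) (l : R) : a < y <= b ->
  v x @[x --> y^'-] --> l ->
  stepfun a b n (fun i => v (gridpt a b n i)) y @[n --> \oo] --> l.
Proof.
move=> aby vy; apply: stepfun_cvg => // e e0.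
move/cvgrPdist_le : vy => /(_ _ e0) [dl /= dl0 H]; exists dl => // n i i_n iy dln.
have ab : a <= b by case/andP: aby => /ltW /le_trans; apply.
case/andP : (iy) => yi _.
rewrite distrC; apply: H => //=; rewrite distrC.
by apply: le_lt_trans dln; have [] := cell_ptE ab (leq_ltn_trans (leq0n _) i_n) iy.
Qed.

Lemma measurable_stepfun a b n v D : measurable_fun D (stepfun a b n v).
Proof.
apply: measurable_sum => i; apply: measurable_funM => //.
by apply: measurable_indic; exact: measurable_itv.
Qed.

Lemma stepfun_bound a b n v y (M : R) : 0 <= M -> (forall i, (i < n)%N -> `|v i| <= M) ->
  `|stepfun a b n v y| <= M.
Proof.
move=> M0 vM; case: n vM => [|n] vM.
  by rewrite /stepfun big_ord0 normr0.
have [aby|aby] := boolP (a < y <= b).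
  by have [i [i_n _ ->]] := stepfunE (ltn0Sn n) aby; exact: vM.
rewrite /stepfun big1 ?normr0// => i _; rewrite indicE memNset ?mulr0//.
rewrite /cell/= in_itv/= => iy; move/negP : aby; apply.
have ab : a <= b.
  rewrite leNgt; apply/negP => ba; case/andP: iy => /lt_le_trans /[apply].
  rewrite gridptS -subr_gt0 addrC addKr pmulr_lgt0 ?invr_gt0//.
  by rewrite subr_gt0 ltNge (ltW ba).
case/andP: iy => iy yi; apply/andP; split.
  by apply: le_lt_trans iy; exact: gridpt_ge.
apply: (le_trans yi).
by have /andP[] := gridpt_itv ab (ltn0Sn n) (ltn_ord i).
Qed.

End grid.

Section bounded_convergence.
Context d (T : measurableType d) (R : realType).
Variables (mu : {measure set T -> \bar R}) (D : set T).
Hypothesis mD : measurable D.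
Hypothesis muD : (mu D < +oo)%E.

Lemma bounded_integrable (f : T -> R) (M : R) : measurable_fun D f ->
  (forall x, D x -> `|f x| <= M) -> mu.-integrable D (EFin \o f).
Proof.
move=> mf fM; apply: measurable_bounded_integrable => //.
exists M; split; first exact: num_real.
by move=> x Mx y Dy; rewrite /= (le_trans (fM _ Dy))// ltW.
Qed.

Lemma bounded_Rintegral_cvg (f_ : nat -> T -> R) (f : T -> R) (M : R) :
  (forall n, measurable_fun D (f_ n)) -> measurable_fun D f ->
  (forall n x, D x -> `|f_ n x| <= M) ->
  {ae mu, forall x, D x -> f_ n x @[n --> \oo] --> f x} ->
  \int[mu]_(x in D) f_ n x @[n --> \oo] --> \int[mu]_(x in D) f x.
Proof.
move=> mf_ mf fM ff.
have [] := @dominated_convergence _ _ _ mu D mD (fun n => EFin \o f_ n)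
  (EFin \o f) (cst M%:E).
- by move=> n; exact/measurable_EFinP.
- exact/measurable_EFinP.
- by apply: filterS ff => x + Dx => /(_ Dx) fx; apply/cvg_EFin => //; near=> n.
- apply: (@bounded_integrable (cst M) `|M|); first exact: measurable_cst.
  by move=> x _.
- by apply: aeW => x n Dx /=; rewrite lee_fin; exact: fM.
move=> intf _ h; apply: fine_cvg; rewrite /Rintegral fineK//.
exact: integrable_fin_num.
Unshelve. all: by end_near. Qed.

End bounded_convergence.

Lemma norm_indic_le1 {R : realType} T (A : set T) x : `|\1_A x : R| <= 1.
Proof. by rewrite indicE; case: (_ \in _); rewrite ?normr1 ?normr0 ?ler01. Qed.

Section riemann.
Context {R : realType}.

Lemma Rintegral_sum d (T : measurableType d) (mu : {measure set T -> \bar R})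
    (D : set T) (I : Type) (s : seq I) (h : I -> T -> R) : measurable D ->
  (forall i, mu.-integrable D (EFin \o h i)) ->
  \int[mu]_(x in D) (\sum_(i <- s) h i x) = \sum_(i <- s) \int[mu]_(x in D) h i x.
Proof.
move=> mD ih; have isum r : mu.-integrable D (EFin \o (fun x => \sum_(i <- r) h i x)).
  have := @integrable_sum _ _ _ mu D mD I r xpredT (fun i => EFin \o h i).
  move=> /(_ (fun i _ => ih i)); apply: eq_integrable => // x _ /=.
  by rewrite sumEFin.
elim: s => [|i s IH].
  under eq_Rintegral do rewrite big_nil.
  by rewrite big_nil Rintegral_cst// mul0r.
under eq_Rintegral do rewrite big_cons.
by rewrite RintegralD// IH big_cons.
Qed.

Lemma Rintegral_indic_scale d (T : measurableType d) (mu : {measure set T -> \bar R})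
    (D A : set T) (c : R) : measurable D -> measurable A -> (mu D < +oo)%E ->
  \int[mu]_(x in D) (c * \1_A x) = c * fine (mu (A `&` D)).
Proof.
move=> mD mA muD; rewrite RintegralZl//; last first.
  apply: (bounded_integrable mD muD (M := 1)); first exact: measurable_indic.
  by move=> x _; exact: norm_indic_le1.
by congr (c * _); rewrite /Rintegral integral_indic.
Qed.

Variable mu : {measure set (measurableTypeR R) -> \bar R}.

(** A Riemann sum is the integral of a step function, so bounded convergence applies. Measurability
    of [f] comes out as a conclusion, [f] being a limit of step functions. The measure is arbitrary
    in order to serve both Lebesgue integrals in time and Stieltjes integrals against the crossing
    probability. *)
Lemma riemann_cvg (a b M : R) (v : nat -> nat -> R) (f : R -> R) :
  (mu `]a, b]%classic < +oo)%E -> 0 <= M ->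
  (forall n i, (i < n)%N -> `|v n i| <= M) ->
  (forall y, a < y <= b -> stepfun a b n (v n) y @[n --> \oo] --> f y) ->
  measurable_fun `]a, b] f /\
  \sum_(i < n) v n i * fine (mu (cell a b n i)) @[n --> \oo] -->
    \int[mu]_(x in `]a, b]) f x.
Proof.
move=> muab M0 vM vf.
have mf : measurable_fun `]a, b] f.
  apply: (measurable_fun_cvg (h := fun n => stepfun a b n (v n))).
    by move=> n; exact: measurable_stepfun.
  by move=> y; rewrite /= in_itv/=; exact: vf.
split=> //.
have [ab|ba] := leP a b; last first.
  have e0 : `]a, b]%classic = set0 by rewrite set_itv_ge// bnd_simp -leNgt ltW.
  rewrite e0 Rintegral_set0.
  rewrite [X in X @ _ --> _](_ : _ = cst 0); first exact: cvg_cst.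
  apply/funext => n /=; rewrite big1// => i _.
  rewrite /cell set_itv_ge ?measure0 ?mulr0// bnd_simp -leNgt gridptS.
  by rewrite gerDl mulr_le0_ge0 ?invr_ge0// subr_le0 ltW.
have -> : (fun n => \sum_(i < n) v n i * fine (mu (cell a b n i))) =
  (fun n => \int[mu]_(x in `]a, b]) stepfun a b n (v n) x).
  apply/funext => n; rewrite /stepfun Rintegral_sum//.
    apply: eq_bigr => i _; rewrite Rintegral_indic_scale//; last first.
      exact: measurable_itv.
    congr (_ * fine (mu _)); apply/esym/setIidl => y.
    rewrite /cell/= !in_itv/= => /andP[y1 y2].
    have n0 := leq_ltn_trans (leq0n _) (ltn_ord i).
    apply/andP; split; first exact: le_lt_trans (gridpt_ge _ _ ab) y1.
    by apply: (le_trans y2); have /andP[] := gridpt_itv ab n0 (ltn_ord i).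
  move=> i; apply: (@bounded_integrable _ _ _ mu _ _ _ _ `|v n i|) => //.
    apply: measurable_funM => //; apply: measurable_indic; exact: measurable_itv.
  by move=> x _; rewrite normrM ler_piMr// norm_indic_le1.
apply: (@bounded_Rintegral_cvg _ _ _ mu `]a, b] _ muab _ _ M) => //.
- by move=> n; exact: measurable_stepfun.
- by move=> n x _; apply: stepfun_bound => // i; exact: vM.
- by apply: aeW => x; rewrite /= in_itv/=; exact: vf.
Qed.

End riemann.

Section expectation.
Context d (Omega : measurableType d) (R : realType) (P : probability Omega R).
Implicit Types (f g : Omega -> R) (A : set Omega).

Definition Ex f : R := \int[P]_w f w.

Definition bounded f := exists M : R, forall w, `|f w| <= M.

(** The bound holds everywhere rather than almost everywhere, which makes the class stable under
    products and every expectation finite. *)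
Definition bfun f := measurable_fun setT f /\ bounded f.

Let P_fin : (P setT < +oo)%E.
Proof. by rewrite probability_setT ltry. Qed.

Lemma bfun_integrable f : bfun f -> P.-integrable setT (EFin \o f).
Proof.
by move=> [mf [M fM]]; apply: (bounded_integrable measurableT P_fin mf) => w _.
Qed.

Lemma bounded_cst c : bounded (fun=> c).
Proof. by exists `|c|. Qed.

Lemma boundedD f g : bounded f -> bounded g -> bounded (fun w => f w + g w).
Proof.
move=> [M fM] [N gN]; exists (M + N) => w.
by rewrite (le_trans (ler_normD _ _))// lerD.
Qed.

Lemma boundedM f g : bounded f -> bounded g -> bounded (fun w => f w * g w).
Proof.
move=> [M fM] [N gN]; exists (M * N) => w.
by rewrite normrM ler_pM.
Qed.

Lemma bounded_indic A : bounded \1_A.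
Proof. by exists 1 => w; exact: norm_indic_le1. Qed.

Lemma bfun_cst c : bfun (fun=> c).
Proof. by split; [exact: measurable_cst|exact: bounded_cst]. Qed.

Lemma bfunD f g : bfun f -> bfun g -> bfun (fun w => f w + g w).
Proof.
by move=> [mf bf] [mg bg]; split; [exact: measurable_funD|exact: boundedD].
Qed.

Lemma bfunM f g : bfun f -> bfun g -> bfun (fun w => f w * g w).
Proof.
by move=> [mf bf] [mg bg]; split; [exact: measurable_funM|exact: boundedM].
Qed.

Lemma bfunN f : bfun f -> bfun (fun w => - f w).
Proof.
move=> bf; have := bfunM (bfun_cst (-1)) bf.
by under eq_fun do rewrite mulN1r.
Qed.

Lemma bfunB f g : bfun f -> bfun g -> bfun (fun w => f w - g w).
Proof. by move=> bf bg; apply: bfunD => //; exact: bfunN. Qed.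

Lemma bfun_indic A : measurable A -> bfun \1_A.
Proof.
by move=> mA; split; [exact: measurable_indic|exact: bounded_indic].
Qed.

Lemma bfun_sum I (s : seq I) (h : I -> Omega -> R) :
  (forall i, bfun (h i)) -> bfun (fun w => \sum_(i <- s) h i w).
Proof.
move=> bh; elim: s => [|i s IH].
  by under eq_fun do rewrite big_nil; exact: bfun_cst.
by under eq_fun do rewrite big_cons; exact: bfunD.
Qed.

Lemma ExD f g : bfun f -> bfun g -> Ex (fun w => f w + g w) = Ex f + Ex g.
Proof. by move=> bf bg; rewrite /Ex RintegralD//; exact: bfun_integrable. Qed.

Lemma ExB f g : bfun f -> bfun g -> Ex (fun w => f w - g w) = Ex f - Ex g.
Proof. by move=> bf bg; rewrite /Ex RintegralB//; exact: bfun_integrable. Qed.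

Lemma ExZ c f : bfun f -> Ex (fun w => c * f w) = c * Ex f.
Proof. by move=> bf; rewrite /Ex RintegralZl//; exact: bfun_integrable. Qed.

Lemma Ex_sum I (s : seq I) (h : I -> Omega -> R) :
  (forall i, bfun (h i)) ->
  Ex (fun w => \sum_(i <- s) h i w) = \sum_(i <- s) Ex (h i).
Proof. by move=> bh; rewrite /Ex Rintegral_sum// => i; exact: bfun_integrable. Qed.

Lemma Ex_indic A : measurable A -> Ex \1_A = fine (P A).
Proof. by move=> mA; rewrite /Ex /Rintegral integral_indic// setIT. Qed.

Lemma Ex_ae f g : bfun f -> bfun g -> {ae P, forall w, f w = g w} -> Ex f = Ex g.
Proof.
move=> [mf _] [mg _] fg; congr fine; apply: ae_eq_integral => //.
- exact/measurable_EFinP.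
- exact/measurable_EFinP.
- by apply: filterS fg => w /= -> _.
Qed.

Lemma Ex_cvg (f_ : nat -> Omega -> R) f (M : R) :
  (forall n, measurable_fun setT (f_ n)) -> measurable_fun setT f ->
  (forall n w, `|f_ n w| <= M) ->
  {ae P, forall w, f_ n w @[n --> \oo] --> f w} ->
  Ex (f_ n) @[n --> \oo] --> Ex f.
Proof.
move=> mf_ mf fM ff; apply: (bounded_Rintegral_cvg _ _ mf_ mf (M := M)) => //.
by apply: filterS ff => w + _.
Qed.

End expectation.

Lemma limits_eq {R : realType} (u v : nat -> R) (l l' : R) :
  (forall n, u n = v n) ->
  u n @[n --> \oo] --> l -> v n @[n --> \oo] --> l' -> l = l'.
Proof.
move=> uv ul; rewrite -(_ : u = v); last exact/funext.
by move=> /cvg_lim <-//; apply/esym/cvg_lim.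
Qed.

(** * Measurability and independence with respect to sub-sigma-algebras *)

Section subsigma.
Context d (Omega : measurableType d) (R : realType) (P : probability Omega R).
Implicit Types (f g : Omega -> R) (A B : set Omega) (G : set (set Omega)).

Definition subsigma G := sigma_algebra setT G /\ G `<=` measurable.

(** Passing to the type whose sigma-algebra is generated by [G] makes the results on
    [measurable_fun] available for sub-sigma-algebras; [gmeasP] translates back. *)
Definition gmeas {d'} {U : sigmaRingType d'} G (f : Omega -> U) :=
  measurable_fun setT (f : g_sigma_algebraType G -> U).

Lemma gmeasP {d'} {U : sigmaRingType d'} G (f : Omega -> U) : sigma_algebra setT G ->
  gmeas G f <-> forall B : set U, measurable B -> G (f @^-1` B).
Proof.
move=> sG; split.
  move=> mf B mB; have := mf measurableT B mB; rewrite setTI.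
  by rewrite /measurable/= sigma_algebra_id.
move=> fG _ B mB; rewrite setTI /measurable/= sigma_algebra_id//; exact: fG.
Qed.

Lemma gmeas_set G (b : Omega -> bool) : sigma_algebra setT G ->
  measurable_fun setT (b : g_sigma_algebraType G -> bool) -> G [set w | b w].
Proof. by move=> sG /(gmeasP _ sG) /(_ [set true]); apply. Qed.

Lemma gmeas_sub G H {d'} {U : sigmaRingType d'} (f : Omega -> U) :
  sigma_algebra setT G -> sigma_algebra setT H -> G `<=` H ->
  gmeas G f -> gmeas H f.
Proof.
move=> sG sH GH /(gmeasP _ sG) fG; apply/(gmeasP _ sH) => B mB.
exact/GH/fG.
Qed.

Lemma gmeas_meas G {d'} {U : sigmaRingType d'} (f : Omega -> U) :
  subsigma G -> gmeas G f -> measurable_fun setT f.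
Proof.
by move=> [sG mG] /(gmeasP _ sG) fG _ B mB; rewrite setTI; exact/mG/fG.
Qed.

Lemma gmeas_indic G A : sigma_algebra setT G -> G A -> gmeas G (\1_A : Omega -> R).
Proof.
move=> sG GA; apply: measurable_indic.
by rewrite /measurable/= sigma_algebra_id.
Qed.

Lemma sigmaT G : sigma_algebra setT G -> G setT.
Proof. by case=> G0 GC _; rewrite -(setD0 setT); exact: GC. Qed.

Lemma sigmaC G A : sigma_algebra setT G -> G A -> G (~` A).
Proof. by case=> G0 GC _ /GC; rewrite setTD. Qed.

Lemma sigma_bigcup G (F : nat -> set Omega) : sigma_algebra setT G ->
  (forall n, G (F n)) -> G (\bigcup_n F n).
Proof. by case=> _ _; apply. Qed.

Lemma sigmaI G A B : sigma_algebra setT G -> G A -> G B -> G (A `&` B).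
Proof.
move=> sG GA GB.
have := @measurableI _ (g_sigma_algebraType G) A B.
by rewrite /measurable/= sigma_algebra_id//; apply.
Qed.

Lemma sigmaU G A B : sigma_algebra setT G -> G A -> G B -> G (A `|` B).
Proof.
move=> sG GA GB.
have := @measurableU _ (g_sigma_algebraType G) A B.
by rewrite /measurable/= sigma_algebra_id//; apply.
Qed.

Lemma subsigma_gen G : G `<=` measurable -> subsigma <<s G >>.
Proof.
move=> Gm; split; first exact: smallest_sigma_algebra.
by apply: smallest_sub => //; exact: sigma_algebra_measurable.
Qed.

Lemma gmeas_bfun G f : subsigma G -> gmeas G f -> bounded f -> bfun f.
Proof. by move=> sG mf bf; split=> //; exact: gmeas_meas mf. Qed.

(** Where [f] and [g] differ, any part of a preimage is negligible and thus already in [G]. *)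
Lemma gmeas_ae G f g : sigma_algebra setT G -> P.-negligible `<=` G ->
  gmeas G f -> {ae P, forall w, f w = g w} -> gmeas G g.
Proof.
move=> sG nG /(gmeasP _ sG) fG fg; apply/(gmeasP _ sG) => B mB.
set N := ~` [set w | f w = g w].
have GN : G N by exact: nG.
have -> : g @^-1` B = (f @^-1` B `&` ~` N) `|` (g @^-1` B `&` N).
  apply/seteqP; split=> w.
    by have [Nw|/contrapT/= fgw] := pselect (N w); [right|left; rewrite /N/= fgw; split].
  by case=> [[/= fB /contrapT/= <-]|[]].
apply: sigmaU => //; first by apply: sigmaI; [| exact: fG|exact: sigmaC].
apply: nG; apply: negligibleS fg; exact: subIsetr.
Qed.

Lemma gmeas_ae_cvg G (f_ : nat -> Omega -> R) f : sigma_algebra setT G ->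
  P.-negligible `<=` G -> (forall n, gmeas G (f_ n)) ->
  {ae P, forall w, f_ n w @[n --> \oo] --> f w} -> gmeas G f.
Proof.
move=> sG nG mf_ ff; set N := ~` [set w | f_ n w @[n --> \oo] --> f w].
have GN : G (~` N) by apply: sigmaC => //; exact: nG.
(* Zeroing the sequence on the exceptional set turns almost sure convergence into convergence
   everywhere. *)
apply: (@gmeas_ae G (fun w => f w * \1_(~` N) w)) => //; last first.
  apply: filterS ff => w fw; have Nw : (~` N) w by rewrite /N setCK.
  by rewrite indicE mem_set// mulr1.
apply: (@measurable_fun_cvg _ (g_sigma_algebraType G) R setT
  (fun n w => f_ n w * \1_(~` N) w)).
  by move=> n; apply: measurable_funM; [exact: mf_|exact: gmeas_indic].
move=> w _; have [Nw|Nw] := pselect ((~` N) w).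
  by apply: cvgM; [move: Nw; rewrite /N setCK|exact: cvg_cst].
have -> : \1_(~` N) w = 0 :> R by rewrite indicE memNset.
by rewrite mulr0; under eq_fun do rewrite mulr0; exact: cvg_cst.
Qed.

(* [m] is the limit of step functions of its own values. *)
Lemma Ex_ext G (X X' m : Omega -> R) : subsigma G -> bfun X -> bfun X' ->
  (forall A, G A -> Ex P (fun w => \1_A w * X w) = Ex P (fun w => \1_A w * X' w)) ->
  gmeas G m -> bounded m ->
  Ex P (fun w => m w * X w) = Ex P (fun w => m w * X' w).
Proof.
move=> [sG Gm] bX bX' XX' mm [M mM].
(* The cells are open on the left, so [a] must lie strictly below every value of [m]. *)
pose a : R := - `|M| - 1; pose b : R := `|M|.
pose m_ n w := stepfun a b n (fun i => gridpt a b n i.+1) (m w).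
have cellE n i w : \1_(cell a b n i) (m w) = \1_(m @^-1` cell a b n i) w :> R.
  by rewrite !indicE.
have Gcell n i : G (m @^-1` cell a b n i).
  by apply: (gmeasP _ sG).1 => //; exact: measurable_itv.
have bm n i : bfun (fun w => \1_(m @^-1` cell a b n i) w : R).
  by apply: bfun_indic; exact: Gm.
have bm_ n (Y : Omega -> R) : bfun Y -> forall i : 'I_n,
    bfun (fun w => gridpt a b n i.+1 * (\1_(m @^-1` cell a b n i) w * Y w)).
  by move=> bY i; apply: bfunM; [exact: bfun_cst|exact: bfunM].
have step n (Y : Omega -> R) : (fun w => m_ n w * Y w) =
    (fun w => \sum_(i < n) gridpt a b n i.+1 * (\1_(m @^-1` cell a b n i) w * Y w)).
  apply/funext => w; rewrite /m_ /stepfun mulr_suml.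
  by apply: eq_bigr => i _; rewrite cellE mulrA.
have mE n : Ex P (fun w => m_ n w * X w) = Ex P (fun w => m_ n w * X' w).
  rewrite !step !Ex_sum; [|exact: bm_..].
  by apply: eq_bigr => i _; rewrite !ExZ ?XX'//; exact: bfunM.
have mcvg (Y : Omega -> R) : bfun Y ->
    Ex P (fun w => m_ n w * Y w) @[n --> \oo] --> Ex P (fun w => m w * Y w).
  move=> bY; case: (bY) => mY [N YN].
  have ab : a <= b by rewrite /a /b; have := normr_ge0 M; lra.
  apply: (@Ex_cvg _ _ _ _ _ _ (`|a| * N)).
  - by move=> n; rewrite step; case: (bfun_sum (index_enum 'I_n) (bm_ n _ bY)).
  - by apply: measurable_funM => //; exact: gmeas_meas mm.
  - move=> n w; rewrite normrM ler_pM//; apply: stepfun_bound => // i i_n.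
    have /andP[] := gridpt_itv ab (leq_ltn_trans (leq0n _) i_n) i_n.
    have -> : `|a| = - a by rewrite ler0_norm// /a; have := normr_ge0 M; lra.
    by rewrite ler_norml /a /b; have := normr_ge0 M; lra.
  apply: aeW => w; apply: cvgM; last exact: cvg_cst.
  apply: (stepfun_right_cvg (v := id)); last exact: cvg_at_right_filter.
  have := mM w; have := ler_norm M; rewrite /a /b ler_norml.
  by move=> ? /andP[? ?]; apply/andP; split; lra.
exact: limits_eq mE (mcvg _ bX) (mcvg _ bX').
Qed.

End subsigma.

Section line.
Context {R : realType}.

(** With [n * n] cells on [[-n, n]] the mesh is [2 / n]: the grid refines while its range exhausts
    the line. *)
Definition linept (n i : nat) : R := gridpt (- n%:R) n%:R (n * n) i.

Definition stepline (n : nat) (v : R -> R) (y : R) : R :=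
  stepfun (- n%:R) n%:R (n * n) (fun i => v (linept n i.+1)) y.

Lemma stepline_cvg (v : R -> R) (y : R) : v x @[x --> y^'+] --> v y ->
  stepline n v y @[n --> \oo] --> v y.
Proof.
move=> vy; apply/cvgrPdist_le => e e0.
move/cvgrPdist_le : vy => /(_ _ e0) [dl /= dl0 H].
have /cvgrPdist_lt h0 := @mesh_cvg0 R 0 2.
near=> n.
have n0 : (0 < n)%N by near: n; exact: nbhs_infty_gt.
have nR : (0 : R) < n%:R by rewrite ltr0n.
have nn0 : (0 < n * n)%N by rewrite muln_gt0 n0.
have yn : `|y| < n%:R by near: n; exact: nbhs_infty_gtr.
have yn' : - n%:R < y <= n%:R.
  by move: yn; rewrite ltr_norml => /andP[-> /ltW].
have nn : - n%:R <= n%:R :> R by lra.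
have [i [i_n iy vE]] := stepfunE nn0 yn'; rewrite /stepline vE.
case/andP : (iy) => _; rewrite le_eqVlt => /predU1P[yE|yi].
  by rewrite /linept -yE subrr normr0 ltW.
apply: H => //=; rewrite distrC.
apply: le_lt_trans (cell_ptE nn nn0 iy).1 _.
have : `|0 - (2 - 0) / n%:R : R| < dl by near: n; exact: h0.
rewrite sub0r normrN ger0_norm ?divr_ge0 ?subr0//.
suff -> : (n%:R - - n%:R) / (n * n)%:R = 2 / n%:R :> R by [].
by rewrite natrM; field; rewrite gt_eqF.
Unshelve. all: by end_near. Qed.

End line.

Section independence.
Context d (Omega : measurableType d) (R : realType) (P : probability Omega R).
Implicit Types (A B : set Omega) (G H : set (set Omega)).

Lemma fine_indep A B : measurable A -> measurable B ->
  P (A `&` B) = (P A * P B)%E ->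
  fine (P (A `&` B)) = fine (P A) * fine (P B).
Proof. by move=> mA mB ->; rewrite fineM// fin_num_measure. Qed.

(* In conditioning on [K] the argument [Y] of [E] is frozen: it is approximated from
   above by grid values, and [E] is locally constant to the right. *)
Lemma freeze (K : set (set Omega)) (E : R -> set Omega) (Y Z : Omega -> R) :
  subsigma K -> measure_is_complete P -> (forall y, measurable (E y)) ->
  (forall y A, K A -> P (A `&` E y) = (P A * P (E y))%E) ->
  {ae P, forall w, forall y : R, exists2 dl : R, 0 < dl &
     forall y' : R, y <= y' < y + dl -> (E y' w <-> E y w)} ->
  gmeas K Y -> gmeas K Z -> bounded Z ->
  [/\ measurable [set w | E (Y w) w],
      gmeas K (fun w => fine (P (E (Y w)))) &
      Ex P (fun w => Z w * \1_[set w | E (Y w) w] w) =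
      Ex P (fun w => Z w * fine (P (E (Y w))))].
Proof.
move=> subK cP mE indE rcE mY mZ [M ZM]; have [sK mK] := subK.
pose phi y := fine (P (E y)).
have phi01 y : 0 <= phi y <= 1.
  by rewrite /phi fine_ge0//= -lee_fin fineK ?fin_num_measure// probability_le1.
have ind_rc : {ae P, forall w, forall y,
    (\1_(E x) w : R) @[x --> y^'+] --> (\1_(E y) w : R)}.
  apply: filterS rcE => w rc y; have [dl dl0 H] := rc y.
  apply: cvg_near_cst; near=> x.
  have yx : y <= x < y + dl.
    apply/andP; split; first by apply/ltW; near: x; exact: nbhs_right_gt.
    by near: x; apply: nbhs_right_lt; rewrite ltrDl.
  have [h1 h2] := H _ yx; rewrite !indicE; congr (nat_of_bool _)%:R.
  by apply/idP/idP => /set_mem ?; apply/mem_set; auto.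
have phi_rc y : phi x @[x --> y^'+] --> phi y.
  apply/cvg_at_rightP => u [uy cu].
  have -> : (fun n => phi (u n)) = fun n => Ex P (\1_(E (u n)) : Omega -> R).
    by apply/funext => n; rewrite Ex_indic.
  rewrite /phi -Ex_indic//; apply: (@Ex_cvg _ _ _ _ _ _ 1).
  - by move=> n; apply: measurable_indic.
  - exact: measurable_indic.
  - by move=> n w; exact: norm_indic_le1.
  - apply: filterS ind_rc => w /(_ y) rc.
    by move/cvg_at_rightP : rc; apply.
(* Right-continuity makes [phi] a pointwise limit of step functions, hence Borel. *)
have mphi : measurable_fun setT phi.
  apply: (measurable_fun_cvg (h := fun n => stepline n phi)).
    by move=> n; exact: measurable_stepfun.
  by move=> y _; exact: stepline_cvg.
have mphiY : gmeas K (phi \o Y) by exact: measurableT_comp.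
pose S n w := stepfun (- n%:R) n%:R (n * n)
  (fun i => (\1_(E (linept n i.+1)) w : R)) (Y w).
pose cellY n i : set Omega := Y @^-1` cell (- n%:R) n%:R (n * n) i.
have KcellY n i : K (cellY n i).
  by apply: (gmeasP _ sK).1 => //; exact: measurable_itv.
have SE n w : S n w = \sum_(i < n * n) \1_(E (linept n i.+1)) w * \1_(cellY n i) w.
  by apply: eq_bigr => i _; rewrite !indicE.
have mS n : measurable_fun setT (S n).
  rewrite (funext (SE n)); apply: measurable_sum => i.
  by apply: measurable_funM; apply: measurable_indic => //; exact/mK/KcellY.
have S1 n w : `|S n w| <= 1.
  by apply: stepfun_bound => // i _; exact: norm_indic_le1.
have Scvg : {ae P, forall w, S n w @[n --> \oo] --> (\1_[set w | E (Y w) w] w : R)}.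
  apply: filterS ind_rc => w /(_ (Y w)) rc.
  rewrite (_ : \1_[set w | E (Y w) w] w = \1_(E (Y w)) w); last by rewrite !indicE.
  exact: (stepline_cvg (v := fun y => \1_(E y) w)).
(* The diagonal event is measurable by completeness, its indicator being an almost sure limit of the
   measurable [S n]. *)
have mEY : measurable [set w | E (Y w) w].
  apply/(measurable_indicP R).
  have sm : sigma_algebra setT (@measurable _ Omega) by exact: sigma_algebra_measurable.
  have : gmeas (@measurable _ Omega) (\1_[set w | E (Y w) w] : Omega -> R).
    apply: (@gmeas_ae_cvg _ _ _ P _ S) => // n.
    by apply/(gmeasP _ sm) => B mB; rewrite -[X in measurable X]setTI; exact: mS.
  by move/(gmeasP _ sm) => h _ B mB; rewrite setTI; exact: h.
split=> //.
have bZ : bfun Z by apply: gmeas_bfun mZ _ => //; exists M.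
have [mZ' _] := bZ.
have L1 : Ex P (fun w => Z w * S n w) @[n --> \oo] -->
    Ex P (fun w => Z w * \1_[set w | E (Y w) w] w).
  apply: (@Ex_cvg _ _ _ _ _ _ M).
  - by move=> n; exact: measurable_funM.
  - by apply: measurable_funM => //; exact: measurable_indic.
  - by move=> n w; rewrite normrM (le_trans (ler_piMr _ _)).
  - by apply: filterS Scvg => w Sw; apply: cvgM => //; exact: cvg_cst.
have L2 : Ex P (fun w => Z w * stepline n phi (Y w)) @[n --> \oo] -->
    Ex P (fun w => Z w * phi (Y w)).
  apply: (@Ex_cvg _ _ _ _ _ _ M).
  - move=> n; apply: measurable_funM => //.
    apply: measurableT_comp; first exact: measurable_stepfun.
    exact: gmeas_meas mY.
  - by apply: measurable_funM => //; exact: gmeas_meas mphiY.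
  - move=> n w; rewrite normrM (le_trans (ler_piMr _ _))//.
    apply: stepfun_bound => // i _; have /andP[p0 p1] := phi01 (linept n i.+1).
    by rewrite ger0_norm.
  - by apply: aeW => w; apply: cvgM; [exact: cvg_cst|exact: stepline_cvg].
apply: limits_eq L1 L2 => n.
have bcell i : bfun (\1_(cellY n i) : Omega -> R).
  by apply: bfun_indic; exact/mK.
transitivity (Ex P (fun w => \sum_(i < n * n)
    (Z w * \1_(cellY n i) w) * \1_(E (linept n i.+1)) w)).
  congr Ex; apply/funext => w; rewrite SE mulr_sumr.
  by apply: eq_bigr => i _; rewrite mulrA mulrAC.
transitivity (Ex P (fun w => \sum_(i < n * n)
    (Z w * \1_(cellY n i) w) * phi (linept n i.+1))); last first.
  congr Ex; apply/funext => w; rewrite /stepline /stepfun mulr_sumr.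
  apply: eq_bigr => i _; rewrite (_ : \1_(cell _ _ _ _) _ = \1_(cellY n i) w).
    by ring.
  by rewrite !indicE.
rewrite !Ex_sum; last 2 first.
- by move=> i; apply: bfunM; [exact: bfunM|exact: bfun_cst].
- by move=> i; apply: bfunM; [exact: bfunM|exact: bfun_indic].
apply: eq_bigr => i _.
(* At a fixed grid value the event is independent of [K]; [Ex_ext] passes from events of [K] to the
   weight [Z] times a cell indicator. *)
apply: (@Ex_ext _ _ _ P K) => //.
- exact: bfun_indic.
- exact: bfun_cst.
- move=> A KA; have mA := mK _ KA.
  under [in RHS]eq_fun do rewrite mulrC.
  rewrite ExZ; last exact: bfun_indic.
  transitivity (Ex P (\1_(A `&` E (linept n i.+1)) : Omega -> R)).
    by congr Ex; apply/funext => w; rewrite indicI.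
  rewrite !Ex_indic//; last exact: measurableI.
  by rewrite fine_indep ?indE// mulrC.
- by apply: measurable_funM => //; exact: gmeas_indic.
- by apply: boundedM; [exists M|exact: bounded_indic].
Unshelve. all: by end_near. Qed.

(** Dynkin's pi-lambda argument: the events independent of [B] form a lambda-system. *)
Lemma indep_generated (C : set (set Omega)) (B : set Omega) :
  setI_closed C -> C `<=` measurable -> measurable B ->
  (forall A, C A -> P (A `&` B) = (P A * P B)%E) ->
  forall A, <<s C >> A -> P (A `&` B) = (P A * P B)%E.
Proof.
move=> CI Cm mB CB A CA.
pose H : set (set Omega) :=
  [set A | measurable A /\ P (A `&` B) = (P A * P B)%E].
suff : H A by case.
have : <<s C >> `<=` H; last exact.
apply: lambda_system_subset => //; last by move=> D CD; split; [exact: Cm|exact: CB].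
apply/dynkin_lambda_system; split.
- by split=> //; rewrite setTI probability_setT mul1e.
- move=> D [mD DB]; split; first exact: measurableC.
  have -> : ~` D `&` B = B `\` D by rewrite setIC setDE.
  rewrite measureD//; last by rewrite (le_lt_trans (probability_le1 _ _)) ?ltry.
  transitivity (P B - P (D `&` B))%E; first by rewrite setIC.
  rewrite DB probability_setC//.
  rewrite -(@fineK _ (P D)) ?fin_num_measure// -(@fineK _ (P B)) ?fin_num_measure//.
  by rewrite -EFinM -EFinB -[1%E]/(1%:E) -EFinB -EFinM; congr (_%:E); ring.
- move=> F tF HF; split; first by apply: bigcupT_measurable => k; case: (HF k).
  rewrite setI_bigcupl measure_bigcup//; last 2 first.
  + by move=> k _; apply: measurableI => //; case: (HF k).
  + exact: trivIset_setIr.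
  rewrite measure_bigcup//; last by move=> k _; case: (HF k).
  rewrite muleC -(@fineK _ (P B)) ?fin_num_measure// -nneseriesZl//.
  apply: eq_eseriesr => k _; transitivity (P (F k) * P B)%E.
    by case: (HF k).
  by rewrite muleC fineK ?fin_num_measure.
Qed.

End independence.

Lemma cvg_norm_le {R : realType} (T : Type) (F : set_system T) (u : T -> R) (l M : R) :
  ProperFilter F -> (\forall t \near F, `|u t| <= M) -> u t @[t --> F] --> l ->
  `|l| <= M.
Proof.
move=> FF uM ul; apply: (closed_cvg (fun x : R => x <= M)) uM _ (cvg_norm ul).
exact: closed_le.
Qed.

(** * Paths of the intensity and stopping times *)

Section cadlag.
Context {R : realType}.
Implicit Types (x : R -> R).
Local Notation leb := (@lebesgue_measure R).

(** Near each time the path is within 1 of its left limit on one side and of its value on the other;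
    compactness of the segment makes the bound uniform. *)
Lemma cadlag_bounded x (T : R) : cadlag x ->
  exists M : R, forall s, 0 <= s <= T -> `|x s| <= M.
Proof.
move=> [xr xl].
have := @segment_compact R 0 T; rewrite compact_near_coveringP.
move=> /(_ R (pinfty_nbhs R) (fun M s => 0 <= s -> `|x s| <= M) _).
case.
- move=> t /=; rewrite in_itv/= => /andP[t0 tT].
  have [B HB] : exists B : R, \forall s \near t, 0 <= s -> `|x s| <= B.
    have /cvgrPdist_le /(_ 1 ltr01) hr := xr t t0.
    have [l hl] : exists l : R, \forall s \near t, s < t -> 0 <= s -> `|x s| <= `|l| + 1.
      move: t0; rewrite le_eqVlt => /predU1P[<-|t0].
        by exists 0; near=> s => s0; rewrite leNgt s0.
      exists (lim (x s @[s --> t^'-])).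
      have /cvgrPdist_le /(_ 1 ltr01) hl := xl t t0.
      have {}hl : \forall s \near t, s < t -> `|lim (x s @[s --> t^'-]) - x s| <= 1 := hl.
      apply: filterS hl => s hs st _.
      rewrite -(subKr (lim (x s @[s --> t^'-])) (x s)).
      by rewrite (le_trans (ler_normB _ _))// lerD2l hs.
    exists (`|l| + `|x t| + 1).
    have {}hr : \forall s \near t, t < s -> `|x t - x s| <= 1 := hr.
    apply: filterS2 hl hr => s hl hr s0; have [st|ts|->] := ltgtP s t.
    - rewrite (le_trans (hl st s0))// lerD2r lerDl; exact: normr_ge0.
    - rewrite -(subKr (x t) (x s)) (le_trans (ler_normB _ _))//.
      by rewrite lerD ?hr// lerDr normr_ge0.
    - by rewrite addrAC lerDr addr_ge0 ?normr_ge0.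
  exists ([set s | 0 <= s -> `|x s| <= B], [set M | B <= M]).
    by split=> //; apply: nbhs_pinfty_ge; exact: num_real.
  by move=> [s M] /= [h1 h2] s0; exact: le_trans (h1 s0) h2.
- move=> M0 [_ HM]; exists (M0 + 1) => s sT.
  apply: (HM (M0 + 1)); first by rewrite ltrDl.
    by rewrite /= in_itv.
  by case/andP: sT.
Unshelve. all: by end_near. Qed.

Lemma lebesgue_ltoc (s t : R) : (leb `]s, t]%classic < +oo)%E.
Proof. by rewrite lebesgue_measure_itv/=; case: ifP => _; rewrite ?ltry. Qed.

Lemma fine_leb_cell (a b : R) (n i : nat) : a <= b ->
  fine (leb (cell a b n i)) = (b - a) / n%:R.
Proof.
move=> ab; rewrite /cell lebesgue_measure_itv/= lte_fin gridptS ltrDl.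
case: ltP => [_|h]; first by rewrite -EFinB/= addrC addKr.
by apply/eqP; rewrite eq_le h andbT/= divr_ge0// subr_ge0.
Qed.

Section euler.
Variables (k x0 : R) (c : R -> R).
Hypothesis k0 : 0 < k.

(* The explicit Euler scheme for dx = - k x dt + dc shows that the solution is
   nonnegative and a measurable functional of [c]. *)
Fixpoint euler (t : R) (n i : nat) : R :=
  if i is j.+1 then
    (1 - k * (t / n%:R)) * euler t n j
    + (c (gridpt 0 t n j.+1) - c (gridpt 0 t n j))
  else x0 + c 0.

(** Keeps the Euler coefficient [1 - k * (t / n)] nonnegative, which preserves signs and prevents
    past errors from growing. *)
Lemma small_mesh (t : R) : \forall n \near \oo, (0 < n)%N /\ k * (t / n%:R) <= 1.
Proof.
have /cvgrPdist_lt /(_ _ (divr_gt0 ltr01 k0)) h := @mesh_cvg0 R 0 t.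
near=> n; split; first by near: n; exact: nbhs_infty_gt.
rewrite mulrC -ler_pdivlMr//; apply/ltW; apply: le_lt_trans (ler_norm _) _.
have : `|0 - (t - 0) / n%:R| < 1 / k by near: n; exact: h.
by rewrite sub0r normrN subr0.
Unshelve. all: by end_near. Qed.

Lemma euler_ge0 (t : R) : 0 <= x0 + c 0 ->
  (forall s s', 0 <= s -> s <= s' -> c s <= c s') -> 0 <= t ->
  \forall n \near \oo, 0 <= euler t n n.
Proof.
move=> h0 cnd t0; apply: filterS (small_mesh t) => n [n0 hn].
suff : forall i, 0 <= euler t n i by exact.
elim=> //= i IH; rewrite addr_ge0// ?mulr_ge0// ?subr_ge0//.
by apply: cnd; [exact: gridpt_ge|exact: gridpt_le].
Qed.

Variable x : R -> R.
Hypothesis cx : cadlag x.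
Let z s := lim (x u @[u --> s^'-]).
Hypothesis xE : forall t, 0 <= t ->
  x t = x0 - k * \int[leb]_(s in `]0, t]) z s + c t.

(** The only error per cell comes from replacing the left limits [z] by the value at the left end.
    As the Euler coefficient lies in [0, 1], these errors merely add up, so the total is at most [k]
    times the integral of [D n], without a Gronwall factor, and this integral tends to 0. *)
Lemma euler_cvg (t : R) : 0 <= t -> euler t n n @[n --> \oo] --> x t.
Proof.
move=> t0; have [M xM] := cadlag_bounded t cx.
have M0 : 0 <= M by apply: le_trans (xM 0 _); rewrite // lexx.
pose v n i := x (gridpt 0 t n i).
have vM n i : (i < n)%N -> `|v n i| <= M.
  move=> i_n; apply: xM; apply: gridpt_itv => //; last exact: ltnW.
  exact: leq_ltn_trans i_n.
have vz (y : R) : 0 < y <= t -> stepfun 0 t n (v n) y @[n --> \oo] --> z y.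
  move=> yt; apply: stepfun_left_cvg => //; apply: cx.2.
  by case/andP: yt.
have [mz _] := @riemann_cvg R leb 0 t M v z (lebesgue_ltoc 0 t) M0 vM vz.
have SM n y : `|stepfun 0 t n (v n) y| <= M.
  by apply: stepfun_bound => // i; exact: vM.
have zM (y : R) : 0 < y <= t -> `|z y| <= M.
  by move=> yt; apply: cvg_norm_le (vz y yt); apply: nearW => n; exact: SM.
pose D n y : R := `|z y - stepfun 0 t n (v n) y|.
have mD n : measurable_fun `]0, t] (D n).
  apply: measurableT_comp => //; apply: measurable_funB => //.
  exact: measurable_stepfun.
have DM n (y : R) : 0 < y <= t -> `|D n y| <= M + M.
  move=> yt; rewrite /D normr_id (le_trans (ler_normB _ _))// lerD ?zM//.
have sub (s : R) : s <= t -> `]0, s]%classic `<=` `]0, t]%classic.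
  by move=> st y; rewrite /= !in_itv/= => /andP[-> /le_trans]; apply.
have bint (s B : R) (f : R -> R) : s <= t -> measurable_fun `]0, t] f ->
    (forall y : R, 0 < y <= t -> `|f y| <= B) -> leb.-integrable `]0, s] (EFin \o f).
  move=> st mf fB; apply: (@bounded_integrable _ _ R leb `]0, s] (measurable_itv _) (lebesgue_ltoc 0 s) _ (B)).
    exact: (measurable_funS (measurable_itv _) (sub _ st) mf).
  by move=> y /(sub _ st); rewrite /= in_itv/=; exact: fB.
have intD : \int[leb]_(y in `]0, t]) D n y @[n --> \oo] --> (0 : R).
  rewrite [X in _ --> X](_ : _ = \int[leb]_(y in `]0, t]) 0 :> R); last first.
    by rewrite Rintegral_cst ?mul0r.
  apply: (@bounded_Rintegral_cvg _ _ R leb `]0, t] (measurable_itv _) (lebesgue_ltoc 0 t) _ _ (M + M)) => //.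
  apply: (@aeW _ _ _ leb) => y; rewrite /= in_itv/= => yt.
  rewrite -(normr0 R) -(subrr (z y)); apply: cvg_norm; apply: cvgB; first exact: cvg_cst.
  exact: vz.
have err : \forall n \near \oo,
    `|euler t n n - x t| <= k * \int[leb]_(y in `]0, t]) D n y.
  apply: filterS (small_mesh t) => n [n0 hn].
  (* The error at a grid point is compared with the integral up to that point, which makes the bound
     inductive. *)
  suff H i : (i <= n)%N -> `|euler t n i - x (gridpt 0 t n i)| <=
      k * \int[leb]_(y in `]0, gridpt 0 t n i]) D n y.
    by have := H n (leqnn n); rewrite gridptn.
  elim: i => [|i IH] i_n /=.
    rewrite gridpt0 xE// set_itv_ge ?bnd_simp ?ltxx// !Rintegral_set0.
    by rewrite !mulr0 subr0 subrr normr0.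
  have := IH (ltnW i_n); set p := gridpt 0 t n i; set q := gridpt 0 t n i.+1.
  have p0 : 0 <= p by exact: gridpt_ge.
  have pq : p <= q by exact: gridpt_le.
  have qt : q <= t by have /andP[] := gridpt_itv t0 n0 i_n.
  have pt := le_trans pq qt; have q0 := le_trans p0 pq.
  have splt (B : R) (f : R -> R) : measurable_fun `]0, t] f ->
      (forall y : R, 0 < y <= t -> `|f y| <= B) ->
      \int[leb]_(y in `]0, q]) f y =
      \int[leb]_(y in `]0, p]) f y + \int[leb]_(y in `]p, q]) f y.
    move=> mf fB; have := @Rintegral_itvB R f (BRight 0) (BRight q) p.
    move=> <-; rewrite ?bnd_simp//; last exact: bint fB.
    by rewrite addrC subrK.
  have sub2 : `]p, q]%classic `<=` `]0, t]%classic.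
    move=> y; rewrite /= !in_itv/= => /andP[py yq].
    by rewrite (le_lt_trans p0 py) (le_trans yq qt).
  have qp : q - p = t / n%:R by rewrite /q gridptS subr0 addrC addKr.
  have intS : \int[leb]_(y in `]p, q]) (z y - stepfun 0 t n (v n) y) =
      \int[leb]_(y in `]p, q]) z y - t / n%:R * x p.
    rewrite RintegralB//; last 2 first.
    - apply: (@bounded_integrable _ _ R leb `]p, q] (measurable_itv _) (lebesgue_ltoc p q) _ (M)).
        exact: (measurable_funS (measurable_itv _) sub2 mz).
      by move=> y /sub2; rewrite /= in_itv/=; exact: zM.
    - apply: (@bounded_integrable _ _ R leb `]p, q] (measurable_itv _) (lebesgue_ltoc p q) _ (M)).
        exact: measurable_stepfun.
      by move=> y _; exact: SM.
    congr (_ - _).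
    transitivity (\int[leb]_(y in `]p, q]) x p).
      apply: eq_Rintegral => y /set_mem; rewrite /= in_itv/= => pyq.
      by rewrite (stepfun_cell _ t0 i_n).
    by rewrite Rintegral_cst// mulrC -/(cell 0 t n i) fine_leb_cell// subr0.
  have absS : `|\int[leb]_(y in `]p, q]) (z y - stepfun 0 t n (v n) y)| <=
      \int[leb]_(y in `]p, q]) D n y.
    apply: le_normr_Rintegral => //.
    apply: (@bounded_integrable _ _ R leb `]p, q] (measurable_itv _) (lebesgue_ltoc p q) _ (M + M)).
      apply: measurable_funB; first exact: (measurable_funS (measurable_itv _) sub2 mz).
      exact: measurable_stepfun.
    by move=> y /sub2; rewrite /= in_itv/= => /(DM n); rewrite /D normr_id.
  rewrite (splt _ _ (mD n) (DM n)) => {}IH.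
  have xq : x q = x p - k * \int[leb]_(y in `]p, q]) z y + (c q - c p).
    by rewrite !xE// (splt _ _ mz zM); ring.
  (* One-step recursion: the driving increment [c q - c p] cancels, leaving the damped old error and
     the local error of the cell. *)
  have -> : (1 - k * (t / n%:R)) * euler t n i + (c q - c p) - x q =
      (1 - k * (t / n%:R)) * (euler t n i - x p) +
      k * \int[leb]_(y in `]p, q]) (z y - stepfun 0 t n (v n) y).
    by rewrite intS xq; ring.
  rewrite [leRHS]mulrDr (le_trans (ler_normD _ _))// lerD//.
    apply: le_trans IH; rewrite normrM ler_piMl// ger0_norm ?subr_ge0//.
    by rewrite gerBl mulr_ge0 ?divr_ge0// ltW.
  by rewrite normrM gtr0_norm// ler_pM2l.
have intkD : k * \int[leb]_(y in `]0, t]) D n y @[n --> \oo] --> (0 : R).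
  by rewrite -[X in _ --> X](mulr0 k); apply: cvgMr.
apply/cvgrPdist_le => e e0; have /cvgrPdist_le /(_ _ e0) he := intkD.
apply: filterS2 err he => n h1 h2; rewrite distrC; apply: le_trans h1 _.
by apply: le_trans h2; rewrite sub0r normrN ler_norm.
Unshelve. all: by end_near. Qed.

Lemma sol_ge0 : 0 <= x0 + c 0 ->
  (forall s s', 0 <= s -> s <= s' -> c s <= c s') ->
  forall t, 0 <= t -> 0 <= x t.
Proof.
move=> h0 cnd t t0.
apply: (closed_cvg (fun y : R => 0 <= y)) (euler_ge0 h0 cnd t0) _ (euler_cvg t0).
exact: closed_ge.
Qed.


End euler.

End cadlag.

Section cumulated.
Context {R : realType}.
Local Notation leb := (@lebesgue_measure R).
Variable lam : R -> R.
Hypothesis cl : cadlag lam.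
Hypothesis lam_ge0 : forall v, 0 <= v -> 0 <= lam v.

Local Notation L s t := (\int[leb]_(v in `[s, t]) lam v).

Lemma cumul_riemann0 (s t : R) : 0 <= s -> s <= t ->
  leb.-integrable `[s, t] (EFin \o lam) /\
  \sum_(i < n) lam (gridpt s t n i.+1) * ((t - s) / n%:R) @[n --> \oo] --> L s t.
Proof.
move=> s0 st; have [M lM] := cadlag_bounded t cl.
have M0 : 0 <= M by apply: le_trans (lM s _); rewrite // s0 st.
have vM n i : (i < n)%N -> `|lam (gridpt s t n i.+1)| <= M.
  move=> i_n; apply: lM; have n0 := leq_ltn_trans (leq0n _) i_n.
  have /andP[h1 ->] := gridpt_itv st n0 i_n.
  by rewrite andbT; exact: le_trans h1.
have vl (y : R) : s < y <= t ->
    stepfun s t n (fun i => lam (gridpt s t n i.+1)) y @[n --> \oo] --> lam y.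
  move=> /andP[sy yt]; apply: stepfun_right_cvg; first exact/andP.
  by apply: cl.1; apply/ltW/(le_lt_trans s0).
have [ml cvl] := @riemann_cvg R leb s t M _ lam (lebesgue_ltoc s t) M0 vM vl.
have il : leb.-integrable `]s, t] (EFin \o lam).
  apply: (@bounded_integrable _ _ R leb `]s, t] (measurable_itv _) (lebesgue_ltoc s t) _ M) => //.
  move=> y; rewrite /= in_itv/= => /andP[sy yt]; apply: lM.
  by rewrite yt andbT; apply/ltW/(le_lt_trans s0).
split.
  have lebst : (leb `[s, t]%classic < +oo)%E.
    by rewrite lebesgue_measure_itv/=; case: ifP => _; rewrite ?ltry.
  apply: (@bounded_integrable _ _ R leb `[s, t] (measurable_itv _) lebst _ M).
    by apply/measurable_fun_itv_obnd_cbndP.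
  move=> y; rewrite /= in_itv/= => /andP[sy yt]; apply: lM.
  by rewrite yt andbT; exact: le_trans sy.
rewrite -Rintegral_itv_obnd_cbnd//.
rewrite (_ : (fun n => _) =
  fun n => \sum_(i < n) lam (gridpt s t n i.+1) * fine (leb (cell s t n i))) //.
by apply/funext => n; apply: eq_bigr => i _; rewrite fine_leb_cell.
Qed.

Lemma cumul_riemann (s t : R) : 0 <= s -> s <= t ->
  \sum_(i < n) lam (gridpt s t n i.+1) * ((t - s) / n%:R) @[n --> \oo] --> L s t.
Proof. by move=> s0 st; have [] := cumul_riemann0 s0 st. Qed.

Lemma cumul_integrable (s t : R) : 0 <= s -> leb.-integrable `[s, t] (EFin \o lam).
Proof.
move=> s0; have [st|ts] := leP s t; first by have [] := cumul_riemann0 s0 st.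
by rewrite set_itv_ge ?bnd_simp -?ltNge//; exact: integrable_set0.
Qed.

Lemma cumul_add (s t : R) : 0 <= s -> s <= t -> L 0 t = L 0 s + L s t.
Proof.
move=> s0 st; have := @Rintegral_itvB R lam (BLeft 0) (BRight t) s.
rewrite !bnd_simp => /(_ (cumul_integrable t (lexx 0)) s0 st) h.
rewrite -[L s t]Rintegral_itv_obnd_cbnd; first by rewrite -h addrC subrK.
apply: integrableS (cumul_integrable t s0) => //.
by move=> y; rewrite /= !in_itv/= => /andP[/ltW -> ->].
Qed.

Lemma cumul_ge0 (s t : R) : 0 <= s -> 0 <= L s t.
Proof.
move=> s0; apply: Rintegral_ge0 => y; rewrite /= in_itv/= => /andP[sy _].
exact/lam_ge0/(le_trans s0).
Qed.

Lemma cumul_refl (s : R) : L s s = 0.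
Proof. by rewrite set_itv1 Rintegral_set1. Qed.

Lemma cumul_le (s t : R) : 0 <= s -> s <= t -> L 0 s <= L 0 t.
Proof. by move=> s0 st; rewrite (cumul_add s0 st) lerDl cumul_ge0. Qed.

Lemma cumul_continuous (t : R) : 0 < t ->
  {within `[0, t], continuous (fun s => L 0 s)}.
Proof.
move=> t0.
exact: (parameterized_integral_continuous (ltW t0) (cumul_integrable t (lexx 0))).
Qed.

Lemma cumul_rc (s : R) : 0 <= s -> L 0 t @[t --> s^'+] --> L 0 s.
Proof.
move=> s0; have s1 : 0 < s + 1 by rewrite ltr_wpDl.
have /continuous_within_itvP := cumul_continuous s1.
move=> /(_ s1)[h1 h2 _]; move: s0; rewrite le_eqVlt => /predU1P[<-//|s0].
by apply: cvg_at_right_filter; apply: h1; rewrite in_itv/= s0 ltrDl ltr01.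
Qed.

(** The clock is continuous, so it visits every level up to its current value, and the time-changed
    process cannot skip a value taken by the unit Poisson process. *)
Lemma cumul_ivt (t u : R) : 0 <= t -> 0 <= u <= L 0 t ->
  exists s, 0 <= s <= t /\ L 0 s = u.
Proof.
rewrite le_eqVlt => /predU1P[<-|t0].
  rewrite cumul_refl => /andP[u0 u0']; exists 0; rewrite lexx; split=> //.
  by rewrite cumul_refl; apply/eqP; rewrite eq_le u0 u0'.
move=> /andP[u0 uL].
have [] := IVT (ltW t0) (cumul_continuous t0) (v := u).
  rewrite cumul_refl min_l ?cumul_ge0// max_r ?cumul_ge0// u0//.
by move=> s; rewrite in_itv/= => st <-; exists s.
Qed.

End cumulated.

Lemma lebesgue_stieltjes_ocitv {R : realType} (f : cumulative R R) (a b : R) :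
  a <= b -> lebesgue_stieltjes_measure f `]a, b]%classic = (f b - f a)%:E.
Proof.
move=> ab; rewrite /lebesgue_stieltjes_measure/= /measure_extension.
by rewrite measurable_mu_extE/= ?wlength_itv_bnd//; exact: is_ocitv.
Qed.

Lemma near_rightP {R : realType} (t : R) (Q : R -> Prop) :
  (\forall s \near t^'+, Q s) -> Q t ->
  exists2 dl : R, 0 < dl & forall s, t <= s < t + dl -> Q s.
Proof.
move=> [dl /= dl0 H] Qt; exists dl => // s /andP[].
rewrite le_eqVlt => /predU1P[<-//|ts sd]; apply: H => //=.
by rewrite ltr_distlC; apply/andP; split; lra.
Qed.

Definition locally_constant_right {R : realType} (m : R -> nat) :=
  forall t : R, 0 <= t -> exists2 dl : R, 0 < dl & forall s, t <= s < t + dl -> m s = m t.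

(** Singletons are open in the discrete topology of [nat]. *)
Lemma nat_rcont {R : realType} (m : R -> nat) :
  (forall t : R, 0 <= t -> m s @[s --> t^'+] --> m t) -> locally_constant_right m.
Proof.
move=> mr t t0; apply: near_rightP => //; apply: (mr t t0 [set m t]).
exact: discrete_set1.
Qed.

(** * Default times along a single path *)

Section stopping.
Context {R : realType}.
Variables (jc : R -> R) (m : R -> nat) (b T t0 : R).
Hypothesis jc_down : forall t, 0 <= t ->
  exists2 dl : R, 0 < dl & forall s, t <= s < t + dl -> jc s <= jc t.
Hypothesis jc0 : jc 0 <= b.
Hypothesis m_nd : forall s t, 0 <= s -> s <= t -> (m s <= m t)%N.
Hypothesis m0 : m 0 = 0%N.
Hypothesis m_rc : locally_constant_right m.
Hypothesis m_simple : forall t, 0 <= t -> (0 < m t)%N -> exists s, 0 <= s <= t /\ m s = 1%N.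
Hypothesis t0T : 0 <= t0 < T.

Definition below (t : R) := forall s, 0 <= s <= t -> jc s <= b.

Let tau1 : \bar R := ereal_inf [set t%:E | t in [set t | 0 < t <= T /\ b < jc t]].
Let tau3 : \bar R := ereal_inf [set t%:E | t in [set t | 0 <= t /\ m t = 1%N]].
Let tau : \bar R :=
  ereal_inf [set t%:E | t in [set t | 0 < t <= T /\ (b < jc t \/ m t = 1%N)]].

Lemma below_le (s t : R) : s <= t -> below t -> below s.
Proof. by move=> st bt u /andP[u0 us]; apply: bt; rewrite u0 (le_trans us). Qed.

Lemma inf_gtP (A : set R) (t : R) :
  (exists2 dl : R, 0 < dl & forall s, A s -> t + dl <= s) ->
  (t%:E < ereal_inf [set s%:E | s in A])%E.
Proof.
move=> [dl dl0 H]; apply: (@lt_le_trans _ _ (t + dl)%:E).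
  by rewrite lte_fin ltrDl.
by apply: le_ereal_inf_tmp => _ [s As <-]; rewrite lee_fin; exact: H.
Qed.

Lemma inf_gt_mem (A : set R) (t s : R) :
  (t%:E < ereal_inf [set s%:E | s in A])%E -> A s -> t < s.
Proof.
move=> h As; rewrite -lte_fin; apply: lt_le_trans h _.
by apply: ereal_inf_lbound; exists s.
Qed.

(** A strict inequality with an infimum needs a gap after [t]; [jc_down] supplies it, since the loss
    only decreases until its next jump. Time 0, which the infimum leaves out, is covered by
    [jc0]. *)
Lemma tau1_gt (t : R) : 0 <= t <= T -> (t%:E < tau1)%E <-> below t.
Proof.
move=> /andP[tge tT]; split=> [h s /andP[s0 st]|h].
  rewrite leNgt; apply/negP => bs.
  move: s0; rewrite le_eqVlt => /predU1P[s0|s0].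
    by move: bs; rewrite -s0 ltNge jc0.
  suff : t < s by rewrite ltNge st.
  by apply: (inf_gt_mem h); rewrite /= s0 (le_trans st).
apply: inf_gtP; have [dl dl0 H] := jc_down tge; exists dl => // s [/andP[s0 sT] bs].
rewrite leNgt; apply/negP => sd; move: bs; rewrite ltNge => /negP; apply.
have [st|ts] := leP s t; first by apply: h; rewrite (ltW s0) st.
apply: le_trans (H s _) (h t _); rewrite ?tge ?lexx//.
by rewrite (ltW ts).
Qed.

(** [tau3] looks for the value 1 exactly; [m_simple] ensures that a positive count has passed
    through it. *)
Lemma tau3_gt (t : R) : 0 <= t -> (t%:E < tau3)%E <-> m t = 0%N.
Proof.
move=> tge; split=> [h|h].
  have [//|mt] := posnP (m t).
  have [s [/andP[s0 st] ms]] := m_simple tge mt.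
  suff : t < s by rewrite ltNge st.
  exact: (inf_gt_mem h).
apply: inf_gtP; have [dl dl0 H] := m_rc tge; exists dl => // s [s0 ms].
rewrite leNgt; apply/negP => sd.
have [st|ts] := leP s t; first by have := m_nd s0 st; rewrite h ms.
by have := H s; rewrite ms h (ltW ts) sd => /(_ isT).
Qed.

Lemma tau_gt (t : R) : 0 <= t <= T -> (t%:E < tau)%E <-> below t /\ m t = 0%N.
Proof.
move=> /[dup] tT /andP[tge tleT]; split=> [h|[h1 h3]].
  split.
    apply/tau1_gt => //; apply: lt_le_trans h _.
    by apply: ereal_inf_le_tmp; apply: image_subset => s [? ?]; split=> //; left.
  have [//|mt] := posnP (m t).
  have [s [/andP[s0 st] ms]] := m_simple tge mt.
  suff : t < s by rewrite ltNge st.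
  apply: (inf_gt_mem h); split; last by right.
  (* [tau] ranges over positive times only, and [m 0 = 0] excludes [s = 0]. *)
  rewrite (le_trans st)// andbT lt_neqAle s0 andbT.
  by apply/eqP => s00; move: ms; rewrite -s00 m0.
move/tau1_gt : h1 => /(_ tT) h1; move/tau3_gt : h3 => /(_ tge) h3.
have : (t%:E < mine tau1 tau3)%E by rewrite lt_min h1.
move=> h; apply: lt_le_trans h _; apply: le_ereal_inf_tmp => _ [s [sT [bs|ms]] <-].
  by rewrite ge_min; apply/orP; left; apply: ereal_inf_lbound; exists s.
rewrite ge_min; apply/orP; right; apply: ereal_inf_lbound; exists s => //.
by split=> //; case/andP: sT => /ltW.
Qed.

Variable D : R -> R.
Hypothesis D_rc : forall t, t0 < t <= T -> D s @[s --> t^'+] --> D t.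

(** A bracket is 1 when the first passage falls in the cell and no intervention has occurred by its
    right end. Both terms read [m] at that same end, so that their difference isolates the
    passage. *)
Definition crossing_sum n : R := \sum_(i < n) D (gridpt t0 T n i.+1) *
  (`[< below (gridpt t0 T n i) /\ m (gridpt t0 T n i.+1) = 0%N >]%:R -
   `[< below (gridpt t0 T n i.+1) /\ m (gridpt t0 T n i.+1) = 0%N >]%:R).

(** With [th] the first passage time, the sum is the step function of [D s * (m s == 0)] evaluated
    at [th]. Reading both factors at right ends is harmless because both are right-continuous. *)
Lemma crossing_sum_cvg : crossing_sum n @[n --> \oo] -->
  D (fine tau) * (tau1 < tau3)%E%:R * (t0%:E < tau <= T%:E)%E%:R.
Proof.
case/andP: t0T => t00 t0lT; have t0leT := ltW t0lT.
(* Common treatment of the cases without a first passage in []t0, T]]: every bracket vanishes and so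
   does the limit. *)
have zero : (forall n i, (i < n)%N -> below (gridpt t0 T n i) ->
     below (gridpt t0 T n i.+1)) ->
   (tau1 < tau3)%E && (t0%:E < tau <= T%:E)%E = false ->
   crossing_sum n @[n --> \oo] -->
   D (fine tau) * (tau1 < tau3)%E%:R * (t0%:E < tau <= T%:E)%E%:R.
  move=> H E.
  have -> : D (fine tau) * (tau1 < tau3)%E%:R * (t0%:E < tau <= T%:E)%E%:R = 0.
    by rewrite -mulrA -natrM mulnb E mulr0.
  rewrite (_ : crossing_sum = cst 0); first exact: cvg_cst.
  apply/funext => n; rewrite /crossing_sum big1// => i _.
  suff -> : `[< below (gridpt t0 T n i) /\ m (gridpt t0 T n i.+1) = 0%N >] =
      `[< below (gridpt t0 T n i.+1) /\ m (gridpt t0 T n i.+1) = 0%N >].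
    by rewrite subrr mulr0.
  apply: asbool_equiv_eq; split=> -[h ->]; split=> //; first exact: H.
  by apply: below_le h; exact: gridpt_le.
have ptT n i : (i < n)%N -> 0 <= gridpt t0 T n i.+1 <= T.
  move=> i_n; have /andP[h ->] := gridpt_itv t0leT (leq_ltn_trans (leq0n _) i_n) i_n.
  by rewrite (le_trans t00 h).
have ptT' n i : (i < n)%N -> 0 <= gridpt t0 T n i <= T.
  move=> i_n; have /andP[h ->] := gridpt_itv t0leT (leq_ltn_trans (leq0n _) i_n) (ltnW i_n).
  by rewrite (le_trans t00 h).
have TT : 0 <= T <= T by rewrite lexx andbT (le_trans t00).
have t0TT : 0 <= t0 <= T by rewrite t00.
have tau_le1 : (tau <= tau1)%E.
  by apply: ereal_inf_le_tmp; apply: image_subset => s [? ?]; split=> //; left.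
have [bT|nbT] := pselect (below T).
  apply: zero => [n i i_n _|].
    by apply: below_le bT; case/andP: (ptT _ _ i_n).
  suff -> : tau1 = +oo%E by rewrite ltNge leey.
  rewrite /tau1 (_ : [set t%:E | t in _] = set0) ?ereal_inf0//.
  apply/seteqP; split=> // y [t [/andP[/ltW t0' tT] bt] _].
  by move: bt; rewrite ltNge => /negP; apply; apply: bT; rewrite t0' tT.
have [bt0|nbt0] := pselect (below t0); last first.
  apply: zero => [n i i_n h|].
    exfalso; apply: nbt0; apply: below_le h; exact: gridpt_ge.
  apply/negbTE/negP => /andP[_ /andP[h _]].
  by have [] := (tau_gt t0TT).1 h.
have t0tau1 : (t0%:E < tau1)%E by apply/tau1_gt.
have tau1T : (tau1 <= T%:E)%E by rewrite leNgt; apply/negP => /(tau1_gt TT).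
have [th thE] : exists th, tau1 = th%:E.
  by case: tau1 t0tau1 tau1T => // r _ _; exists r.
have t0th : t0 < th by rewrite -lte_fin -thE.
have thT : th <= T by rewrite -lee_fin -thE.
have th0 : 0 <= th by apply/ltW/(le_lt_trans t00).
have belowE s : 0 <= s <= T -> below s <-> s < th.
  by move=> sT; rewrite -lte_fin -thE; apply: iff_sym; exact: tau1_gt.
have -> : D (fine tau) * (tau1 < tau3)%E%:R * (t0%:E < tau <= T%:E)%E%:R =
    D th * (m th == 0%N)%:R.
  have [mth|mth] := eqVneq (m th) 0%N.
    have -> : (tau1 < tau3)%E by rewrite thE; apply/tau3_gt.
    (* A value [r] of [tau] below [th] is impossible: neither a passage nor an intervention has
       occurred by [r], so [tau_gt] would give [r < tau]. *)
    have tauE : tau = th%:E.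
      apply/eqP; rewrite eq_le -{1}thE tau_le1/= leNgt; apply/negP => h.
      have tau0 : (0%:E <= tau)%E.
        by apply: le_ereal_inf_tmp => _ [s [/andP[/ltW s0 _] _] <-]; rewrite lee_fin.
      have [r rE] : exists r, tau = r%:E.
        by case: tau h tau0 => // r _ _; exists r.
      move: h tau0; rewrite rE lte_fin lee_fin => rth r0.
      have rT : 0 <= r <= T by rewrite r0 (le_trans (ltW rth)).
      have : (r%:E < tau)%E.
        apply/tau_gt => //; split; first exact/belowE.
        by apply/eqP; rewrite -leqn0 -mth; apply: m_nd => //; exact: ltW.
      by rewrite rE ltxx.
    by rewrite tauE/= lte_fin lee_fin t0th thT !mulr1.
  (* An intervention at the instant [th] itself is included in [m th], in agreement with the strict
     inequality in the recovery. *)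
  suff -> : (tau1 < tau3)%E = false by rewrite mulr0 mul0r mulr0.
  apply/negbTE/negP; rewrite thE => /(tau3_gt th0) h.
  by rewrite h in mth.
rewrite (_ : crossing_sum = fun n => stepfun t0 T n
   (fun i => D (gridpt t0 T n i.+1) * (m (gridpt t0 T n i.+1) == 0%N)%:R) th); last first.
  apply/funext => n; apply: eq_bigr => i _; rewrite -mulrA; congr (_ * _).
  have sT := ptT _ _ (ltn_ord i); have sT' := ptT' _ _ (ltn_ord i).
  have e1 : `[< below (gridpt t0 T n i) /\ m (gridpt t0 T n i.+1) = 0%N >] =
      (gridpt t0 T n i < th) && (m (gridpt t0 T n i.+1) == 0%N).
    apply/asboolP/andP => -[h1 h2]; split; [exact/belowE|exact/eqP|exact/belowE|exact/eqP].
  have e2 : `[< below (gridpt t0 T n i.+1) /\ m (gridpt t0 T n i.+1) = 0%N >] =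
      (gridpt t0 T n i.+1 < th) && (m (gridpt t0 T n i.+1) == 0%N).
    apply/asboolP/andP => -[h1 h2]; split; [exact/belowE|exact/eqP|exact/belowE|exact/eqP].
  rewrite e1 e2 indicE /cell.
  have -> : (th \in `]gridpt t0 T n i, gridpt t0 T n i.+1]%classic) =
      (gridpt t0 T n i < th <= gridpt t0 T n i.+1).
    by apply/idP/idP => [/set_mem|h]; rewrite ?inE /= in_itv.
  have : gridpt t0 T n i <= gridpt t0 T n i.+1 by exact: gridpt_le.
  move: (gridpt t0 T n i) (gridpt t0 T n i.+1) => p q pq.
  case: (m q == 0%N); rewrite ?andbT ?andbF/= ?subrr ?mul0r// mul1r.
  have [qth|thq] := ltP q th; first by rewrite (le_lt_trans pq qth) andbF subrr.
  by rewrite andbT subr0.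
apply: (@stepfun_right_cvg _ _ _ _ (fun s => D s * (m s == 0%N)%:R)).
  by rewrite t0th thT.
apply: cvgM; first by apply: D_rc; rewrite t0th.
apply: cvg_near_cst; have [dl dl0 H] := m_rc th0.
near=> s; rewrite H//; apply/andP; split.
  by apply: ltW; near: s; exact: nbhs_right_gt.
by near: s; apply: nbhs_right_lt; rewrite ltrDl.
Unshelve. all: by end_near. Qed.

End stopping.

(** * Independence of the driving processes *)

Section trace.
Context d (Omega : measurableType d) (R : realType) (P : probability Omega R).
Implicit Types (A B U : set Omega) (G H K : set (set Omega)).

(** With [U] the whole space this is the completion of [K]; with [U] a no-intervention event it says
    that an observation adds nothing to [K] as long as [U] holds. *)
Definition trace_mod K U : set (set Omega) :=
  [set A | exists2 A', K A' & {ae P, forall w, U w -> (A w <-> A' w)}].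

Lemma trace_mod_sigma K U : sigma_algebra setT K ->
  sigma_algebra setT (trace_mod K U).
Proof.
move=> sK; split.
- by exists set0; [case: sK|exact: aeW].
- move=> A [A' KA' AA']; exists (~` A'); first exact: sigmaC.
  by apply: filterS AA' => w + Uw => /(_ Uw) [h1 h2]; rewrite setTD; split; exact: contra_not.
- move=> F HF; have /choice[F' HF'] : forall n, exists A', K A' /\
      {ae P, forall w, U w -> (F n w <-> A' w)}.
    by move=> n; have [A' ? ?] := HF n; exists A'.
  exists (\bigcup_n F' n); first by apply: sigma_bigcup => // n; case: (HF' n).
  have : {ae P, forall w, forall n, U w -> (F n w <-> F' n w)}.
    by apply: ae_foralln => n; case: (HF' n).
  apply: filterS => w h Uw.
  by split=> -[n _ Fn]; exists n => //; apply/(h n Uw).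
Qed.

Lemma sub_trace_mod K U : K `<=` trace_mod K U.
Proof. by move=> A KA; exists A => //; exact: aeW. Qed.

Lemma trace_mod_negligible K U : sigma_algebra setT K ->
  P.-negligible `<=` trace_mod K U.
Proof.
move=> sK A nA; exists set0; first by case: sK.
have : {ae P, forall w, ~ A w} by apply: negligibleS nA => w /contrapT.
by apply: filterS => w Aw _; split.
Qed.

Lemma trace_mod_mono K K' U : K `<=` K' -> trace_mod K U `<=` trace_mod K' U.
Proof. by move=> KK' A [A' KA' h]; exists A' => //; exact: KK'. Qed.

Lemma ae_eq_measurable A A' : measure_is_complete P -> measurable A' ->
  {ae P, forall w, A w <-> A' w} -> measurable A.
Proof.
move=> cP mA' h.
have sm : sigma_algebra setT (@measurable _ Omega) by exact: sigma_algebra_measurable.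
apply/(measurable_indicP R).
have : gmeas (@measurable _ Omega) (\1_A : Omega -> R).
  apply: (@gmeas_ae _ _ _ P _ \1_A') => //; first exact: gmeas_indic.
  apply: filterS h => w [h1 h2]; rewrite !indicE; congr (nat_of_bool _)%:R.
  by apply/idP/idP => /set_mem ?; apply/mem_set; auto.
by move/(gmeasP _ sm) => mf _ B mB; rewrite setTI; exact: mf.
Qed.

Lemma ae_eq_prob A A' : measurable A -> measurable A' ->
  {ae P, forall w, A w <-> A' w} -> P A = P A'.
Proof.
move=> mA mA' h; rewrite -(@fineK _ (P A)) ?fin_num_measure//.
rewrite -(@fineK _ (P A')) ?fin_num_measure//; congr (_%:E).
rewrite -!Ex_indic//; apply: Ex_ae; [exact: bfun_indic..|].
apply: filterS h => w [h1 h2]; rewrite !indicE; congr (nat_of_bool _)%:R.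
by apply/idP/idP => /set_mem ?; apply/mem_set; auto.
Qed.

Definition completion K := trace_mod K setT.

Lemma subsigma_completion K : measure_is_complete P -> subsigma K ->
  subsigma (completion K).
Proof.
move=> cP [sK mK]; split; first exact: trace_mod_sigma.
move=> A [A' KA' h]; apply: (ae_eq_measurable cP (mK _ KA')).
by apply: filterS h => w; apply.
Qed.

Lemma indep_completion K B : measure_is_complete P -> subsigma K -> measurable B ->
  (forall A, K A -> P (A `&` B) = (P A * P B)%E) ->
  forall A, completion K A -> P (A `&` B) = (P A * P B)%E.
Proof.
move=> cP sK mB KB A cA; have [_ mcK] := subsigma_completion cP sK.
have mA := mcK _ cA; case: cA => A' KA' h; have mA' := sK.2 _ KA'.
have {}h : {ae P, forall w, A w <-> A' w} by apply: filterS h => w; apply.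
rewrite (ae_eq_prob mA mA' h) -KB//; apply: ae_eq_prob; [exact: measurableI..|].
by apply: filterS h => w [h1 h2]; split=> -[]; split; auto.
Qed.

(** Triple intersections form a pi-system that generates the join. *)
Lemma indep3 G0 G1 G2 B : subsigma G0 -> subsigma G1 -> subsigma G2 -> measurable B ->
  (forall A0 A1 A2, G0 A0 -> G1 A1 -> G2 A2 ->
     P (A0 `&` A1 `&` A2 `&` B) = (P (A0 `&` A1 `&` A2) * P B)%E) ->
  forall A, <<s G0 `|` G1 `|` G2 >> A -> P (A `&` B) = (P A * P B)%E.
Proof.
move=> [s0 m0] [s1 m1] [s2 m2] mB H.
pose C : set (set Omega) := [set A | exists A0 A1 A2,
  [/\ G0 A0, G1 A1, G2 A2 & A = A0 `&` A1 `&` A2]].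
have CI : setI_closed C.
  move=> _ _ [A0 [A1 [A2 [h0 h1 h2 ->]]]] [A0' [A1' [A2' [h0' h1' h2' ->]]]].
  exists (A0 `&` A0'), (A1 `&` A1'), (A2 `&` A2'); split; [exact: sigmaI..|].
  by rewrite (setIACA (A0 `&` A1)) (setIACA A0).
have sub : <<s G0 `|` G1 `|` G2 >> `<=` <<s C >>.
  apply: smallest_sub; first exact: smallest_sigma_algebra.
  move=> A GA; apply: sub_sigma_algebra; case: GA => [[]|] GA.
  - exists A, setT, setT; split=> //; [exact: sigmaT..|by rewrite !setIT].
  - exists setT, A, setT; split=> //; [exact: sigmaT..|by rewrite setTI setIT].
  - exists setT, setT, A; split=> //; [exact: sigmaT..|by rewrite !setTI].
move=> A /sub; apply: indep_generated => //.
- move=> _ [A0 [A1 [A2 [h0 h1 h2 ->]]]].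
  by apply: measurableI; [apply: measurableI|]; auto.
- by move=> _ [A0 [A1 [A2 [h0 h1 h2 ->]]]]; exact: H.
Qed.

End trace.

Section sigma_gen.
Context d (Omega : measurableType d).
Implicit Types (K : set (set Omega)).

Lemma sigma_gen_sub d' (U : measurableType d') (I : Type) (D : set I)
    (X : I -> Omega -> U) K : sigma_algebra setT K ->
  (forall i, D i -> gmeas K (X i)) -> sigma_gen D X `<=` K.
Proof.
move=> sK XK; apply: smallest_sub => // A [i Di [B mB <-]].
by rewrite setTI; apply: (gmeasP _ sK).1 mB; exact: XK.
Qed.

Lemma sigma_gen_gmeas d' (U : measurableType d') (I : Type) (D : set I)
    (X : I -> Omega -> U) i : D i -> gmeas (sigma_gen D X) (X i).
Proof.
move=> Di; apply/gmeasP; first exact: smallest_sigma_algebra.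
move=> B mB; apply: sub_sigma_algebra; exists i => //.
by exists B => //; rewrite setTI.
Qed.

Lemma subsigma_sigma_gen d' (U : measurableType d') (I : Type) (D : set I)
    (X : I -> Omega -> U) : (forall i, D i -> measurable_fun setT (X i)) ->
  subsigma (sigma_gen D X).
Proof.
move=> mX; split; first exact: smallest_sigma_algebra.
apply: sigma_gen_sub; first exact: sigma_algebra_measurable.
move=> i Di; apply/gmeasP; first exact: sigma_algebra_measurable.
by move=> B mB; have := mX i Di measurableT B mB; rewrite setTI.
Qed.

(** A sum of random length is split over the countably many values of its length. *)
Lemma gmeas_compound (R : realType) K (N : Omega -> nat) (a : nat -> Omega -> R) :
  sigma_algebra setT K -> gmeas K N -> (forall k, gmeas K (a k)) ->
  gmeas K (fun w => \sum_(k < N w) a k w).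
Proof.
move=> sK mN ma; apply/(gmeasP _ sK) => B mB.
have -> : (fun w => \sum_(k < N w) a k w) @^-1` B =
  \bigcup_n (N @^-1` [set n] `&` (fun w => \sum_(k < n) a k w) @^-1` B).
  apply/seteqP; split=> [w Bw|w [n _ [/= <-]]//].
  by exists (N w).
apply: sigma_bigcup => // n; apply: sigmaI => //.
  by apply: (gmeasP _ sK).1.
apply: (gmeasP _ sK).1 mB.
by apply: measurable_sum => k; exact: ma.
Qed.

End sigma_gen.

Section mutual_independence4.
Context d (Omega : measurableType d) (R : realType) (P : probability Omega R).

Lemma mutually_independent4 (G0 G1 G2 G3 : set (set Omega)) :
  mutually_independent P (tnth [tuple G0; G1; G2; G3]) ->
  forall A0 A1 A2 A3, G0 A0 -> G1 A1 -> G2 A2 -> G3 A3 ->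
  P (A0 `&` A1 `&` A2 `&` A3) = (P A0 * P A1 * P A2 * P A3)%E.
Proof.
move=> ind A0 A1 A2 A3 h0 h1 h2 h3.
pose s : {fset 'I_4} := [fset i | i in 'I_4]%fset.
have sT i : i \in s by rewrite in_fset.
have := ind s (tnth [tuple A0; A1; A2; A3]) _.
rewrite (perm_big (index_enum 'I_4)); last first.
  apply: uniq_perm; [exact: fset_uniq|exact: index_enum_uniq|].
  by move=> i; rewrite mem_index_enum; exact: sT.
rewrite !big_ord_recl big_ord0 /= !muleA mule1 => <-.
  congr (P _); apply/seteqP; split=> w.
    move=> [[[w0 w1] w2] w3] i _.
    by case: i => -[|[|[|[|//]]]] hi; rewrite (tnth_nth set0).
  move=> h; have g k (hk : (k < 4)%N) : nth set0 [:: A0; A1; A2; A3] k w.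
    by have := h (Ordinal hk) (sT _); rewrite (tnth_nth set0).
  by split; [split; [split|]|]; [exact: (g 0)|exact: (g 1)|exact: (g 2)|exact: (g 3)].
move=> i _; case: i => -[|[|[|[|//]]]] hi; by rewrite !(tnth_nth set0).
Qed.

End mutual_independence4.

Section poisson.
Context d (Omega : measurableType d) (R : realType) (P : probability Omega R).
Variables (rate : R) (N : R -> Omega -> nat).
Hypothesis rate0 : 0 < rate.
Hypothesis NP : is_poisson_process P rate N.

Lemma poisson_ge2_set_measurable (s t : R) : 0 <= s -> s < t ->
  measurable [set w | (2 <= N t w - N s w)%N].
Proof.
move=> s0 st; have mN u : 0 <= u -> measurable_fun setT (N u).
  by move=> u0; exact: poisson_measurable NP u u0.
have := measurable_fun_subn (mN t (le_trans s0 (ltW st))) (mN s s0).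
move=> /(_ measurableT [set k | (2 <= k)%N] I); rewrite setTI.
by [].
Qed.

(** For mean [h] the probability is [1 - exp (- h) * (1 + h)], and [exp (- h) >= 1 - h] turns this
    into at most [h ^ 2]. The square is what beats the number of cells when summing over a grid. *)
Lemma poisson_ge2_le (s t : R) : 0 <= s -> s < t ->
  (P [set w | (2 <= N t w - N s w)%N] <= ((rate * (t - s)) ^+ 2)%:E)%E.
Proof.
move=> s0 st; set h := rate * (t - s).
have h0 : 0 <= h by rewrite mulr_ge0 ?subr_ge0// ltW.
have mN u : 0 <= u -> measurable_fun setT (N u).
  by move=> u0; exact: poisson_measurable NP u u0.
have mE k : measurable [set w | (N t w - N s w)%N = k].
  have := measurable_fun_subn (mN t (le_trans s0 (ltW st))) (mN s s0).
  by move=> /(_ measurableT [set k] I); rewrite setTI.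
have -> : [set w | (2 <= N t w - N s w)%N] =
    ~` ([set w | (N t w - N s w)%N = 0%N] `|` [set w | (N t w - N s w)%N = 1%N]).
  apply/seteqP; split=> w /=; first by move=> h2 [] e; rewrite e in h2.
  by case: (_ - _)%N => [|[|k]]// h'; exfalso; apply: h'; [left|right].
rewrite probability_setC; last exact: measurableU.
rewrite measureU//; last by apply/seteqP; split=> // w /= [->].
apply: (@le_trans _ _ (1 - (P [set w | (N t w - N s w)%N = 0%N] +
                            P [set w | (N t w - N s w)%N = 1%N]))%E) => //.
rewrite !(poisson_law NP)//.
apply: (@le_trans _ _ (1 - (poisson_pmf h 0 + poisson_pmf h 1))%:E).
  by rewrite EFinB EFinD.
rewrite lee_fin /poisson_pmf.
have hgt0 : 0 < h by rewrite mulr_gt0 ?subr_gt0.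
rewrite -/h hgt0 !expr0 !expr1 !fact0 !invr1 !mulr1 mul1r.
have := expR_ge1Dx (- h); move: (expR (- h)) => e he.
have : (1 - h) * (1 + h) <= e * (1 + h) by rewrite ler_wpM2r// addr_ge0.
by rewrite expr2; lra.
Qed.

(* Over a grid with [n] cells on [0, M], the probability that some cell contains two
   jumps is at most [(rate * M) ^ 2 / n]. *)
Lemma poisson_simple : {ae P, forall w, forall t : R, 0 <= t -> (0 < N t w)%N ->
  exists s, 0 <= s <= t /\ N s w = 1%N}.
Proof.
pose bad (M : nat) w := (0 < N M.+1%:R w)%N /\
  forall s : R, 0 <= s <= M.+1%:R -> N s w <> 1%N.
suff H M : {ae P, forall w, ~ bad M w}.
  apply: filterS2 (ae_foralln H) (poisson_nondecreasing NP) => w nb nd t t0 Nt.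
  apply: contrapT => h; have [M tM] : exists M : nat, t <= M.+1%:R.
    exists (Num.truncn t); apply/ltW; exact: truncnS_gt.
  apply: (nb M); split; first by apply: leq_trans Nt (nd _ _ t0 tM).
  move=> s /andP[s0 sM] Ns; have [st|ts] := leP s t.
    by apply: h; exists s; rewrite s0 st.
  apply: h; exists t; rewrite t0 lexx; split=> //.
  by apply/eqP; rewrite eqn_leq Nt andbT -Ns nd// ltW.
pose M' : R := M.+1%:R; have M0 : 0 < M' by rewrite ltr0n.
pose E n i : set Omega := [set w | (2 <= N (gridpt 0 M' n.+1 i.+1) w - N (gridpt 0 M' n.+1 i) w)%N].
have pt0 n i : 0 <= gridpt 0 M' n.+1 i by apply: gridpt_ge; exact: ltW.
have ptlt n i : gridpt 0 M' n.+1 i < gridpt 0 M' n.+1 i.+1.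
  by rewrite gridptS subr0 ltrDl divr_gt0// ltr0n.
have mE n i : measurable (E n i) by exact: poisson_ge2_set_measurable.
pose U n : set Omega := \big[setU/set0]_(i < n.+1) E n i.
have mU n : measurable (U n) by apply: bigsetU_measurable => i _; exact: mE.
have UE n : (P (U n) <= (((rate * M') ^+ 2) / n.+1%:R)%:E)%E.
  apply: (@le_trans _ _ (\sum_(i < n.+1) P (E n i))%E).
    by apply: content_subadditive.
  apply: (@le_trans _ _ (\sum_(i < n.+1) ((rate * (M' / n.+1%:R)) ^+ 2)%:E)%E).
    apply: lee_sum => i _; have := poisson_ge2_le (pt0 n i) (ptlt n i).
    suff -> : gridpt 0 M' n.+1 i.+1 - gridpt 0 M' n.+1 i = M' / n.+1%:R by [].
    by rewrite gridptS subr0 addrC addKr.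
  rewrite sumEFin sumr_const card_ord lee_fin -[leLHS]mulr_natr.
  rewrite le_eqVlt; apply/orP; left; apply/eqP.
  have : n.+1%:R != 0 :> R by rewrite pnatr_eq0.
  by move: n.+1%:R => r r0; field.
have mI : measurable (\bigcap_n U n) by exact: bigcap_measurable.
have PI : P (\bigcap_n U n) = 0%E.
  apply/eqP; rewrite eq_le measure_ge0 andbT.
  apply/lee_addgt0Pr => e e0; rewrite add0e.
  have /cvgrPdist_lt /(_ _ e0) [n _ hn] := @mesh_cvg0 R 0 ((rate * M') ^+ 2).
  apply: (@le_trans _ _ (P (U n))).
    by apply: le_measure; rewrite ?inE//; exact: bigcap_inf.
  apply: le_trans (UE n) _; rewrite lee_fin.
  have := hn n.+1 (leqnSn n); rewrite /= sub0r normrN subr0 => /ltW.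
  by apply: le_trans; exact: ler_norm.
have nI : {ae P, forall w, ~ (\bigcap_n U n) w}.
  by exists (\bigcap_n U n); split=> // w /contrapT.
apply: filterS3 nI (poisson_start NP) (poisson_nondecreasing NP) => w nU N0 nd.
move=> [NM h]; apply: nU => n _.
(* If the value 1 is never taken, the count goes from 0 to at least 2 within the first cell whose
   right end has a positive count. *)
have ex : exists i, (0 < N (gridpt 0 M' n.+1 i.+1) w)%N.
  by exists n; rewrite gridptn.
case: (ex_minnP ex) => i Ni imin.
have i_n : (i <= n)%N by apply: imin; rewrite gridptn.
rewrite /U -bigcup_mkord; exists i => //=; rewrite /E/=.
have -> : N (gridpt 0 M' n.+1 i) w = 0%N.
  case: i Ni imin i_n => [|i] Ni imin i_n; first by rewrite gridpt0.
  apply/eqP; rewrite -leqn0 leqNgt; apply/negP => /imin.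
  by rewrite ltnn.
rewrite subn0 ltn_neqAle Ni andbT eq_sym; apply/eqP.
by apply: h; apply: gridpt_itv => //; exact: ltW.
Qed.

End poisson.

Lemma aeI d (Omega : measurableType d) (R : realType) (P : probability Omega R)
    (A B : Omega -> Prop) : {ae P, forall w, A w} -> {ae P, forall w, B w} ->
  {ae P, forall w, A w /\ B w}.
Proof. by move=> hA hB; apply: filterS2 hA hB => w; split. Qed.

Section paths.
Context d (Omega : measurableType d) (R : realType) (P : probability Omega R).
Variables (p : coco_params R) (X : drivers Omega R).
Hypothesis adm : admissible p.
Hypothesis spec : drivers_spec P p X.

Definition effects (t : R) (w : Omega) : R :=
  vsig2 p * compound (count2 X)
    (fun k w' => jump_effect p (neg_part (jump2 X k w'))) t w.

(** One almost sure event gathering all path properties, so that later pathwise arguments discard a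
    single null set. *)
Record good_path (w : Omega) : Prop := {
  good_lam : cadlag (fun t => lambda3 p X t w);
  good_lam_ge0 : forall v, 0 <= v -> 0 <= lambda3 p X v w;
  good_euler : forall t, 0 <= t ->
    euler (kap2 p) (lam20 p) (effects ^~ w) t n n @[n --> \oo] --> intensity2 X t w;
  good_count1_rc : locally_constant_right (fun t => count1 X t w);
  good_count1_nd : forall s t, 0 <= s -> s <= t -> (count1 X s w <= count1 X t w)%N;
  good_count1_0 : count1 X 0 w = 0%N;
  good_unit_rc : locally_constant_right (fun t => unit_poisson X t w);
  good_unit_nd : forall s t, 0 <= s -> s <= t ->
    (unit_poisson X s w <= unit_poisson X t w)%N;
  good_unit_0 : unit_poisson X 0 w = 0%N;
  good_unit_simple : forall t : R, 0 <= t -> (0 < unit_poisson X t w)%N ->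
    exists s, 0 <= s <= t /\ unit_poisson X s w = 1%N }.

Lemma neg_part_ge0 (x : R) : 0 <= neg_part x.
Proof. by rewrite /neg_part oppr_ge0 ge_min lexx orbT. Qed.

Lemma jump_effect_neg_ge0 (x : R) : 0 <= jump_effect p (neg_part x).
Proof. by apply: (jump_effect_ge0 adm); exact: neg_part_ge0. Qed.

Lemma compound_nd (N : R -> Omega -> nat) (a : nat -> Omega -> R) w :
  (forall k, 0 <= a k w) ->
  (forall s t, 0 <= s -> s <= t -> (N s w <= N t w)%N) ->
  forall s t, 0 <= s -> s <= t -> compound N a s w <= compound N a t w.
Proof.
move=> a0 nd s t s0 st; rewrite /compound.
rewrite -!(big_mkord xpredT (fun k => a k w)).
rewrite (big_cat_nat _ (nd _ _ s0 st))//= lerDl.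
by rewrite big_nat; apply: sumr_ge0 => i _; exact: a0.
Qed.

Lemma ae_good_path : {ae P, forall w, good_path w}.
Proof.
have N1 := compound_counting (J_cp spec); have N2 := compound_counting (Y_cp spec).
have N3 := N3_pp spec.
have := aeI (poisson_simple ltr01 N3) (aeI (poisson_rcont N1)
  (aeI (poisson_rcont N3) (aeI (poisson_nondecreasing N1)
  (aeI (poisson_nondecreasing N2) (aeI (poisson_nondecreasing N3)
  (aeI (poisson_start N1) (aeI (poisson_start N3)
  (aeI (bm_continuous (W_bm spec)) (intensity2_eq spec))))))))).
apply: filterS => w [simple [rc1 [rc3 [nd1 [nd2 [nd3 [z1 [z3 [cW [cx xE]]]]]]]]]].
(* Jumps only push the intensity up, which is what the Euler scheme needs to keep the solution
   nonnegative. *)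
have eff_nd s t : 0 <= s -> s <= t -> effects s w <= effects t w.
  move=> s0 st; rewrite /effects ler_pM2l ?(vsig2_gt0 adm)//.
  by apply: compound_nd => // k; exact: jump_effect_neg_ge0.
have eff0 : 0 <= lam20 p + effects 0 w.
  apply: addr_ge0; first exact/ltW/(lam20_gt0 adm).
  apply: mulr_ge0; first exact/ltW/(vsig2_gt0 adm).
  by apply: sumr_ge0 => k _; exact: jump_effect_neg_ge0.
have x_ge0 := sol_ge0 (kap2_gt0 adm) cx xE eff0 eff_nd.
move/continuous_within_itvcyP : cW => [cW1 cW0].
have cWr t : 0 <= t -> brownian X s w @[s --> t^'+] --> brownian X t w.
  rewrite le_eqVlt => /predU1P[<-//|t0]; apply: cvg_at_right_filter.
  by apply: cW1; rewrite in_itv/= t0.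
have cWl t : 0 < t -> brownian X s w @[s --> t^'-] --> brownian X t w.
  by move=> t0; apply: cvg_at_left_filter; apply: cW1; rewrite in_itv/= t0.
split=> //.
- split=> t tge0.
    apply: cvgD; last exact: cx.1.
    rewrite expr2; under eq_fun do rewrite expr2.
    by apply: cvgM; apply: cvgD; apply: cvgM; try exact: cvg_cst;
      [exact: cvg_at_right_filter|exact: cWr|exact: cvg_at_right_filter|exact: cWr].
  apply: is_cvgD; last exact: cx.2.
  apply/cvg_ex; exists ((kap1 p * t + vsig1 p * brownian X t w) ^+ 2).
  rewrite expr2; under eq_fun do rewrite expr2.
  by apply: cvgM; apply: cvgD; apply: cvgM; try exact: cvg_cst;
    [exact: cvg_at_left_filter|exact: cWl|exact: cvg_at_left_filter|exact: cWl].
- by move=> v v0; rewrite addr_ge0 ?sqr_ge0// x_ge0.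
- by move=> t tge0; exact: (euler_cvg (kap2_gt0 adm) cx xE).
- exact: nat_rcont.
- exact: nat_rcont.
Qed.

End paths.

Section sources.
Context d (Omega : measurableType d) (R : realType) (P : probability Omega R).
Variables (p : coco_params R) (X : drivers Omega R) (F : R -> set (set Omega)).
Hypothesis adm : admissible p.
Hypothesis spec : drivers_spec P p X.
Hypothesis filt : filtration_spec P p X F.

Let cP : measure_is_complete P := filtration_complete (F_usual filt).

Definition srcW := sigma_gen `[0, +oo[ (brownian X).
Definition srcJ : set (set Omega) :=
  <<s sigma_gen `[0, +oo[ (count1 X) `|` sigma_gen setT (jump1 X) >>.
Definition srcY : set (set Omega) :=
  <<s sigma_gen `[0, +oo[ (count2 X) `|` sigma_gen setT (jump2 X) >>.
Definition srcN := sigma_gen `[0, +oo[ (unit_poisson X).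
Definition pastJ (s : R) := sigma_gen `[0, s] (procJ X).
Definition futureJ (s : R) := sigma_gen `[s, +oo[ (fun u => procJ X u \- procJ X s).

(* [srcWY] carries the intensity, [srcWJY] everything but the unit Poisson
   process, and [srcWJsY s] stops the losses at time [s]. *)
Definition srcWY := completion P <<s srcW `|` srcY >>.
Definition srcWJY := completion P <<s srcW `|` srcJ `|` srcY >>.
Definition srcWJsY (s : R) := completion P <<s srcW `|` pastJ s `|` srcY >>.

Lemma srcW_subsigma : subsigma srcW.
Proof.
apply: subsigma_sigma_gen => t; rewrite /= in_itv/= andbT.
exact: bm_measurable (W_bm spec) t.
Qed.

Lemma src_compound_subsigma (r : R) mu N a : is_compound_poisson P r mu N a ->
  subsigma <<s sigma_gen `[0, +oo[ N `|` sigma_gen setT a >>.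
Proof.
move=> h; apply: subsigma_gen => A [].
  apply: (subsigma_sigma_gen _).2 => t; rewrite /= in_itv/= andbT.
  exact: poisson_measurable (compound_counting h) t.
by apply: (subsigma_sigma_gen _).2 => k _; have [] := compound_law h k.
Qed.

Lemma srcJ_subsigma : subsigma srcJ.
Proof. exact: src_compound_subsigma (J_cp spec). Qed.

Lemma srcY_subsigma : subsigma srcY.
Proof. exact: src_compound_subsigma (Y_cp spec). Qed.

Lemma srcN_subsigma : subsigma srcN.
Proof.
apply: subsigma_sigma_gen => t; rewrite /= in_itv/= andbT.
exact: poisson_measurable (N3_pp spec) t.
Qed.

Lemma gmeas_gen_l {G H : set (set Omega)} {d'} {U : sigmaRingType d'} (f : Omega -> U) :
  sigma_algebra setT G -> gmeas G f -> gmeas <<s G `|` H >> f.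
Proof.
move=> sG; apply: (gmeas_sub sG (smallest_sigma_algebra _ _)).
by move=> A GA; apply: sub_sigma_algebra; left.
Qed.

Lemma gmeas_gen_r {G H : set (set Omega)} {d'} {U : sigmaRingType d'} (f : Omega -> U) :
  sigma_algebra setT H -> gmeas H f -> gmeas <<s G `|` H >> f.
Proof.
move=> sH; apply: (gmeas_sub sH (smallest_sigma_algebra _ _)).
by move=> A GA; apply: sub_sigma_algebra; right.
Qed.

Lemma gmeas_count_src (N : R -> Omega -> nat) (a : nat -> Omega -> R) (t : R) : 0 <= t ->
  gmeas <<s sigma_gen `[0, +oo[ N `|` sigma_gen setT a >> (N t : Omega -> nat).
Proof.
move=> t0; apply: gmeas_gen_l; first exact: smallest_sigma_algebra.
by apply: sigma_gen_gmeas; rewrite /= in_itv/= t0.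
Qed.

Lemma gmeas_jump_src (N : R -> Omega -> nat) (a : nat -> Omega -> R) k :
  gmeas <<s sigma_gen `[0, +oo[ N `|` sigma_gen setT a >> (a k : Omega -> R).
Proof.
apply: gmeas_gen_r; first exact: smallest_sigma_algebra.
exact: sigma_gen_gmeas.
Qed.

Lemma gmeas_procJ (t : R) : 0 <= t -> gmeas srcJ (procJ X t).
Proof.
move=> t0; apply: gmeas_compound; first exact: smallest_sigma_algebra.
  exact: gmeas_count_src.
exact: gmeas_jump_src.
Qed.

Lemma gmeas_procY (t : R) : 0 <= t -> gmeas srcY (procY X t).
Proof.
move=> t0; apply: gmeas_compound; first exact: smallest_sigma_algebra.
  exact: gmeas_count_src.
exact: gmeas_jump_src.
Qed.

(** [jump_effect] is monotone on nonnegative arguments, where [neg_part] takes its values; the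
    composite is monotone, hence Borel. *)
Lemma measurable_jump_effect_neg :
  measurable_fun setT (fun x => jump_effect p (neg_part x)).
Proof.
apply: nonincreasing_measurable => // x y xy.
apply: (jump_effect_incr adm); first exact: neg_part_ge0.
by rewrite /neg_part lerN2 le_min !ge_min xy lexx orbT.
Qed.

Lemma gmeas_effects (t : R) : 0 <= t -> gmeas srcY (effects p X t).
Proof.
move=> t0; apply: measurable_funM => //.
apply: gmeas_compound; first exact: smallest_sigma_algebra.
  exact: gmeas_count_src.
move=> k; apply: (measurableT_comp measurable_jump_effect_neg).
exact: gmeas_jump_src.
Qed.

Lemma pastJ_sub (s : R) : pastJ s `<=` srcJ.
Proof.
apply: sigma_gen_sub; first exact: smallest_sigma_algebra.
by move=> t; rewrite /= in_itv/= => /andP[t0 _]; exact: gmeas_procJ.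
Qed.

Lemma futureJ_sub (s : R) : 0 <= s -> futureJ s `<=` srcJ.
Proof.
move=> s0; apply: sigma_gen_sub; first exact: smallest_sigma_algebra.
move=> t; rewrite /= in_itv/= andbT => st.
by apply: measurable_funB; apply: gmeas_procJ => //; exact: le_trans st.
Qed.

Lemma pastJ_subsigma (s : R) : subsigma (pastJ s).
Proof.
split; first exact: smallest_sigma_algebra.
by move=> A /pastJ_sub; exact: srcJ_subsigma.2.
Qed.

Let gen2_subsigma (G H : set (set Omega)) : subsigma G -> subsigma H ->
  subsigma <<s G `|` H >>.
Proof. by move=> [_ mG] [_ mH]; apply: subsigma_gen => A [/mG|/mH]. Qed.

Let gen3_subsigma (G H K : set (set Omega)) : subsigma G -> subsigma H -> subsigma K ->
  subsigma <<s G `|` H `|` K >>.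
Proof. by move=> [_ mG] [_ mH] [_ mK]; apply: subsigma_gen => A [[/mG|/mH]|/mK]. Qed.

Lemma srcWY_subsigma : subsigma srcWY.
Proof.
apply: subsigma_completion => //.
exact: gen2_subsigma srcW_subsigma srcY_subsigma.
Qed.

Lemma srcWJY_subsigma : subsigma srcWJY.
Proof.
apply: subsigma_completion => //.
exact: gen3_subsigma srcW_subsigma srcJ_subsigma srcY_subsigma.
Qed.

Lemma srcWJsY_subsigma (s : R) : subsigma (srcWJsY s).
Proof.
apply: subsigma_completion => //.
exact: gen3_subsigma srcW_subsigma (pastJ_subsigma s) srcY_subsigma.
Qed.

Lemma srcWY_sub (s : R) : srcWY `<=` srcWJsY s.
Proof.
apply: trace_mod_mono; apply: smallest_sub; first exact: smallest_sigma_algebra.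
by move=> A [?|?]; apply: sub_sigma_algebra; [left; left|right].
Qed.

Lemma srcWJsY_sub (s : R) : srcWJsY s `<=` srcWJY.
Proof.
apply: trace_mod_mono; apply: smallest_sub; first exact: smallest_sigma_algebra.
by move=> A [[?|/pastJ_sub ?]|?]; apply: sub_sigma_algebra;
  [left; left|left; right|right].
Qed.

Lemma srcWJY_indep A B : srcWJY A -> srcN B -> P (A `&` B) = (P A * P B)%E.
Proof.
move=> GA GB; have mB := srcN_subsigma.2 _ GB.
have sG := gen3_subsigma srcW_subsigma srcJ_subsigma srcY_subsigma.
apply: (indep_completion cP sG mB _ GA).
apply: indep3 => //; [exact: srcW_subsigma|exact: srcJ_subsigma|exact: srcY_subsigma|].
move=> A0 A1 A2 h0 h1 h2; have ind := mutually_independent4 (drivers_independent spec).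
rewrite ind// -[A0 `&` A1 `&` A2]setIT ind//; last exact: sigmaT srcN_subsigma.1.
by rewrite probability_setT mule1.
Qed.

(** Taken from the filtration: past losses lie in [F s], later loss increments in
    [future_increments s]. *)
Lemma pastJ_futureJ_indep (s : R) A B : 0 <= s -> pastJ s A -> futureJ s B ->
  P (A `&` B) = (P A * P B)%E.
Proof.
move=> s0 hA hB; apply: (F_increments filt s0).
  rewrite (F_enlarged filt s0) => u /= su.
  apply: sub_sigma_algebra; left; apply: sub_sigma_algebra; left; left; right.
  move: A hA; apply: sigma_gen_sub; first exact: smallest_sigma_algebra.
  move=> t; rewrite /= in_itv/= => /andP[t0 ts]; apply: sigma_gen_gmeas.
  by rewrite /= in_itv/= t0 ltW// (le_lt_trans ts).
by apply: sub_sigma_algebra; left; right.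
Qed.

(** A past loss event intersected with a future one is a single event of [srcJ]. Mutual independence
    of the drivers splits it from the Brownian motion and the second compound process, and then past
    and future losses separate. *)
Lemma srcWJsY_indep (s : R) A B : 0 <= s -> srcWJsY s A -> futureJ s B ->
  P (A `&` B) = (P A * P B)%E.
Proof.
move=> s0 GA hB; have mB := srcJ_subsigma.2 _ (futureJ_sub s0 hB).
have sG := gen3_subsigma srcW_subsigma (pastJ_subsigma s) srcY_subsigma.
apply: (indep_completion cP sG mB _ GA).
apply: indep3 => //; [exact: srcW_subsigma|exact: pastJ_subsigma|exact: srcY_subsigma|].
move=> A0 A1 A2 h0 h1 h2; have ind := mutually_independent4 (drivers_independent spec).
have NT := sigmaT srcN_subsigma.1.
have h1' := pastJ_sub h1; have hB' := futureJ_sub s0 hB.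
(* The whole space occupies the slot of the unit Poisson process. *)
have e1 : P (A0 `&` (A1 `&` B) `&` A2 `&` setT) = (P A0 * (P A1 * P B) * P A2)%E.
  rewrite (ind _ _ _ _ h0 _ h2 NT); last exact: sigmaI srcJ_subsigma.1 h1' hB'.
  by rewrite (pastJ_futureJ_indep s0 h1 hB) probability_setT mule1.
have e2 : P (A0 `&` A1 `&` A2 `&` setT) = (P A0 * P A1 * P A2)%E.
  by rewrite (ind _ _ _ _ h0 h1' h2 NT) probability_setT mule1.
rewrite -[A0 `&` A1 `&` A2]setIT e2.
have -> : A0 `&` A1 `&` A2 `&` setT `&` B = A0 `&` (A1 `&` B) `&` A2 `&` setT.
  by rewrite !setIT setIAC !setIA.
rewrite e1 -!muleA; congr (_ * _)%E; congr (_ * _)%E; exact: muleC.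
Qed.

End sources.

(** * Monotonicity of the cotangent *)

Section trigonometry.
Context {R : realType}.

Lemma cot_tan (x : R) : cot x = tan (pi / 2 - x).
Proof.
have -> : pi / 2 - x = - x + pi / 2 by rewrite addrC.
by rewrite /tan sinDpihalf cosDpihalf cosN sinN opprK.
Qed.

Lemma cot_itv (x : R) : 0 < x < 1 -> pi / 2 - pi * x \in `](- (pi / 2)), (pi / 2)[.
Proof.
move=> /andP[x0 x1]; have p0 := @pi_gt0 R; rewrite in_itv/=.
have : pi * x < pi * 1 by rewrite ltr_pM2l.
have : 0 < pi * x by rewrite mulr_gt0.
by move=> ? ?; apply/andP; split; lra.
Qed.

(** Solving for [atan y] leaves the bound [pi / 2 - pi * x], inside the interval where [tan]
    increases and inverts [atan]. This turns a capital threshold into a level for the loss. *)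
Lemma cot_ltP (x y : R) : 0 < x < 1 ->
  (1 - (pi^-1 * atan y + 2^-1) < x) = (cot (pi * x) < y).
Proof.
move=> x01; have p0 := @pi_gt0 R.
have -> : (1 - (pi^-1 * atan y + 2^-1) < x) = (pi / 2 - pi * x < atan y).
  rewrite -(ltr_pM2l p0 _ x) mulrBr mulrDr mulVKf ?gt_eqF// mulr1.
  by apply/idP/idP => ?; lra.
rewrite cot_tan -[in RHS](atanK y) ltr_tan//; first exact: cot_itv.
by rewrite in_itv/= atan_gtNpi2 atan_ltpi2.
Qed.

Lemma cot_onem (x : R) : cot (pi * (1 - x)) = - cot (pi * x).
Proof.
rewrite !cot_tan -tanN; congr tan.
by rewrite mulrBr mulr1; lra.
Qed.

Lemma le_cot (x y : R) : 0 < x < 1 -> 0 < y < 1 -> x < y -> cot (pi * y) <= cot (pi * x).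
Proof.
move=> x01 y01 xy; rewrite !cot_tan ltW// ltr_tan ?cot_itv// ltrD2l ltrN2.
by rewrite ltr_pM2l// pi_gt0.
Qed.

End trigonometry.

Lemma grid_hits {R : realType} (a t u dl : R) : a < t -> a <= u <= t -> 0 < dl ->
  \forall n \near \oo, exists i, (0 < i <= n)%N /\ u <= gridpt a t n i < u + dl.
Proof.
move=> at_ /andP[au ut] dl0.
have /cvgrPdist_lt /(_ _ dl0) h := @mesh_cvg0 R a t.
near=> n; have n0 : (0 < n)%N by near: n; exact: nbhs_infty_gt.
have mesh : (t - a) / n%:R < dl.
  have : `|0 - (t - a) / n%:R| < dl by near: n; exact: h.
  by rewrite sub0r normrN; apply: le_lt_trans; exact: ler_norm.
move: au; rewrite le_eqVlt => /predU1P[<-|au].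
  (* Index 0 is not allowed, so [u = a] is approximated by the next grid point. *)
  exists 1%N; rewrite n0; split=> //; rewrite gridptS gridpt0 lerDl ltrD2l mesh.
  by rewrite divr_ge0// subr_ge0 ltW.
have [i [i_n iy]] := gridpt_cell n0 (introT andP (conj au ut)).
exists i.+1; split=> //; case/andP: iy => iy -> /=.
by rewrite gridptS ltrD.
Unshelve. all: by end_near. Qed.

(** * The loss process and the filtration *)

Section loss_paths.
Context d (Omega : measurableType d) (R : realType).
Variables (p : coco_params R) (X : drivers Omega R).
Hypothesis adm : admissible p.

Definition drift : R := lam1 p * (alpha p)%:R / beta p.

Lemma drift_gt0 : 0 < drift.
Proof.
by rewrite divr_gt0 ?(beta_gt0 adm)// mulr_gt0 ?(lam1_gt0 adm)// ltr0n (alpha_gt0 adm).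
Qed.

Lemma JcompE t w : Jcomp p X t w = procJ X t w - drift * t.
Proof. by rewrite /Jcomp /drift; congr (_ - _); rewrite mulrAC. Qed.

Lemma Bmin_01 : 0 < Bmin p < 1.
Proof.
by have /andP[-> /lt_trans] := Bmin_B0 adm; apply; have /andP[] := B0_01 adm.
Qed.

(** The barrier equals [cot (pi * Bmin) - cot (pi * B0)], and the cotangent decreases. Thus the
    compensated loss, which starts at 0, does not start above the barrier. *)
Lemma barrier_ge0 : 0 <= barrier p.
Proof.
rewrite /barrier cot_onem subr_ge0; have /andP[_ h] := Bmin_B0 adm.
by apply: le_cot h; [exact: Bmin_01|exact: B0_01].
Qed.

Lemma CET1_ltP t w : (CET1 p X t w < Bmin p) = (barrier p < Jcomp p X t w).
Proof.
by rewrite /CET1 cot_ltP ?Bmin_01// /barrier /Jcomp; apply/idP/idP => ?; lra.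
Qed.

Variable w : Omega.
Hypothesis n_rc : locally_constant_right (fun t => count1 X t w).
Hypothesis n_nd : forall s t, 0 <= s -> s <= t -> (count1 X s w <= count1 X t w)%N.
Hypothesis n_0 : count1 X 0 w = 0%N.

Lemma procJ_rc (t : R) : 0 <= t ->
  exists2 dl : R, 0 < dl & forall s, t <= s < t + dl -> procJ X s w = procJ X t w.
Proof.
move=> t0; have [dl dl0 H] := n_rc t0; exists dl => // s /H h.
by rewrite /procJ /compound h.
Qed.

Lemma Jcomp_down (t : R) : 0 <= t ->
  exists2 dl : R, 0 < dl & forall s, t <= s < t + dl -> Jcomp p X s w <= Jcomp p X t w.
Proof.
move=> t0; have [dl dl0 H] := procJ_rc t0; exists dl => // s /[dup] /H h /andP[ts _].
by rewrite !JcompE h lerB// ler_pM2l// drift_gt0.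
Qed.

Lemma Jcomp_open (t y : R) : 0 <= t -> y < Jcomp p X t w ->
  exists2 dl : R, 0 < dl & forall s, t <= s < t + dl -> y < Jcomp p X s w.
Proof.
move=> t0; rewrite JcompE => yt; have [dl dl0 H] := procJ_rc t0.
have e0 : 0 < (procJ X t w - drift * t - y) / drift.
  by rewrite divr_gt0 ?drift_gt0// subr_gt0.
(* The second bound is the time the drift takes to consume the excess over [y]. *)
exists (Order.min dl ((procJ X t w - drift * t - y) / drift)).
  by rewrite lt_min dl0.
move=> s /andP[ts]; rewrite -ltrBlDl lt_min => /andP[sd se].
rewrite JcompE (H s); last by rewrite ts -ltrBlDl.
move: se; rewrite ltr_pdivlMr ?drift_gt0// mulrC mulrBr => ?; lra.
Qed.

Lemma Jcomp_0 : Jcomp p X 0 w = 0.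
Proof. by rewrite JcompE /procJ /compound n_0 big_ord0 mulr0 subr0. Qed.

(** The Erlang jumps are nonnegative only almost surely; absolute values give a bound on every path
    with a nondecreasing count. *)
Lemma Jcomp_bounded (t : R) : 0 <= t ->
  exists M : R, forall s, 0 <= s <= t -> Jcomp p X s w <= M.
Proof.
move=> t0; exists (\sum_(k < count1 X t w) `|jump1 X k w|) => s /andP[s0 st].
rewrite JcompE (@le_trans _ _ (procJ X s w))//.
  by rewrite gerBl mulr_ge0// ltW ?drift_gt0.
rewrite /procJ /compound (le_trans (ler_norm _))// (le_trans (ler_norm_sum _ _ _))//.
rewrite -!(big_mkord xpredT (fun k => `|jump1 X k w|)).
rewrite [leRHS](big_cat_nat _ (n_nd s0 st))//= lerDl.
exact: sumr_ge0.
Qed.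

(** Boundedness of the path is essential here: [sup] of an unbounded set would be a default
    value. *)
Lemma Jbar_gtP (t x : R) : 0 <= t ->
  (x < Jbar p X t w) <-> ~ below (fun s => Jcomp p X s w) x t.
Proof.
move=> t0; have [M HM] := Jcomp_bounded t0.
set A := [set Jcomp p X s w | s in `[0, t]].
have A0 : A !=set0.
  by exists (Jcomp p X 0 w); exists 0 => //=; rewrite in_itv/= lexx t0.
have hA : has_sup A.
  split=> //; exists M => _ [s + <-]; rewrite /= in_itv/=; exact: HM.
split=> [h bl|nb].
  have : Jbar p X t w <= x.
    by apply: ge_sup => // _ [s + <-]; rewrite /= in_itv/=; exact: bl.
  by rewrite leNgt h.
rewrite ltNge; apply/negP => h; apply: nb => s st.
apply: le_trans h; apply: ub_le_sup => //; first exact: hA.2.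
by exists s => //=; rewrite in_itv.
Qed.

(* A crossing persists on a short interval to its right, which contains grid points. *)
Lemma below_grid (a t x : R) : 0 <= a < t ->
  \forall n \near \oo, (forall s, a <= s <= t -> Jcomp p X s w <= x) <->
    forall i, (0 < i <= n)%N -> Jcomp p X (gridpt a t n i) w <= x.
Proof.
move=> /andP[a0 at_].
have [bl|nb] := pselect (forall s, a <= s <= t -> Jcomp p X s w <= x).
  near=> n; split=> // _ i /andP[i0 i_n]; apply: bl.
  apply: gridpt_itv => //; [exact: ltW|exact: leq_trans i0 i_n].
have [u /not_implyP[aut xu]] : exists u, ~ (a <= u <= t -> Jcomp p X u w <= x).
  exact/existsNP.
have u0 : 0 <= u by case/andP: aut => /(le_trans a0).
move/negP : xu; rewrite -ltNge => /(Jcomp_open u0)[dl dl0 H].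
apply: filterS (grid_hits at_ aut dl0) => n [i [i_n iu]].
split=> [//|h]; exfalso; have := H _ iu; rewrite ltNge => /negP; apply.
exact: h.
Unshelve. all: by end_near. Qed.

End loss_paths.

Section adapted.
Context d (Omega : measurableType d) (R : realType) (P : probability Omega R).
Variables (p : coco_params R) (X : drivers Omega R) (F : R -> set (set Omega)).
Hypothesis adm : admissible p.
Hypothesis spec : drivers_spec P p X.
Hypothesis filt : filtration_spec P p X F.

Let cP : measure_is_complete P := filtration_complete (F_usual filt).
Let sWY := srcWY_subsigma spec filt.

Lemma srcWY_negligible : P.-negligible `<=` srcWY P X.
Proof. by apply: trace_mod_negligible; exact: smallest_sigma_algebra. Qed.

Lemma srcWJsY_negligible s : P.-negligible `<=` srcWJsY P X s.
Proof. by apply: trace_mod_negligible; exact: smallest_sigma_algebra. Qed.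

Lemma gmeas_srcW_WY (f : Omega -> R) : gmeas (srcW X) f -> gmeas (srcWY P X) f.
Proof.
apply: (gmeas_sub (srcW_subsigma spec).1 sWY.1) => A WA.
by apply: sub_trace_mod; apply: sub_sigma_algebra; left.
Qed.

Lemma gmeas_srcY_WY (f : Omega -> R) : gmeas (srcY X) f -> gmeas (srcWY P X) f.
Proof.
apply: (gmeas_sub (srcY_subsigma spec).1 sWY.1) => A WA.
by apply: sub_trace_mod; apply: sub_sigma_algebra; right.
Qed.

(** The equation is only pathwise, but each Euler approximation is an explicit function of the
    effects at finitely many times. *)
Lemma gmeas_intensity2 (t : R) : 0 <= t -> gmeas (srcWY P X) (intensity2 X t).
Proof.
move=> t0; apply: (@gmeas_ae_cvg _ _ _ P _
    (fun n w => euler (kap2 p) (lam20 p) ((effects p X)^~ w) t n n)).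
- exact: sWY.1.
- exact: srcWY_negligible.
- move=> n; apply: gmeas_srcY_WY.
  suff H i : gmeas (srcY X) (fun w => euler (kap2 p) (lam20 p) ((effects p X)^~ w) t n i).
    exact: H.
  have gE j : gmeas (srcY X) (effects p X (gridpt 0 t n j)).
    by apply: gmeas_effects => //; exact: gridpt_ge.
  elim: i => [|i IH] /=.
    apply: measurable_funD => //; exact: gmeas_effects.
  apply: measurable_funD; last by apply: measurable_funB; exact: gE.
  by apply: measurable_funM => //; exact: IH.
- by apply: filterS (ae_good_path adm spec) => w /good_euler; apply.
Qed.

Lemma gmeas_lambda3 (t : R) : 0 <= t -> gmeas (srcWY P X) (lambda3 p X t).
Proof.
move=> t0; apply: measurable_funD; last exact: gmeas_intensity2.
apply: measurable_funX; apply: measurable_funD => //; apply: measurable_funM => //.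
by apply: gmeas_srcW_WY; apply: sigma_gen_gmeas; rewrite /= in_itv/= t0.
Qed.

(** Riemann sums give measurability in [w] without any joint measurability in time and [w]. *)
Lemma gmeas_cumulative (s t : R) : 0 <= s -> s <= t ->
  gmeas (srcWY P X) (cumulative_intensity p X s t).
Proof.
move=> s0 st; apply: (@gmeas_ae_cvg _ _ _ P _
    (fun n w => \sum_(i < n) lambda3 p X (gridpt s t n i.+1) w * ((t - s) / n%:R))).
- exact: sWY.1.
- exact: srcWY_negligible.
- move=> n; apply: measurable_sum => i; apply: measurable_funM => //.
  by apply: gmeas_lambda3; apply: le_trans s0 _; exact: gridpt_ge.
- apply: filterS (ae_good_path adm spec) => w /good_lam cl.
  exact: (cumul_riemann cl).
Qed.

Record good_N3Lambda (w : Omega) : Prop := {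
  N3Lambda_nd : forall s t, 0 <= s -> s <= t -> (N3Lambda p X s w <= N3Lambda p X t w)%N;
  N3Lambda_0 : N3Lambda p X 0 w = 0%N;
  N3Lambda_rc : locally_constant_right (fun t => N3Lambda p X t w);
  N3Lambda_simple : forall t : R, 0 <= t -> (0 < N3Lambda p X t w)%N ->
    exists s, 0 <= s <= t /\ N3Lambda p X s w = 1%N }.

Lemma good_path_N3Lambda w : good_path p X w -> good_N3Lambda w.
Proof.
move=> g; have cl := good_lam g; have l0 := good_lam_ge0 g.
have L0 t : 0 <= t -> 0 <= cumulative_intensity p X 0 t w.
  by move=> t0; exact: (cumul_ge0 l0).
split.
- move=> s t s0 st; apply: (good_unit_nd g); first exact: L0.
  exact: (cumul_le cl l0).
- by rewrite /N3Lambda /cumulative_intensity cumul_refl (good_unit_0 g).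
- move=> t t0; have [dl dl0 H] := good_unit_rc g (L0 t t0).
  have rc := cumul_rc cl t0; apply: near_rightP => //.
  have lt_dl : cumulative_intensity p X 0 t w < cumulative_intensity p X 0 t w + dl.
    by rewrite ltrDl.
  have near_lt := cvgr_lt _ rc _ lt_dl.
  near=> s; apply: H; apply/andP; split; last by near: s; exact: near_lt.
  by apply: (cumul_le cl l0) => //; apply: ltW; near: s; exact: nbhs_right_gt.
(* The level at which the unit process equals 1 is reached by the continuous clock at some time
   [s]. *)
- move=> t t0 Nt; have [u [/andP[u0 uL] Nu]] := good_unit_simple g (L0 t t0) Nt.
  have [s [st sE]] := cumul_ivt cl l0 t0 (introT andP (conj u0 uL)).
  by exists s; split=> //; rewrite /N3Lambda /cumulative_intensity sE.
Unshelve. all: by end_near. Qed.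

Lemma F_subsigma (t : R) : 0 <= t -> subsigma (F t).
Proof.
by move=> t0; split; [exact: filtration_sigma (F_usual filt) t t0|
  exact: filtration_sub (F_usual filt) t t0].
Qed.

Lemma F_negligible (t : R) : 0 <= t -> P.-negligible `<=` F t.
Proof.
move=> t0 A /(filtration_null (F_usual filt)).
by move=> F0A; apply: (filtration_mono (F_usual filt) _ t0 F0A); rewrite lexx.
Qed.

Lemma natural_F (t : R) (A : set Omega) : 0 <= t ->
  (forall s, t < s -> natural_filtration p X s A) -> F t A.
Proof.
move=> t0 H; rewrite (F_enlarged filt t0) => s /= ts.
by apply: sub_sigma_algebra; left; exact: H.
Qed.

Lemma gmeas_F_procJ (t u : R) : 0 <= u -> u <= t -> gmeas (F t) (procJ X u).
Proof.
move=> u0 ut; have t0 := le_trans u0 ut; apply/(gmeasP _ (F_subsigma t0).1) => B mB.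
apply: natural_F => // s ts; apply: sub_sigma_algebra; left; left; right.
apply: sub_sigma_algebra; exists u; last by exists B => //; rewrite setTI.
by rewrite /= in_itv/= u0 ltW// (le_lt_trans ut).
Qed.

Lemma gmeas_F_N3Lambda (t u : R) : 0 <= u -> u <= t -> gmeas (F t) (N3Lambda p X u).
Proof.
move=> u0 ut; have t0 := le_trans u0 ut; apply/(gmeasP _ (F_subsigma t0).1) => B mB.
apply: natural_F => // s ts; apply: sub_sigma_algebra; right.
apply: sub_sigma_algebra; exists u; last by exists B => //; rewrite setTI.
by rewrite /= in_itv/= u0 ltW// (le_lt_trans ut).
Qed.

Definition zeroN (t : R) : set Omega := [set w | N3Lambda p X t w = 0%N].

Lemma F_zeroN (t : R) : 0 <= t -> F t (zeroN t).
Proof.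
move=> t0; have := (gmeasP _ (F_subsigma t0).1).1 (gmeas_F_N3Lambda t0 (lexx t)).
by move=> /(_ [set 0%N]); exact.
Qed.

(* No intervention up to [s] makes the observed Cox process trivial, so that on this
   event [F t] contains no more than the other sources up to [s > t]. *)
Lemma F_trace (t s : R) : 0 <= t -> t < s ->
  F t `<=` trace_mod P (srcWJsY P X s) (zeroN s).
Proof.
move=> t0 ts; have s0 := le_trans t0 (ltW ts).
have sK := (srcWJsY_subsigma spec filt s).1.
have sT := trace_mod_sigma P (zeroN s) sK.
have subK : srcWJsY P X s `<=` trace_mod P (srcWJsY P X s) (zeroN s).
  exact: sub_trace_mod.
have gen (G : set (set Omega)) : G `<=` <<s srcW X `|` pastJ X s `|` srcY X >> ->
    G `<=` trace_mod P (srcWJsY P X s) (zeroN s).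
  by move=> h A /h GA; apply: subK; exact: sub_trace_mod.
have s3 := smallest_sigma_algebra setT (srcW X `|` pastJ X s `|` srcY X).
move=> A; rewrite (F_enlarged filt t0) => /(_ s ts); apply: smallest_sub => //.
move=> {}A [|nA]; last exact: trace_mod_negligible.
apply: smallest_sub => // {}A [[[]|]|]; last first.
- move: A; apply: smallest_sub => // A [u]; rewrite /= in_itv/= => /andP[u0 us].
  move=> [B mB <-]; rewrite setTI.
  (* Without intervention the observed count is constantly 0, so its preimages are trivial on this
     event. *)
  exists (if `[< B 0%N >] then setT else set0).
    by case: ifP => _; [exact: sigmaT sK|case: sK].
  apply: filterS (ae_good_path adm spec) => w /good_path_N3Lambda g zs.
  have Nu : N3Lambda p X u w = 0%N.
    by apply/eqP; rewrite -leqn0 -zs; exact: (N3Lambda_nd g).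
  by rewrite /preimage/= Nu; case: asboolP.
- apply: gen; apply: sigma_gen_sub => // u; rewrite /= in_itv/= => /andP[u0 us].
  apply: (gmeas_sub (srcY_subsigma spec).1 s3); last exact: gmeas_procY.
  by move=> ? ?; apply: sub_sigma_algebra; right.
- apply: gen => ? ?; apply: sub_sigma_algebra; left; right; exact.
- apply: gen; apply: sigma_gen_sub => // u; rewrite /= in_itv/= => /andP[u0 us].
  apply: (gmeas_sub (srcW_subsigma spec).1 s3).
    by move=> ? ?; apply: sub_sigma_algebra; left; left.
  by apply: sigma_gen_gmeas; rewrite /= in_itv/= u0.
Qed.

Lemma gmeas_indic_set (K : set (set Omega)) (A : set Omega) : sigma_algebra setT K ->
  gmeas K (\1_A : Omega -> R) -> K A.
Proof.
move=> sK /(gmeasP _ sK) /(_ [set 1] (measurable_set1 _)).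
rewrite (_ : _ @^-1` _ = A)//; apply/seteqP; split=> w /=; rewrite indicE.
  by case: (boolP (w \in A)) => [/set_mem//|_ /eqP]; rewrite eq_sym oner_eq0.
by move=> Aw; rewrite mem_set.
Qed.

Lemma sigma_forall (K : set (set Omega)) (E : nat -> set Omega) : sigma_algebra setT K ->
  (forall i, K (E i)) -> K [set w | forall i, E i w].
Proof.
move=> sK KE; have -> : [set w | forall i, E i w] = ~` (\bigcup_i ~` E i).
  by rewrite setC_bigcup; apply/seteqP; split=> [w h i _|w h i]; rewrite ?setCK; have := h i; rewrite ?setCK; exact.
by apply: sigmaC => //; apply: sigma_bigcup => // i; exact: sigmaC.
Qed.

Lemma gmeas_Jcomp (K : set (set Omega)) (u : R) : sigma_algebra setT K ->
  gmeas K (procJ X u) -> gmeas K (Jcomp p X u).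
Proof.
move=> sK gJ; rewrite (_ : Jcomp p X u = fun w => procJ X u w - drift p * u); last first.
  by apply/funext => w; rewrite JcompE.
exact: measurable_funB.
Qed.

Definition belowset (t : R) : set Omega :=
  [set w | below (fun s => Jcomp p X s w) (barrier p) t].

(** The event involves uncountably many times, but [below_grid] makes its indicator an almost sure
    limit over grids. At [t = 0] the grid degenerates; there the event is almost surely everything.
    A general [K] allows both [F t] and the source sigma-algebras. *)
Lemma sigma_belowset (K : set (set Omega)) (t : R) : sigma_algebra setT K ->
  P.-negligible `<=` K -> 0 <= t ->
  (forall u, 0 <= u -> u <= t -> gmeas K (procJ X u)) -> K (belowset t).
Proof.
move=> sK nK t0 gJ; apply: gmeas_indic_set => //.
move: t0; rewrite le_eqVlt => /predU1P[t0|t0].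
  apply: (@gmeas_ae _ _ _ P _ (cst 1)) => //; first exact: measurable_cst.
  apply: filterS (ae_good_path adm spec) => w g; rewrite indicE mem_set// => s.
  rewrite -t0 -eq_le => /eqP <-; rewrite (Jcomp_0 _ (good_count1_0 g)).
  exact: barrier_ge0.
pose G n : set Omega := [set w | forall i, (0 < i <= n)%N ->
  Jcomp p X (gridpt 0 t n i) w <= barrier p].
apply: (@gmeas_ae_cvg _ _ _ P _ (fun n => \1_(G n))) => //.
  move=> n; apply: gmeas_indic => //; apply: sigma_forall => // i.
  have [i_n|i_n] := boolP (0 < i <= n)%N; last first.
    rewrite (_ : (fun w => _) = setT); first exact: sigmaT.
    by apply/seteqP; split=> // w _ h.
  rewrite (_ : (fun w => _) = [set w | Jcomp p X (gridpt 0 t n i) w <= barrier p]); last first.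
    by apply/seteqP; split=> w /=; [apply|].
  case/andP: i_n => i0 i_n.
  have /andP[h1 h2] := gridpt_itv (ltW t0) (leq_trans i0 i_n) i_n.
  apply: gmeas_set => //; apply: measurable_fun_ler => //.
  by apply: gmeas_Jcomp => //; exact: gJ.
apply: filterS (ae_good_path adm spec) => w g.
have t00 : 0 <= (0 : R) < t by rewrite lexx t0.
apply: cvg_near_cst.
have := below_grid adm (good_count1_rc g) (barrier p) t00.
apply: filterS => n h; rewrite !indicE; congr (nat_of_bool _)%:R.
apply/idP/idP => /set_mem H; apply/mem_set; first exact/h.
by apply/h.
Qed.

Lemma F_belowset (t : R) : 0 <= t -> F t (belowset t).
Proof.
move=> t0; apply: sigma_belowset => //; [exact: (F_subsigma t0).1|exact: F_negligible|].
by move=> u u0 ut; exact: gmeas_F_procJ.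
Qed.

Lemma gmeas_srcWJsY_procJ (s u : R) : 0 <= u -> u <= s ->
  gmeas (srcWJsY P X s) (procJ X u).
Proof.
move=> u0 us; have sP := (pastJ_subsigma spec s).1.
apply: (gmeas_sub sP (srcWJsY_subsigma spec filt s).1).
  move=> A hA; apply: sub_trace_mod; apply: sub_sigma_algebra; left; right; exact: hA.
by apply: sigma_gen_gmeas; rewrite /= in_itv/= u0.
Qed.

Lemma srcWJsY_belowset (s t : R) : 0 <= t -> t <= s -> srcWJsY P X s (belowset t).
Proof.
move=> t0 ts; apply: sigma_belowset => //.
- exact: (srcWJsY_subsigma spec filt s).1.
- exact: srcWJsY_negligible.
- by move=> u u0 ut; apply: gmeas_srcWJsY_procJ => //; exact: le_trans ts.
Qed.

End adapted.

(** * Conditional expectations and bounded versions *)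

Section conditional_expectation.
Context d (Omega : measurableType d) (R : realType) (P : probability Omega R).
Implicit Types (f g X Y : Omega -> R) (A : set Omega) (G : set (set Omega)).

Lemma RintegralE A f : \int[P]_(w in A) f w = Ex P (fun w => \1_A w * f w).
Proof.
rewrite Rintegral_mkcond; congr Ex; apply/funext => w.
by rewrite patchE indicE; case: (w \in A); rewrite ?mul1r ?mul0r.
Qed.

(** Tested on the [G]-event where the inequality fails: there the difference is positive but has a
    nonpositive integral. *)
Lemma le_ae_of_integrals G Y1 Y2 : subsigma G ->
  P.-integrable setT (EFin \o Y1) -> P.-integrable setT (EFin \o Y2) ->
  gmeas G Y1 -> gmeas G Y2 ->
  (forall A, G A -> \int[P]_(w in A) Y1 w <= \int[P]_(w in A) Y2 w) ->
  {ae P, forall w, Y1 w <= Y2 w}.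
Proof.
move=> sG i1 i2 m1 m2 H; pose A : set Omega := [set w | Y2 w < Y1 w].
have GA : G A by apply: gmeas_set; [exact: sG.1|exact: measurable_fun_ltr].
have mA := sG.2 _ GA.
have iA f : P.-integrable setT (EFin \o f) -> P.-integrable A (EFin \o f).
  by apply: integrableS.
have i12 : P.-integrable A (EFin \o (fun w => Y1 w - Y2 w)).
  have := integrableB mA (iA _ i1) (iA _ i2).
  by apply: eq_integrable => // w _ /=; rewrite EFinB.
have le0 : \int[P]_(w in A) (Y1 w - Y2 w) <= 0.
  by rewrite RintegralB//; [rewrite subr_le0; exact: H|exact: iA..].
have ge0 : 0 <= \int[P]_(w in A) (Y1 w - Y2 w).
  by apply: Rintegral_ge0 => w /ltW; rewrite subr_ge0.
have e0 : (\int[P]_(w in A) `|(Y1 w - Y2 w)%:E| = 0)%E.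
  have -> : (\int[P]_(w in A) `|(Y1 w - Y2 w)%:E| = \int[P]_(w in A) (Y1 w - Y2 w)%:E)%E.
    by apply: eq_integral => w /set_mem Aw; rewrite gee0_abs// lee_fin subr_ge0 ltW.
  rewrite -[LHS]fineK; last exact: integrable_fin_num.
  by congr (_%:E); apply/eqP; rewrite eq_le le0 ge0.
have mY : measurable_fun A (EFin \o (fun w => Y1 w - Y2 w)) by case/integrableP : i12.
have /(ae_eq_integral_abs _ mA mY) := e0.
apply: filterS => w h; rewrite leNgt; apply/negP => Aw.
by have [] := h Aw; move/eqP; rewrite subr_eq0 gt_eqF.
Qed.

Lemma eq_ae_of_integrals G Y1 Y2 : subsigma G ->
  P.-integrable setT (EFin \o Y1) -> P.-integrable setT (EFin \o Y2) ->
  gmeas G Y1 -> gmeas G Y2 ->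
  (forall A, G A -> \int[P]_(w in A) Y1 w = \int[P]_(w in A) Y2 w) ->
  {ae P, forall w, Y1 w = Y2 w}.
Proof.
move=> sG i1 i2 m1 m2 H.
have h12 : {ae P, forall w, Y1 w <= Y2 w}.
  by apply: (le_ae_of_integrals sG) => // A GA; rewrite H.
have h21 : {ae P, forall w, Y2 w <= Y1 w}.
  by apply: (le_ae_of_integrals sG) => // A GA; rewrite H.
by apply: filterS2 h12 h21 => w a b; apply/eqP; rewrite eq_le a b.
Qed.

Lemma cond_exp_gmeas G X Y : sigma_algebra setT G -> is_cond_exp P G X Y -> gmeas G Y.
Proof.
move=> sG [_ _ h _]; apply/(gmeasP _ sG) => B mB; apply: h.
by exists B => //; rewrite setTI.
Qed.

Lemma cond_exp_integral G X Y A : is_cond_exp P G X Y -> G A ->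
  \int[P]_(w in A) Y w = \int[P]_(w in A) X w.
Proof. by move=> [_ _ _ h] GA; rewrite /Rintegral h. Qed.

(** A version of a conditional probability is in [0, 1] only almost surely; clipping makes the bound
    hold everywhere and preserves monotonicity in time. *)
Definition clip01 (y : R) : R := Order.max 0 (Order.min y 1).

Lemma clip01_itv y : 0 <= clip01 y <= 1.
Proof. by rewrite /clip01 le_max lexx/= ge_max ler01 ge_min lexx orbT. Qed.

Lemma clip01_norm y : `|clip01 y| <= 1.
Proof. by have /andP[h ?] := clip01_itv y; rewrite ger0_norm. Qed.

Lemma clip01_id y : 0 <= y <= 1 -> clip01 y = y.
Proof. by move=> /andP[y0 y1]; rewrite /clip01 min_l// max_r. Qed.

Lemma gmeas_clip01 G f : gmeas G f -> gmeas G (fun w => clip01 (f w)).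
Proof.
by move=> mf; apply: measurable_maxr => //; exact: measurable_minr.
Qed.

Lemma bounded_clip01 f : bounded (fun w => clip01 (f w)).
Proof. by exists 1 => w; exact: clip01_norm. Qed.

(** Comparing with the constants 0 and 1 on [G]-events confines [Y] to [0, 1] almost surely;
    [Ex_ext] then replaces test events by bounded [G]-measurable weights. [X'] is a modification of
    [X] that satisfies the bounds everywhere. *)
Lemma cond_exp_clip G X X' Y : subsigma G -> is_cond_exp P G X Y ->
  bfun X' -> (forall w, 0 <= X' w <= 1) -> {ae P, forall w, X w = X' w} ->
  {ae P, forall w, Y w = clip01 (Y w)} /\
  forall m, gmeas G m -> bounded m ->
    Ex P (fun w => m w * X' w) = Ex P (fun w => m w * clip01 (Y w)).
Proof.
move=> sG ce bX' X'01 XX'; have mY := cond_exp_gmeas sG.1 ce.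
have [iX iY _ _] := ce.
have eqX A : G A -> \int[P]_(w in A) X w = \int[P]_(w in A) X' w.
  move=> GA; have mA := sG.2 _ GA; rewrite /Rintegral; congr fine.
  apply: ae_eq_integral => //.
  - by apply: measurable_funTS; case/integrableP : iX.
  - by apply: measurable_funTS; apply/measurable_EFinP; exact: bX'.1.
  - by apply: filterS XX' => w /= ->.
have eqY A : G A -> \int[P]_(w in A) Y w = \int[P]_(w in A) X' w.
  by move=> GA; rewrite (cond_exp_integral ce GA) eqX.
have icst c : P.-integrable setT (EFin \o (fun=> c : R) : Omega -> \bar R).
  exact/bfun_integrable/bfun_cst.
have gcst c : gmeas G (fun=> c : R) by exact: measurable_cst.
have iA A (f : Omega -> R) : G A -> P.-integrable setT (EFin \o f) ->
    P.-integrable A (EFin \o f).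
  by move=> GA; apply: integrableS => //; exact: sG.2.
have iX' := bfun_integrable P bX'.
have Y1 : {ae P, forall w, Y w <= 1}.
  apply: (le_ae_of_integrals sG iY (icst 1) mY (gcst 1)) => A GA.
  rewrite eqY//; apply: le_Rintegral; [exact: sG.2|exact: iA|exact: iA|].
  by move=> w _; case/andP: (X'01 w).
have Y0 : {ae P, forall w, 0 <= Y w}.
  apply: (le_ae_of_integrals sG (icst 0) iY (gcst 0) mY) => A GA.
  rewrite eqY//; apply: le_Rintegral; [exact: sG.2|exact: iA|exact: iA|].
  by move=> w _; case/andP: (X'01 w).
have Yc : {ae P, forall w, Y w = clip01 (Y w)}.
  by apply: filterS2 Y0 Y1 => w h0 h1; rewrite clip01_id// h0.
split=> // m mm bm.
have bc : bfun (fun w => clip01 (Y w)).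
  by apply: gmeas_bfun sG _ (bounded_clip01 _); exact: gmeas_clip01.
apply: (Ex_ext (P := P) sG) => // A GA.
rewrite -!RintegralE -eqY// /Rintegral; congr fine; apply: ae_eq_integral => //.
- exact: sG.2.
- by apply: measurable_funTS; case/integrableP : iY.
- by apply: measurable_funTS; apply/measurable_EFinP; exact: bc.1.
- by apply: filterS Yc => w /= <-.
Qed.

End conditional_expectation.

Lemma norm_mul_le {R : realType} (a x M : R) : `|a| <= 1 -> `|x| <= M -> `|a * x| <= M.
Proof. by move=> a1 xM; rewrite normrM (le_trans _ xM)// ler_piMl. Qed.

(** * Conditional survival and crossing *)

Section survival.
Context d (Omega : measurableType d) (R : realType) (P : probability Omega R).
Variables (p : coco_params R) (X : drivers Omega R) (F : R -> set (set Omega)).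
Hypothesis adm : admissible p.
Hypothesis spec : drivers_spec P p X.
Hypothesis filt : filtration_spec P p X F.

Let cP : measure_is_complete P := filtration_complete (F_usual filt).

Lemma gmeas_WY_WJsY s (f : Omega -> R) : gmeas (srcWY P X) f -> gmeas (srcWJsY P X s) f.
Proof.
apply: (gmeas_sub (srcWY_subsigma spec filt).1 (srcWJsY_subsigma spec filt s).1).
exact: srcWY_sub.
Qed.

Lemma gmeas_WJsY_WJY s (f : Omega -> R) : gmeas (srcWJsY P X s) f -> gmeas (srcWJY P X) f.
Proof.
apply: (gmeas_sub (srcWJsY_subsigma spec filt s).1 (srcWJY_subsigma spec filt).1).
exact: srcWJsY_sub.
Qed.

(* The intensity is nonnegative only almost surely; the maximum keeps the
   variable bounded everywhere. *)
Definition surv (s t : R) (w : Omega) : R :=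
  expR (- Order.max (cumulative_intensity p X s t w) 0).

Lemma surv_itv s t w : 0 <= surv s t w <= 1.
Proof. by rewrite expR_ge0 -expR0 ler_expR oppr_le0 le_max lexx orbT. Qed.

Lemma surv_norm s t w : `|surv s t w| <= 1.
Proof. by have /andP[h ?] := surv_itv s t w; rewrite ger0_norm. Qed.

Lemma bounded_surv s t : bounded (surv s t).
Proof. by exists 1 => w; exact: surv_norm. Qed.

Lemma gmeas_surv s t : 0 <= s -> s <= t -> gmeas (srcWY P X) (surv s t).
Proof.
move=> s0 st; apply: (measurableT_comp (@measurable_expR R)).
apply: measurable_funN; apply: measurable_maxr => //.
exact: (gmeas_cumulative adm spec filt).
Qed.

Lemma survE s t w : good_path p X w -> 0 <= s ->
  surv s t w = expR (- cumulative_intensity p X s t w).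
Proof.
move=> g s0; rewrite /surv max_l//.
exact: (cumul_ge0 (good_lam_ge0 g)).
Qed.

Lemma surv_split s t w : good_path p X w -> 0 <= s -> s <= t ->
  surv 0 t w = surv 0 s w * surv s t w.
Proof.
move=> g s0 st; rewrite !survE// -expRD -opprD; congr (expR (- _)).
exact: (cumul_add (good_lam g)).
Qed.

Let K := srcWJY_subsigma spec filt.

(** Truncated at 0 because the unit Poisson process is specified at nonnegative times only. *)
Let E3 (y : R) : set Omega := [set w | unit_poisson X (Order.max y 0) w = 0%N].

Lemma srcN_E3 y : srcN X (E3 y).
Proof.
have h : gmeas (srcN X) (unit_poisson X (Order.max y 0)).
  by apply: sigma_gen_gmeas; rewrite /= in_itv/= le_max lexx orbT.
exact: ((gmeasP _ (srcN_subsigma spec).1).1 h [set 0%N]).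
Qed.

Lemma prob_E3 y : fine (P (E3 y)) = expR (- Order.max y 0).
Proof.
have N3 := N3_pp spec; have mE y' := (srcN_subsigma spec).2 _ (srcN_E3 y').
have start : {ae P, forall w, unit_poisson X 0 w = 0%N} := poisson_start N3.
have [y0|y0] := ltP 0 y.
  have mS : measurable [set w | (unit_poisson X y w - unit_poisson X 0 w)%N = 0%N].
    have := measurable_fun_subn (poisson_measurable N3 (ltW y0))
      (poisson_measurable N3 (lexx 0)).
    by move=> /(_ measurableT [set 0%N] I); rewrite setTI.
  rewrite (ae_eq_prob (mE y) mS); last first.
    by apply: filterS start => w /= e; rewrite /E3/= max_l ?ltW// e subn0.
  rewrite (poisson_law N3)// /poisson_pmf/= subr0 mul1r y0.
  by rewrite expr0 fact0 invr1 !mul1r.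
rewrite oppr0 expR0 (ae_eq_prob (mE y) measurableT); last first.
  by apply: filterS start => w /= e; rewrite /E3/= max_r.
by rewrite probability_setT.
Qed.

(** [freeze] with the clock as frozen argument: a unit Poisson process has no jump up to level [y]
    with probability [exp (- y)]. *)
Lemma Ex_zeroN (Z : Omega -> R) (s : R) : 0 <= s -> gmeas (srcWJY P X) Z -> bounded Z ->
  Ex P (fun w => Z w * \1_(zeroN p X s) w) = Ex P (fun w => Z w * surv 0 s w).
Proof.
move=> s0 mZ bZ.
have mE y := (srcN_subsigma spec).2 _ (srcN_E3 y).
have rc : {ae P, forall w, forall y : R, exists2 dl : R, 0 < dl &
    forall y' : R, y <= y' < y + dl -> (E3 y' w <-> E3 y w)}.
  apply: filterS (ae_good_path adm spec) => w g y.
  have y0 : 0 <= Order.max y 0 by rewrite le_max lexx orbT.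
  have [dl dl0 H] := good_unit_rc g y0; exists dl => // y' /andP[yy' y'd].
  rewrite /E3/= H//; apply/andP; split.
    by rewrite ge_max !le_max yy' lexx orbT.
  by rewrite gt_max; apply/andP; split; [apply: lt_le_trans y'd _; rewrite lerD2r le_max lexx|rewrite ltr_wpDl].
have mL : gmeas (srcWJY P X) (cumulative_intensity p X 0 s).
  by apply: (gmeas_WJsY_WJY (s := 0)); apply: gmeas_WY_WJsY; apply: (gmeas_cumulative adm spec filt).
have [mEL _ fr] := freeze K cP mE
  (fun y A KA => srcWJY_indep spec filt KA (srcN_E3 y)) rc mL mZ bZ.
transitivity (Ex P (fun w => Z w * \1_[set w | E3 (cumulative_intensity p X 0 s w) w] w)).
  have mzN := (F_subsigma filt s0).2 _ (F_zeroN filt s0).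
  have bZ' := gmeas_bfun K mZ bZ.
  apply: Ex_ae; [exact/bfunM/bfun_indic|exact/bfunM/bfun_indic|].
  apply: filterS (ae_good_path adm spec) => w g; congr (_ * _).
  have L0 : 0 <= cumulative_intensity p X 0 s w by apply: (cumul_ge0 (good_lam_ge0 g)).
  rewrite !indicE; congr (nat_of_bool _)%:R.
  apply/idP/idP => /set_mem h; apply/mem_set; move: h.
    by rewrite /E3 /zeroN/= max_l.
  by rewrite /E3 /zeroN/= max_l.
by rewrite fr; congr Ex; apply/funext => w; rewrite prob_E3.
Qed.

Lemma measurable_zeroN s : 0 <= s -> measurable (zeroN p X s).
Proof. by move=> s0; exact: (F_subsigma filt s0).2 _ (F_zeroN filt s0). Qed.

Lemma zeroN_le w (s t : R) : good_path p X w -> 0 <= s -> s <= t ->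
  zeroN p X t w -> zeroN p X s w.
Proof.
move=> /good_path_N3Lambda g s0 st; rewrite /zeroN/= => zt.
by apply/eqP; rewrite -leqn0 -zt; exact: (N3Lambda_nd g).
Qed.

Lemma zeroN_rc w (s : R) : good_path p X w -> 0 <= s ->
  (\1_(zeroN p X u) w : R) @[u --> s^'+] --> (\1_(zeroN p X s) w : R).
Proof.
move=> /good_path_N3Lambda g s0; have [dl dl0 H] := N3Lambda_rc g s0.
apply: cvg_near_cst; near=> u.
have Hu : N3Lambda p X u w = N3Lambda p X s w.
  apply: H; apply/andP; split; first by apply/ltW; near: u; exact: nbhs_right_gt.
  by near: u; apply: nbhs_right_lt; rewrite ltrDl.
rewrite !indicE; congr (nat_of_bool _)%:R.
by apply/idP/idP => /set_mem; rewrite /zeroN/= => h; apply/mem_set => /=; rewrite -h Hu.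
Unshelve. all: by end_near. Qed.

(** The first points of finer and finer grids serve as times decreasing to [s] inside []s, t]]. *)
Lemma first_gridpt (s t : R) n : s < t -> s < gridpt s t n.+1 1 <= t.
Proof.
move=> st; have /andP[_ ->] := gridpt_itv (ltW st) (ltn0Sn n) (ltn0Sn n : 1 <= n.+1)%N.
by rewrite andbT gridptS gridpt0 ltrDl divr_gt0 ?subr_gt0// ltr0n.
Qed.

Lemma first_gridpt_cvg (s t : R) : s < t ->
  gridpt s t n.+1 1 @[n --> \oo] --> s^'+.
Proof.
move=> st; have h : gridpt s t n.+1 1 @[n --> \oo] --> s.
  apply/cvgrPdist_lt => e e0; have /cvgrPdist_lt /(_ _ e0) [N _ hN] := @mesh_cvg0 R s t.
  exists N => // n Nn; have := hN n.+1 (leqW Nn).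
  by rewrite /= gridptS gridpt0 opprD addNKr sub0r.
move=> A [dl /= dl0 HA]; have /cvgrPdist_lt /(_ _ dl0) := h.
apply: filterS => n hn; apply: HA => //=.
by have /andP[] := first_gridpt n st.
Qed.

(** At [s n > t0] the event [A] may be traded for a source event [A'], which permits integrating out
    the unit Poisson process; then [s n] tends to [t0]. *)
Lemma Ex_survival (A : set Omega) (Z : Omega -> R) (t0 t : R) :
  0 <= t0 -> t0 < t -> F t0 A -> gmeas (srcWJY P X) Z -> bounded Z ->
  Ex P (fun w => \1_A w * (Z w * \1_(zeroN p X t) w)) =
  Ex P (fun w => \1_A w * (\1_(zeroN p X t0) w * (Z w * surv t0 t w))).
Proof.
move=> t00 t0t FA mZ bZ.
pose s n := gridpt t0 t n.+1 1.
have st n : t0 < s n <= t by exact: first_gridpt.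
have ts n : t0 < s n by case/andP: (st n).
have s0 n : 0 <= s n by apply/ltW/(le_lt_trans t00).
have sltt n : s n <= t by case/andP: (st n).
have tge : 0 <= t by rewrite (le_trans t00)// ltW.
have mA := (F_subsigma filt t00).2 _ FA.
have mS u v : 0 <= u -> u <= v -> gmeas (srcWJY P X) (surv u v).
  by move=> u0 uv; apply: (gmeas_WJsY_WJY (s := 0)); apply: gmeas_WY_WJsY; exact: gmeas_surv.
have bS u v : 0 <= u -> u <= v -> bfun (surv u v).
  by move=> u0 uv; apply: gmeas_bfun K (mS _ _ u0 uv) (bounded_surv _ _).
have bfZ := gmeas_bfun K mZ bZ.
have mZN := measurable_zeroN.
have step n : Ex P (fun w => \1_A w * (Z w * \1_(zeroN p X t) w)) =
    Ex P (fun w => \1_A w * (\1_(zeroN p X (s n)) w * (Z w * surv (s n) t w))).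
  have [A' KA' AA'] := F_trace adm spec filt t00 (ts n) FA.
  have KA'' : srcWJY P X A' by exact: srcWJsY_sub KA'.
  have mA' := K.2 _ KA''.
  have indA w : (zeroN p X (s n) w -> (A w <-> A' w)) ->
      \1_A w * \1_(zeroN p X (s n)) w = \1_A' w * \1_(zeroN p X (s n)) w :> R.
    move=> h; rewrite !indicE; have [/set_mem z|] := boolP (w \in zeroN p X (s n)); last first.
      by rewrite !mulr0.
    rewrite !mulr1; congr (nat_of_bool _)%:R.
    by apply/idP/idP => /set_mem ?; apply/mem_set; apply/(h z).
  have mZA : gmeas (srcWJY P X) (fun w => \1_A' w * Z w).
    by apply: measurable_funM => //; exact: gmeas_indic K.1 KA''.
  have bZA : bounded (fun w => \1_A' w * Z w).
    by apply: boundedM => //; exact: bounded_indic.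
  (* Allowed since no intervention by [t] entails none by [s n], where [A] and [A'] agree. *)
  transitivity (Ex P (fun w => (\1_A' w * Z w) * \1_(zeroN p X t) w)).
    apply: Ex_ae.
    - by apply: bfunM; [exact: bfun_indic|apply: bfunM => //; exact/bfun_indic/mZN].
    - by apply: bfunM; [exact: gmeas_bfun K mZA bZA|exact/bfun_indic/mZN].
    apply: filterS2 (ae_good_path adm spec) AA' => w g h.
    rewrite mulrA; have [zt|zt] := pselect (zeroN p X t w); last first.
      by rewrite [\1_(zeroN p X t) w]indicE memNset// !mulr0.
    have zs := zeroN_le g (s0 n) (sltt n) zt.
    have := indA w h; rewrite [\1_(zeroN p X (s n)) w]indicE mem_set// !mulr1 => ->.
    by [].
  rewrite (Ex_zeroN tge mZA bZA).
  transitivity (Ex P (fun w => ((\1_A' w * Z w) * surv (s n) t w) * surv 0 (s n) w)).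
    apply: Ex_ae.
    - by apply: bfunM; [exact: gmeas_bfun K mZA bZA|exact: bS].
    - apply: bfunM; last exact: bS.
      by apply: bfunM; [exact: gmeas_bfun K mZA bZA|exact: bS].
    apply: filterS (ae_good_path adm spec) => w g.
    by rewrite (surv_split g (s0 n) (sltt n)); ring.
  (* [Ex_zeroN] read backwards: survival over [[0, s n]] becomes an indicator again, on which [A']
     can be traded back for [A]. *)
  rewrite -Ex_zeroN//; last 2 first.
  - by apply: measurable_funM => //; exact: mS.
  - by apply: boundedM => //; exact: bounded_surv.
  apply: Ex_ae.
  - apply: bfunM; last exact/bfun_indic/mZN.
    by apply: bfunM; [exact: gmeas_bfun K mZA bZA|exact: bS].
  - apply: bfunM; first exact: bfun_indic.
    by apply: bfunM; [exact/bfun_indic/mZN|apply: bfunM => //; exact: bS].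
  apply: filterS AA' => w h; rewrite [RHS]mulrA indA//; ring.
have [M ZM] := bZ.
have L : Ex P (fun w => \1_A w * (\1_(zeroN p X (s n)) w * (Z w * surv (s n) t w)))
    @[n --> \oo] -->
    Ex P (fun w => \1_A w * (\1_(zeroN p X t0) w * (Z w * surv t0 t w))).
  apply: (@Ex_cvg _ _ _ _ _ _ M).
  - move=> n; apply: (proj1 (_ : bfun _)); apply: bfunM; first exact: bfun_indic.
    by apply: bfunM; [exact/bfun_indic/mZN|apply: bfunM => //; exact: bS].
  - apply: (proj1 (_ : bfun _)); apply: bfunM; first exact: bfun_indic.
    by apply: bfunM; [exact/bfun_indic/mZN|apply: bfunM => //; apply: bS => //; exact: ltW].
  - move=> n w; apply: norm_mul_le; first exact: norm_indic_le1.
    apply: norm_mul_le; first exact: norm_indic_le1.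
    by rewrite mulrC; apply: norm_mul_le => //; exact: surv_norm.
  apply: filterS (ae_good_path adm spec) => w g.
  apply: cvgM; first exact: cvg_cst.
  apply: cvgM.
    exact: (cvg_comp _ _ (first_gridpt_cvg t0t) (zeroN_rc g t00)).
  apply: cvgM; first exact: cvg_cst.
  (* Expressed through the clock started at 0, whose right-continuity gives the limit. *)
  have -> : surv t0 t w = expR (- (cumulative_intensity p X 0 t w - cumulative_intensity p X 0 t0 w)).
    rewrite survE//; congr (expR (- _)).
    by rewrite (_ : cumulative_intensity p X 0 t w =
        cumulative_intensity p X 0 t0 w + cumulative_intensity p X t0 t w);
      [rewrite addrC addKr|exact: (cumul_add (good_lam g) t00 (ltW t0t))].
  have -> : (fun n => surv (s n) t w) = (fun n => expR (- (cumulative_intensity p X 0 t w -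
      cumulative_intensity p X 0 (s n) w))).
    apply/funext => n; rewrite survE//; congr (expR (- _)).
    by rewrite (_ : cumulative_intensity p X 0 t w =
        cumulative_intensity p X 0 (s n) w + cumulative_intensity p X (s n) t w);
      [rewrite addrC addKr|exact: (cumul_add (good_lam g) (s0 n) (sltt n))].
  apply: (continuous_cvg _ (@continuous_expR R _)); apply: cvgN; apply: cvgB.
    exact: cvg_cst.
  exact: (cvg_comp _ _ (first_gridpt_cvg t0t) (cumul_rc (good_lam g) t00)).
apply: (limits_eq step _ L); exact: cvg_cst.
Qed.

End survival.

Section crossing.
Context d (Omega : measurableType d) (R : realType) (P : probability Omega R).
Variables (p : coco_params R) (X : drivers Omega R) (F : R -> set (set Omega)).
Hypothesis adm : admissible p.
Hypothesis spec : drivers_spec P p X.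
Hypothesis filt : filtration_spec P p X F.

Let cP : measure_is_complete P := filtration_complete (F_usual filt).
Let K := srcWJY_subsigma spec filt.

Section later_loss.
Variables (t0 t : R).
Hypothesis t00 : 0 <= t0.
Hypothesis t0t : t0 < t.

Let u n i := gridpt t0 t n.+1 i.
Let s n := u n 1.

(* The running maximum on ]t0, t], seen on a grid whose first point stands for
   [t0]: it only involves increments after that point. *)
Definition loss_below n (y : R) : set Omega := [set w | forall i, (0 < i <= n.+1)%N ->
  procJ X (u n i) w - procJ X (s n) w - drift p * (u n i - t0) <= y].

(** [y] is the headroom left at [t0]; measuring from [Jcomp p X t0] makes the event depend on later
    increments only. *)
Definition loss_below_lim (y : R) : set Omega := [set w | forall r, t0 <= r <= t ->
  Jcomp p X r w <= y + Jcomp p X t0 w].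

Let t0s n : t0 < s n <= t.
Proof. exact: first_gridpt. Qed.

Let s0 n : 0 <= s n.
Proof. by case/andP: (t0s n) => /ltW /(le_trans t00). Qed.

Let su n i : (0 < i)%N -> s n <= u n i.
Proof. by move=> i0; apply: gridpt_le => //; exact: ltW. Qed.

Lemma futureJ_loss_below n y : futureJ X (s n) (loss_below n y).
Proof.
have sF := smallest_sigma_algebra setT
  (\bigcup_(v in `[s n, +oo[) g_sigma_algebra_preimage (procJ X v \- procJ X (s n))).
apply: sigma_forall => // i.
have [i_n|i_n] := boolP (0 < i <= n.+1)%N; last first.
  rewrite (_ : (fun w => _) = setT); first exact: sigmaT.
  by apply/seteqP; split=> // w _ h.
rewrite (_ : (fun w => _) =
    [set w | (procJ X (u n i) \- procJ X (s n)) w - drift p * (u n i - t0) <= y]); last first.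
  by apply/seteqP; split=> w /=; [apply|].
apply: gmeas_set => //; apply: measurable_fun_ler => //; apply: measurable_funB => //.
apply: sigma_gen_gmeas; rewrite /= in_itv/= andbT; apply: su.
by case/andP: i_n.
Qed.

Lemma measurable_loss_below n y : measurable (loss_below n y).
Proof.
apply: (srcJ_subsigma spec).2; apply: (futureJ_sub (s0 n)).
exact: futureJ_loss_below.
Qed.

(** For large [n] the path of [procJ] has not moved on [[t0, s n]], so starting the increments at
    [s n] changes nothing; the drift is counted from [t0] already. *)
Lemma near_loss_below w y : good_path p X w ->
  \forall n \near \oo, loss_below n y w <-> loss_below_lim y w.
Proof.
move=> g; have a0 : 0 <= t0 < t by rewrite t00.
have [N _ HN] := below_grid adm (good_count1_rc g) (y + Jcomp p X t0 w) a0.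
have [dl dl0 Hdl] := procJ_rc (good_count1_rc g) t00.
have near_s : \forall n \near \oo, s n < t0 + dl.
  have : \forall v \near t0^'+, v < t0 + dl by apply: nbhs_right_lt; rewrite ltrDl.
  exact: (first_gridpt_cvg t0t).
near=> n; have sn : s n < t0 + dl by near: n.
have Js : procJ X (s n) w = procJ X t0 w.
  by apply: Hdl; rewrite sn andbT ltW//; case/andP: (t0s n).
have Nn : (N <= n.+1)%N by apply: leqW; near: n; exact: nbhs_infty_ge.
have E i : (procJ X (u n i) w - procJ X (s n) w - drift p * (u n i - t0) <= y) =
    (Jcomp p X (u n i) w <= y + Jcomp p X t0 w).
  by rewrite !JcompE Js; apply/idP/idP => ?; lra.
split=> [h|h].
  by apply/(HN n.+1 Nn) => i i_n; rewrite -E; exact: h.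
by move=> i i_n; rewrite E; apply: (HN n.+1 Nn).1 i_n.
Unshelve. all: by end_near. Qed.

Lemma loss_below_cvg y :
  {ae P, forall w, (\1_(loss_below n y) w : R) @[n --> \oo] --> (\1_(loss_below_lim y) w : R)}.
Proof.
apply: filterS (ae_good_path adm spec) => w g; apply: cvg_near_cst.
apply: filterS (near_loss_below y g) => n h; rewrite !indicE; congr (nat_of_bool _)%:R.
by apply/idP/idP => /set_mem ?; apply/mem_set; apply/h.
Qed.

Lemma measurable_loss_below_lim y : measurable (loss_below_lim y).
Proof.
have sm : sigma_algebra setT (@measurable _ Omega) by exact: sigma_algebra_measurable.
apply: (gmeas_indic_set (R := R) sm).
apply: (gmeas_ae_cvg sm cP _ (loss_below_cvg y)) => n.
apply: gmeas_indic => //; exact: measurable_loss_below.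
Qed.

Let phi y : R := fine (P (loss_below_lim y)).

Lemma loss_below_prob_cvg y : fine (P (loss_below n y)) @[n --> \oo] --> phi y.
Proof.
rewrite /phi -Ex_indic; last exact: measurable_loss_below_lim.
have -> : (fun n => fine (P (loss_below n y))) =
    (fun n => Ex P (\1_(loss_below n y) : Omega -> R)).
  by apply/funext => n; rewrite Ex_indic//; exact: measurable_loss_below.
apply: (@Ex_cvg _ _ _ _ _ _ 1).
- by move=> n; apply: measurable_indic; exact: measurable_loss_below.
- by apply: measurable_indic; exact: measurable_loss_below_lim.
- by move=> n w; exact: norm_indic_le1.
- exact: loss_below_cvg.
Qed.

Lemma prob_norm_le1 (A : set Omega) : measurable A -> `|fine (P A)| <= 1.
Proof.
move=> mA; rewrite ger0_norm ?fine_ge0//.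
by rewrite -lee_fin fineK ?fin_num_measure// probability_le1.
Qed.

Lemma measurable_phi : measurable_fun setT phi.
Proof.
apply: nondecreasing_measurable => // x y xy.
rewrite /phi fine_le ?fin_num_measure//; [exact: measurable_loss_below_lim..|].
apply: le_measure; rewrite ?inE; [exact: measurable_loss_below_lim..|].
by move=> w h r rt; rewrite (le_trans (h r rt))// lerD2r.
Qed.

Let Y w : R := barrier p - Jcomp p X t0 w.

Lemma gmeas_F_level : gmeas (F t0) Y.
Proof.
apply: measurable_funB => //; apply: gmeas_Jcomp; first exact: (F_subsigma filt t00).1.
by apply: (gmeas_F_procJ filt t00).
Qed.

(** An explicit candidate for the conditional probability of staying below the barrier up to [t]:
    the past condition times the law of later losses at the current headroom. *)
Definition later_below w : R := \1_(belowset p X t0) w * phi (Y w).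

Lemma gmeas_later_below : gmeas (F t0) later_below.
Proof.
apply: measurable_funM.
  by apply: gmeas_indic; [exact: (F_subsigma filt t00).1|exact: (F_belowset adm spec filt t00)].
exact: (measurableT_comp measurable_phi gmeas_F_level).
Qed.

Lemma bounded_later_below : bounded later_below.
Proof.
exists 1 => w; apply: norm_mul_le; first exact: norm_indic_le1.
by apply: prob_norm_le1; exact: measurable_loss_below_lim.
Qed.

Lemma srcWJY_loss_below n : srcWJY P X [set w | loss_below n (Y w) w].
Proof.
have gJ v : 0 <= v -> gmeas (srcWJY P X) (procJ X v).
  by move=> v0; apply: (gmeas_WJsY_WJY (s := v) spec filt); apply: (gmeas_srcWJsY_procJ spec filt).
apply: sigma_forall => [|i]; first exact: K.1.
have [i_n|i_n] := boolP (0 < i <= n.+1)%N; last first.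
  rewrite (_ : (fun w => _) = setT); first exact: sigmaT K.1.
  by apply/seteqP; split=> // w _ h.
rewrite (_ : (fun w => _) =
    [set w | procJ X (u n i) w - procJ X (s n) w - drift p * (u n i - t0) <= Y w]); last first.
  by apply/seteqP; split=> w /=; [apply|].
have u0 : 0 <= u n i by apply: le_trans (s0 n) _; apply: su; case/andP: i_n.
apply: gmeas_set; first exact: K.1; apply: measurable_fun_ler => //.
  by apply: measurable_funB => //; apply: measurable_funB; exact: gJ.
by apply: measurable_funB => //; apply: gmeas_Jcomp; [exact: K.1|exact: gJ].
Qed.

(** The weight [Z], the headroom and a substitute for [A] all belong to [srcWJsY (s n)], of which
    later loss increments are independent; [freeze] is applied with the headroom frozen. *)
Lemma Ex_later_below (A : set Omega) (Z : Omega -> R) :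
  F t0 A -> gmeas (srcWY P X) Z -> bounded Z ->
  Ex P (fun w => \1_A w * (\1_(zeroN p X t0) w * (Z w * \1_(belowset p X t) w))) =
  Ex P (fun w => \1_A w * (\1_(zeroN p X t0) w * (Z w * later_below w))).
Proof.
move=> FA mZ bZ.
have mA := (F_subsigma filt t00).2 _ FA.
have mZJ : gmeas (srcWJY P X) Z.
  by apply: (gmeas_WJsY_WJY (s := 0) spec filt); exact: (gmeas_WY_WJsY spec filt).
have bfZ := gmeas_bfun K mZJ bZ.
have mZN := measurable_zeroN filt.
have mB0 : measurable (belowset p X t0).
  exact: (F_subsigma filt t00).2 _ (F_belowset adm spec filt t00).
have gB0 n : srcWJsY P X (s n) (belowset p X t0).
  by apply: (srcWJsY_belowset adm spec filt) => //; case/andP: (t0s n) => /ltW.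
have mY n : gmeas (srcWJsY P X (s n)) Y.
  apply: measurable_funB => //; apply: gmeas_Jcomp.
    exact: (srcWJsY_subsigma spec filt (s n)).1.
  by apply: (gmeas_srcWJsY_procJ spec filt) => //; case/andP: (t0s n) => /ltW.
(* The event grows with [y], and a violation persists until [y] has risen by its excess. *)
have rc n : {ae P, forall w, forall y : R, exists2 dl : R, 0 < dl &
    forall y' : R, y <= y' < y + dl -> (loss_below n y' w <-> loss_below n y w)}.
  apply: aeW => w y; have [h|h] := pselect (loss_below n y w).
    exists 1 => // y' /andP[yy' _]; split=> // _ i i_n.
    by rewrite (le_trans (h i i_n)).
  have [i /not_implyP[i_n hi]] : exists i, ~ ((0 < i <= n.+1)%N ->
      procJ X (u n i) w - procJ X (s n) w - drift p * (u n i - t0) <= y).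
    exact/existsNP.
  move/negP : hi; rewrite -ltNge -subr_gt0 => hi.
  exists (procJ X (u n i) w - procJ X (s n) w - drift p * (u n i - t0) - y) => //.
  move=> y' /andP[_]; rewrite subrKC => y'lt; split=> // /(_ i i_n).
  by rewrite leNgt y'lt.
have fr n (Z' : Omega -> R) := @freeze _ _ _ P (srcWJsY P X (s n)) (loss_below n) Y Z'
  (srcWJsY_subsigma spec filt (s n)) cP (@measurable_loss_below n)
  (fun y A KA => srcWJsY_indep spec filt (s0 n) KA (@futureJ_loss_below n y)) (rc n) (mY n).
pose V n : set Omega := [set w | loss_below n (Y w) w].
pose q n w := fine (P (loss_below n (Y w))).
have mV n : measurable (V n) by exact: K.2 _ (srcWJY_loss_below n).
have mq n : gmeas (srcWJsY P X (s n)) (q n).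
  by have [] := fr n (fun=> 0) (measurable_cst _) (bounded_cst _ 0).
have q1 n w : `|q n w| <= 1.
  by apply: prob_norm_le1; exact: measurable_loss_below.
have bq n : bounded (q n) by exists 1.
have mqJ n : gmeas (srcWJY P X) (q n) by exact: (gmeas_WJsY_WJY spec filt (mq n)).
have bfq n := gmeas_bfun K (mqJ n) (bq n).
have step n :
    Ex P (fun w => \1_A w * (\1_(zeroN p X (s n)) w * (Z w * (\1_(belowset p X t0) w * \1_(V n) w)))) =
    Ex P (fun w => \1_A w * (\1_(zeroN p X (s n)) w * (Z w * (\1_(belowset p X t0) w * q n w)))).
  have ts : t0 < s n by case/andP: (t0s n).
  have [A' KA' AA'] := F_trace adm spec filt t00 ts FA.
  have KA'' : srcWJY P X A' by exact: srcWJsY_sub KA'.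
  have mA' := K.2 _ KA''.
  (* The no-intervention indicator involves the unit Poisson process; it is first replaced by a
     survival factor, so that the whole weight becomes measurable for [srcWJsY (s n)]. *)
  have red (W : Omega -> R) : gmeas (srcWJY P X) W -> bounded W ->
     Ex P (fun w => \1_A w * (\1_(zeroN p X (s n)) w * (Z w * (\1_(belowset p X t0) w * W w)))) =
     Ex P (fun w => (\1_A' w * (Z w * (\1_(belowset p X t0) w * surv p X 0 (s n) w))) * W w).
    move=> mW bW; have bfW := gmeas_bfun K mW bW.
    have mZ' : gmeas (srcWJY P X) (fun w => \1_A' w * (Z w * (\1_(belowset p X t0) w * W w))).
      apply: measurable_funM; first exact: gmeas_indic K.1 KA''.
      apply: measurable_funM => //; apply: measurable_funM => //.
      by apply: gmeas_indic K.1 _; exact: srcWJsY_sub (gB0 n).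
    have bZ' : bounded (fun w => \1_A' w * (Z w * (\1_(belowset p X t0) w * W w))).
      apply: boundedM; first exact: bounded_indic.
      by apply: boundedM => //; apply: boundedM => //; exact: bounded_indic.
    transitivity (Ex P (fun w => (\1_A' w * (Z w * (\1_(belowset p X t0) w * W w))) *
        \1_(zeroN p X (s n)) w)).
      apply: Ex_ae.
      - apply: bfunM; first exact: bfun_indic.
        apply: bfunM; first exact/bfun_indic/mZN.
        by apply: bfunM => //; apply: bfunM => //; exact: bfun_indic.
      - apply: bfunM; last exact/bfun_indic/mZN.
        exact: gmeas_bfun K mZ' bZ'.
      apply: filterS AA' => w h.
      have [z|nz] := pselect (zeroN p X (s n) w); last first.
        by rewrite [\1_(zeroN p X (s n)) w]indicE memNset// mul0r !mulr0.
      have -> : \1_A w = \1_A' w :> R.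
        rewrite !indicE; congr (nat_of_bool _)%:R.
        by apply/idP/idP => /set_mem ?; apply/mem_set; apply/(h z).
      by ring.
    rewrite (Ex_zeroN adm spec filt (s0 n) mZ' bZ'); congr Ex; apply/funext => w.
    by ring.
  rewrite (red _ (gmeas_indic K.1 (srcWJY_loss_below n)) (bounded_indic _ _)).
  rewrite (red _ (mqJ n) (bq n)).
  have mS : gmeas (srcWJsY P X (s n))
      (fun w => \1_A' w * (Z w * (\1_(belowset p X t0) w * surv p X 0 (s n) w))).
    apply: measurable_funM; first exact: gmeas_indic (srcWJsY_subsigma spec filt (s n)).1 KA'.
    apply: measurable_funM; first exact: (gmeas_WY_WJsY spec filt).
    apply: measurable_funM; first exact: gmeas_indic (srcWJsY_subsigma spec filt (s n)).1 (gB0 n).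
    by apply: (gmeas_WY_WJsY spec filt); apply: (gmeas_surv adm spec filt).
  have bS : bounded (fun w => \1_A' w * (Z w * (\1_(belowset p X t0) w * surv p X 0 (s n) w))).
    apply: boundedM; first exact: bounded_indic.
    by apply: boundedM => //; apply: boundedM; [exact: bounded_indic|exact: bounded_surv].
  by have [_ _ h] := fr n _ mS bS; exact: h.
have [M ZM] := bZ.
have lim (W_ : nat -> Omega -> R) (W : Omega -> R) :
    (forall n, bfun (W_ n)) -> bfun W -> (forall n w, `|W_ n w| <= 1) ->
    {ae P, forall w, W_ n w @[n --> \oo] --> W w} ->
    Ex P (fun w => \1_A w * (\1_(zeroN p X (s n)) w * (Z w * W_ n w))) @[n --> \oo] -->
    Ex P (fun w => \1_A w * (\1_(zeroN p X t0) w * (Z w * W w))).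
  move=> bW_ bW W1 cW; apply: (@Ex_cvg _ _ _ _ _ _ M).
  - move=> n; apply: (proj1 (_ : bfun _)); apply: bfunM; first exact: bfun_indic.
    by apply: bfunM; [exact/bfun_indic/mZN|exact: bfunM].
  - apply: (proj1 (_ : bfun _)); apply: bfunM; first exact: bfun_indic.
    by apply: bfunM; [exact/bfun_indic/mZN|exact: bfunM].
  - move=> n w; apply: norm_mul_le; first exact: norm_indic_le1.
    apply: norm_mul_le; first exact: norm_indic_le1.
    by rewrite mulrC; apply: norm_mul_le.
  apply: filterS2 (ae_good_path adm spec) cW => w g cw.
  apply: cvgM; first exact: cvg_cst.
  apply: cvgM; last by apply: cvgM => //; exact: cvg_cst.
  exact: (cvg_comp _ _ (first_gridpt_cvg t0t) (zeroN_rc g t00)).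
apply: limits_eq step _ _; apply: lim.
- by move=> n; apply: bfunM; exact: bfun_indic.
- apply: bfun_indic; have t00' : 0 <= t by rewrite (le_trans t00)// ltW.
  exact: (F_subsigma filt t00').2 _ (F_belowset adm spec filt t00').
- by move=> n w; apply: norm_mul_le; exact: norm_indic_le1.
(* Staying below up to [t] splits at [t0] into the past and the later losses, compared with the
   headroom [Y w]. *)
- apply: filterS (ae_good_path adm spec) => w g.
  apply: cvg_near_cst; apply: filterS (near_loss_below (Y w) g) => n h.
  rewrite -[LHS]/((\1_(belowset p X t0) : Omega -> R) w * (\1_(V n) : Omega -> R) w).
  rewrite -[LHS]/((\1_(belowset p X t0) \* \1_(V n)) w : R) -indicI !indicE.
  congr (nat_of_bool _)%:R.
  have YE : Y w + Jcomp p X t0 w = barrier p by rewrite /Y subrK.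
  apply/idP/idP => /set_mem; rewrite /V /belowset /below/=.
    move=> [h1 /h h2]; apply/mem_set => r /andP[r0 rt].
    have [rt0|t0r] := leP r t0; first by apply: h1; rewrite r0.
    by rewrite -YE; apply: h2; rewrite (ltW t0r).
  move=> h'; apply/mem_set; split=> [r /andP[r0 rt0]|].
    by apply: h'; rewrite r0 (le_trans rt0)// ltW.
  apply/h => r /andP[t0r rt]; rewrite YE; apply: h'.
  by rewrite rt (le_trans t00).
- by move=> n; apply: bfunM => //; exact: bfun_indic.
- apply: gmeas_bfun (F_subsigma filt t00) gmeas_later_below bounded_later_below.
- by move=> n w; apply: norm_mul_le; [exact: norm_indic_le1|exact: q1].
- apply: aeW => w; apply: cvgM; first exact: cvg_cst.
  exact: loss_below_prob_cvg.
Qed.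

End later_loss.

End crossing.

Section factorization.
Context d (Omega : measurableType d) (R : realType) (P : probability Omega R).
Variables (p : coco_params R) (X : drivers Omega R) (F : R -> set (set Omega)).
Variables (t0 : R) (Pf : R -> Omega -> cumulative R R) (Ef : R -> R -> Omega -> R).
Hypothesis adm : admissible p.
Hypothesis spec : drivers_spec P p X.
Hypothesis filt : filtration_spec P p X F.
Hypothesis t00 : 0 <= t0.
Hypothesis cross : is_crossing_prob P p X (F t0) Pf.
Hypothesis str : is_survival_transform P p X (F t0) t0 Ef.

Let sF : subsigma (F t0) := F_subsigma filt t00.

Definition stay t w : R := 1 - clip01 (Pf (barrier p) w t).

Definition quiet t w : R := clip01 (Ef t 1 w).

Lemma measurable_belowset t : 0 <= t -> measurable (belowset p X t).
Proof. by move=> tge; exact: (F_subsigma filt tge).2 _ (F_belowset adm spec filt tge). Qed.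

Lemma belowset_Jbar w t : good_path p X w -> 0 <= t ->
  (\1_[set w | barrier p < Jbar p X t w] w : R) = 1 - \1_(belowset p X t) w.
Proof.
move=> g tge; have h := Jbar_gtP adm (good_count1_nd g) (barrier p) tge.
rewrite !indicE; have [b|nb] := pselect (belowset p X t w).
  by rewrite memNset ?(mem_set b) ?subrr//= => /h; exact.
by rewrite mem_set ?(memNset nb) ?subr0//=; apply/h.
Qed.

Lemma crossing_clip t : 0 <= t ->
  {ae P, forall w, Pf (barrier p) w t = clip01 (Pf (barrier p) w t)} /\
  forall m, gmeas (F t0) m -> bounded m ->
    Ex P (fun w => m w * \1_(belowset p X t) w) = Ex P (fun w => m w * stay t w).
Proof.
move=> tge; have mB := measurable_belowset tge.
have bB : bfun (fun w => 1 - \1_(belowset p X t) w : R).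
  by apply: bfunB; [exact: bfun_cst|exact: bfun_indic].
have [||h1 h2] := cond_exp_clip sF (cross (barrier p) tge) bB.
- by move=> w; rewrite indicE; case: (_ \in _); rewrite ?subrr ?subr0 ?lexx ler01.
- by apply: filterS (ae_good_path adm spec) => w g; exact: belowset_Jbar.
split=> // m mm bm; have bfm := gmeas_bfun sF mm bm.
have gP : gmeas (F t0) (fun w => clip01 (Pf (barrier p) w t)).
  by apply: gmeas_clip01; exact: cond_exp_gmeas sF.1 (cross (barrier p) tge).
have bP := gmeas_bfun sF gP (bounded_clip01 _).
have E (x y : R) : x * y = x - x * (1 - y) by ring.
rewrite (_ : (fun w => m w * \1_(belowset p X t) w) =
  (fun w => m w - m w * (1 - \1_(belowset p X t) w))); last exact/funext.
rewrite ExB//; last exact: bfunM.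
rewrite h2// -ExB//; last exact: bfunM.
by congr Ex; apply/funext => w; rewrite /stay; ring.
Qed.

Lemma gmeas_stay t : 0 <= t -> gmeas (F t0) (stay t).
Proof.
move=> tge; apply: measurable_funB => //; apply: gmeas_clip01.
exact: cond_exp_gmeas sF.1 (cross (barrier p) tge).
Qed.

Lemma stay_norm t w : `|stay t w| <= 1.
Proof.
have /andP[h0 h1] := clip01_itv (Pf (barrier p) w t).
by rewrite ger0_norm /stay ?subr_ge0// gerBl.
Qed.

Lemma bounded_stay t : bounded (stay t).
Proof. by exists 1 => w; exact: stay_norm. Qed.

(** The conditional probability [Pf] is tested only against [F t0], whereas [Z] involves the future
    intensity. The explicit [later_below] accepts such weights; the case [Z = 1] identifies it with
    [stay t] almost surely before any intervention. *)
Lemma Ex_stay t (A : set Omega) (Z : Omega -> R) : t0 <= t ->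
  F t0 A -> gmeas (srcWY P X) Z -> bounded Z ->
  Ex P (fun w => \1_A w * (\1_(zeroN p X t0) w * (Z w * \1_(belowset p X t) w))) =
  Ex P (fun w => \1_A w * (\1_(zeroN p X t0) w * (Z w * stay t w))).
Proof.
move=> t0t FA mZ bZ; have tge := le_trans t00 t0t.
have [psi [mpsi bpsi H]] : exists psi, [/\ gmeas (F t0) psi, bounded psi &
    forall A Z, F t0 A -> gmeas (srcWY P X) Z -> bounded Z ->
    Ex P (fun w => \1_A w * (\1_(zeroN p X t0) w * (Z w * \1_(belowset p X t) w))) =
    Ex P (fun w => \1_A w * (\1_(zeroN p X t0) w * (Z w * psi w)))].
  (* For [t = t0] the event is already known and its indicator serves as [psi]. *)
  move: t0t; rewrite le_eqVlt => /predU1P[<-|t0t].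
    exists (\1_(belowset p X t0)); split=> //; last exact: bounded_indic.
    by apply: gmeas_indic sF.1 _; exact: (F_belowset adm spec filt).
  exists (later_below P p X t0 t); split.
  - exact: (gmeas_later_below adm spec filt).
  - exact: (bounded_later_below adm spec filt).
  - by move=> A' Z' *; exact: (Ex_later_below adm spec filt).
have FN := F_zeroN filt t00; have mN := sF.2 _ FN.
have bfN : bfun (\1_(zeroN p X t0) : Omega -> R) by exact: bfun_indic.
have mA := sF.2 _ FA.
have sWY := srcWY_subsigma spec filt.
have bfZ : bfun Z.
  exact: gmeas_bfun sWY mZ bZ.
have bfpsi := gmeas_bfun sF mpsi bpsi.
have gst := gmeas_stay tge.
have bfst := gmeas_bfun sF gst (bounded_stay t).
have mN1 (f : Omega -> R) : gmeas (F t0) f -> gmeas (F t0) (fun w => \1_(zeroN p X t0) w * f w).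
  by move=> mf; apply: measurable_funM => //; exact: gmeas_indic sF.1 FN.
have E : {ae P, forall w, \1_(zeroN p X t0) w * psi w = \1_(zeroN p X t0) w * stay t w}.
  apply: (eq_ae_of_integrals sF).
  - exact/bfun_integrable/bfunM.
  - exact/bfun_integrable/bfunM.
  - exact: mN1.
  - exact: mN1.
  move=> B FB; rewrite !RintegralE.
  have := H B (fun=> 1) FB (measurable_cst _) (bounded_cst _ 1).
  under eq_fun do rewrite mul1r.
  under [X in _ = Ex P X]eq_fun do rewrite mul1r.
  move=> <-.
  have gm : gmeas (F t0) (fun w => \1_B w * \1_(zeroN p X t0) w : R).
    by apply: measurable_funM; apply: gmeas_indic sF.1 _.
  have bm : bounded (fun w => \1_B w * \1_(zeroN p X t0) w : R).
    by apply: boundedM; exact: bounded_indic.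
  have := (crossing_clip tge).2 _ gm bm.
  under eq_fun do rewrite -mulrA.
  by under [X in _ = Ex P X]eq_fun do rewrite -mulrA.
rewrite (H _ _ FA mZ bZ); apply: Ex_ae.
- by apply: bfunM; [exact: bfun_indic|apply: bfunM => //; exact: bfunM].
- by apply: bfunM; [exact: bfun_indic|apply: bfunM => //; exact: bfunM].
by apply: filterS E => w h; rewrite ![_ * (Z w * _)]mulrCA h.
Qed.

Lemma survival_clip t : t0 <= t ->
  {ae P, forall w, Ef t 1 w = quiet t w} /\
  forall m, gmeas (F t0) m -> bounded m ->
    Ex P (fun w => m w * surv p X t0 t w) = Ex P (fun w => m w * quiet t w).
Proof.
move=> t0t; have mS : gmeas (srcWY P X) (surv p X t0 t).
  exact: (gmeas_surv adm spec filt).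
apply: (cond_exp_clip sF (str.1 t 1 t0t ler01)).
- exact: gmeas_bfun (srcWY_subsigma spec filt) mS (bounded_surv _ _ _ _).
- by move=> w; exact: surv_itv.
- by apply: filterS (ae_good_path adm spec) => w g; rewrite mul1r survE.
Qed.

Lemma gmeas_quiet t : t0 <= t -> gmeas (F t0) (quiet t).
Proof.
by move=> t0t; apply: gmeas_clip01; exact: cond_exp_gmeas sF.1 (str.1 t 1 t0t ler01).
Qed.

(** The order matters: removing the interventions leaves a survival weight in [srcWY], which
    [Ex_stay] admits; once the losses are replaced by [stay], all factors but survival are
    [F t0]-measurable. Two times are kept because recovery compares consecutive grid points. *)
Lemma Ex_factor t t' (A : set Omega) : t0 <= t' -> t' <= t -> t0 < t -> F t0 A ->
  Ex P (fun w => \1_A w * (\1_(belowset p X t') w * \1_(zeroN p X t) w)) =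
  Ex P (fun w => \1_A w * (\1_(zeroN p X t0) w * (stay t' w * quiet t w))).
Proof.
move=> t0t' t't t0t FA; have t'0 := le_trans t00 t0t'.
have mB : gmeas (srcWJY P X) (\1_(belowset p X t') : Omega -> R).
  apply: gmeas_indic (srcWJY_subsigma spec filt).1 _.
  exact: srcWJsY_sub (srcWJsY_belowset adm spec filt t'0 (lexx t')).
rewrite (Ex_survival adm spec filt t00 t0t FA mB (bounded_indic _ _)).
under eq_fun do rewrite [\1_(belowset _ _ _) _ * _]mulrC.
rewrite (Ex_stay t0t' FA)//; last 2 first.
- by apply: (gmeas_surv adm spec filt) => //; exact: ltW.
- exact: bounded_surv.
pose m w : R := \1_A w * (\1_(zeroN p X t0) w * stay t' w).
have gm : gmeas (F t0) m.
  apply: measurable_funM; first exact: gmeas_indic sF.1 FA.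
  apply: measurable_funM; first exact: gmeas_indic sF.1 (F_zeroN filt t00).
  exact: gmeas_stay.
have bm : bounded m.
  apply: boundedM; first exact: bounded_indic.
  by apply: boundedM; [exact: bounded_indic|exact: bounded_stay].
have := (survival_clip (ltW t0t)).2 _ gm bm; rewrite /m => h.
transitivity (Ex P (fun w => m w * surv p X t0 t w)).
  by congr Ex; apply/funext => w; rewrite /m; ring.
by rewrite h; congr Ex; apply/funext => w; ring.
Qed.

End factorization.

(** The drops of a nonincreasing sequence telescope, giving a bound that does not grow with the
    number of terms. *)
Lemma norm_sum_decr {R : realType} (c a : nat -> R) (M : R) n :
  (forall i, (i < n)%N -> `|c i| <= M) -> (forall i, (i < n)%N -> a i.+1 <= a i) ->
  `|\sum_(i < n) c i * (a i - a i.+1)| <= M * (a 0%N - a n).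
Proof.
elim: n => [|n IH] cM ad; first by rewrite big_ord0 normr0 subrr mulr0.
rewrite big_ord_recr/= (le_trans (ler_normD _ _))//.
have -> : M * (a 0%N - a n.+1) = M * (a 0%N - a n) + M * (a n - a n.+1) by ring.
apply: lerD; first by apply: IH => i i_n; [apply: cM|apply: ad]; exact: ltnW.
have h : 0 <= a n - a n.+1 by rewrite subr_ge0 ad.
by rewrite normrM [X in _ * X]ger0_norm// ler_wpM2r// cM.
Qed.

Lemma indicM_asbool {T : Type} {R : realType} (A B : set T) w :
  \1_A w * \1_B w = `[< A w /\ B w >]%:R :> R.
Proof.
rewrite !indicE -natrM mulnb; congr (nat_of_bool _)%:R.
apply/andP/asboolP => [[/set_mem a /set_mem b]//|[a b]].
by split; exact/mem_set.
Qed.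

Lemma clip01_mono {R : realType} (x y : R) : x <= y -> clip01 x <= clip01 y.
Proof.
move=> xy; rewrite /clip01 ge_max !le_max lexx/=; apply/orP; right.
by rewrite le_min !ge_min xy lexx orbT.
Qed.

(** Outside []a, T]], where [fine x] may be a default value, the indicator annihilates both
    sides. *)
Lemma frozen_fine {R : realType} (D : R -> R) (a T c : R) (x : \bar R) :
  c * D (fine x) * (a%:E < x <= T%:E)%E%:R =
  D (Order.min (fine x) T) * c * (a%:E < x <= T%:E)%E%:R.
Proof.
rewrite [c * _]mulrC; have [/andP[]|_] := boolP (_ < _ <= _)%E; last by rewrite !mulr0.
by case: x => [r _|_|] //=; rewrite lee_fin => rT; rewrite min_l.
Qed.

Section discounting.
Context (R : realType) (p : coco_params R) (t0 : R).
Hypothesis adm : admissible p.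
Hypothesis t0T : 0 <= t0 < expiry p.

(* The rate is only assumed integrable up to expiry, where the discount factor
   is frozen. *)
Definition disc (s : R) : R := discount p t0 (Order.min s (expiry p)).

Lemma discE s : s <= expiry p -> disc s = discount p t0 s.
Proof. by move=> sT; rewrite /disc min_l. Qed.

Let cont : {within `[t0, expiry p], continuous (discount p t0)}.
Proof.
case/andP: t0T => t00 t0lT.
have iR : (@lebesgue_measure R).-integrable `[t0, expiry p] (EFin \o rate p).
  apply: integrableS (rate_integrable adm) => //.
  by apply: subset_itvr; rewrite bnd_simp.
have hc := parameterized_integral_continuous (ltW t0lT) iR.
have he : continuous (fun y : R => expR (- y)).
  by move=> y; apply: continuous_comp; [exact: opp_continuous|exact: continuous_expR].
move=> x; apply: (@continuous_comp (subspace `[t0, expiry p]) R R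
  (fun y => parameterized_integral lebesgue_measure t0 y (rate p)) (fun y => expR (- y)));
  [exact: hc|exact: he].
Qed.

Lemma disc_rc t : t0 < t <= expiry p -> disc s @[s --> t^'+] --> disc t.
Proof.
case/andP: t0T => t00 t0lT /andP[t0t]; rewrite le_eqVlt => /predU1P[->|tT].
  apply: cvg_near_cst; near=> s.
  have Ts : expiry p <= s by apply: ltW; near: s; exact: nbhs_right_gt.
  by rewrite /disc minxx min_r.
have [h _ _] := (continuous_within_itvP _ t0lT).1 cont.
have ht : discount p t0 s @[s --> t^'+] --> disc t.
  rewrite discE ?ltW//; apply: cvg_at_right_filter; apply: h.
  by rewrite in_itv/= t0t tT.
apply: cvg_trans ht; apply: near_eq_cvg; near=> s.
have sT : s <= expiry p by apply: ltW; near: s; exact: nbhs_right_lt.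
by rewrite discE.
Unshelve. all: by end_near. Qed.

Lemma disc_bounded : exists2 M : R, 0 <= M & forall s, t0 <= s -> `|disc s| <= M.
Proof.
case/andP: t0T => t00 t0lT.
have [c _ H] := EVT_max (ltW t0lT) cont.
exists (discount p t0 c) => [|s t0s]; first exact: expR_ge0.
rewrite ger0_norm; last exact: expR_ge0.
apply: H; rewrite in_itv/= ge_min lexx orbT andbT.
by rewrite le_min t0s ltW.
Qed.

End discounting.

Section good_path_stopping.
Context d (Omega : measurableType d) (R : realType) (P : probability Omega R).
Variables (p : coco_params R) (X : drivers Omega R) (t0 : R) (w : Omega).
Hypothesis adm : admissible p.
Hypothesis g : good_path p X w.
Hypothesis t0T : 0 <= t0 < expiry p.

Let jc t := Jcomp p X t w.
Let m t := N3Lambda p X t w.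
Let T := expiry p.
Let b := barrier p.

Let tau1E : tau1 p X w = ereal_inf [set t%:E | t in [set t | 0 < t <= T /\ b < jc t]].
Proof.
by rewrite /tau1; under [X in image X _]eq_fun do rewrite CET1_ltP//.
Qed.

Let tauE : tau p X w =
  ereal_inf [set t%:E | t in [set t | 0 < t <= T /\ (b < jc t \/ m t = 1%N)]].
Proof.
by rewrite /tau; under [X in image X _]eq_fun do rewrite CET1_ltP//.
Qed.

Let jc_down := Jcomp_down adm (good_count1_rc g).

Let jc_start : jc 0 <= b.
Proof. by rewrite /jc (Jcomp_0 _ (good_count1_0 g)) barrier_ge0. Qed.

Let gN := good_path_N3Lambda g.

Lemma tau_gt_indic t : 0 <= t <= T ->
  (t%:E < tau p X w)%E%:R = \1_(belowset p X t) w * \1_(zeroN p X t) w :> R.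
Proof.
move=> tT; rewrite indicM_asbool; congr (nat_of_bool _)%:R; rewrite tauE.
have h := tau_gt jc_down jc_start (N3Lambda_nd gN) (N3Lambda_0 gN) (N3Lambda_rc gN)
  (N3Lambda_simple gN) tT.
by apply/idP/asboolP => /h.
Qed.

Lemma recovery_cvg :
  \sum_(i < n) disc p t0 (gridpt t0 T n i.+1) *
    (\1_(belowset p X (gridpt t0 T n i)) w * \1_(zeroN p X (gridpt t0 T n i.+1)) w
     - \1_(belowset p X (gridpt t0 T n i.+1)) w * \1_(zeroN p X (gridpt t0 T n i.+1)) w)
  @[n --> \oo] -->
  (tau1 p X w < tau3 p X w)%E%:R * discount p t0 (fine (tau p X w))
     * (t0%:E < tau p X w <= T%:E)%E%:R.
Proof.
have h := crossing_sum_cvg jc_down jc_start (N3Lambda_nd gN) (N3Lambda_0 gN) (N3Lambda_rc gN)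
  (N3Lambda_simple gN) t0T (disc_rc adm t0T).
rewrite -tauE -tau1E in h.
rewrite (frozen_fine (discount p t0)).
apply: cvg_trans h; apply: near_eq_cvg; apply: nearW => n.
by apply: eq_bigr => i _; rewrite !indicM_asbool.
Qed.

End good_path_stopping.

(** * Valuation *)

Section matching.
Context d (Omega : measurableType d) (R : realType) (P : probability Omega R).
Variables (G : set (set Omega)) (N0 : set Omega).
Hypothesis mG : G `<=` measurable.
Hypothesis mN0 : measurable N0.
Implicit Types f g : Omega -> R.

(* On [N0], [g] is the conditional expectation of [f] given [G]; elsewhere that
   expectation vanishes. *)
Definition matches f g := [/\ bfun f, bfun g & forall A, G A ->
  Ex P (fun w => \1_A w * f w) = Ex P (fun w => \1_A w * (\1_N0 w * g w))].

Lemma matchesD f1 g1 f2 g2 : matches f1 g1 -> matches f2 g2 ->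
  matches (fun w => f1 w + f2 w) (fun w => g1 w + g2 w).
Proof.
move=> [bf1 bg1 h1] [bf2 bg2 h2]; split; [exact: bfunD|exact: bfunD|move=> A GA].
have bA : bfun (\1_A : Omega -> R) by apply: bfun_indic; exact: mG.
have bN : bfun (\1_N0 : Omega -> R) by exact: bfun_indic.
have bAf f : bfun f -> bfun (fun w => \1_A w * f w) by exact: bfunM.
have bNf f : bfun f -> bfun (fun w => \1_N0 w * f w) by exact: bfunM.
transitivity (Ex P (fun w => \1_A w * f1 w + \1_A w * f2 w)).
  by congr Ex; apply/funext => w; rewrite mulrDr.
rewrite (ExD P (bAf _ bf1) (bAf _ bf2)) h1// h2//.
rewrite -(ExD P (bAf _ (bNf _ bg1)) (bAf _ (bNf _ bg2))).
by congr Ex; apply/funext => w; rewrite !mulrDr.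
Qed.

Lemma matchesZ c f g : matches f g -> matches (fun w => c * f w) (fun w => c * g w).
Proof.
move=> [bf bg h]; split; [exact/bfunM/bf/bfun_cst|exact/bfunM/bg/bfun_cst|move=> A GA].
have bA : bfun (\1_A : Omega -> R) by apply: bfun_indic; exact: mG.
have bN : bfun (\1_N0 : Omega -> R) by exact: bfun_indic.
transitivity (Ex P (fun w => c * (\1_A w * f w))).
  by congr Ex; apply/funext => w; rewrite mulrCA.
rewrite (ExZ P c (bfunM bA bf)) h// -(ExZ P c (bfunM bA (bfunM bN bg))).
by congr Ex; apply/funext => w; ring.
Qed.

Lemma matches0 : matches (fun=> 0) (fun=> 0).
Proof.
split; [exact: bfun_cst|exact: bfun_cst|move=> A GA].
by congr Ex; apply/funext => w; rewrite !mulr0.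
Qed.

Lemma matchesB f1 g1 f2 g2 : matches f1 g1 -> matches f2 g2 ->
  matches (fun w => f1 w - f2 w) (fun w => g1 w - g2 w).
Proof.
move=> m1 /(matchesZ (-1)) m2; have := matchesD m1 m2.
rewrite (_ : (fun w => f1 w + _) = (fun w => f1 w - f2 w)); last first.
  by apply/funext => w; rewrite mulN1r.
by rewrite (_ : (fun w => g1 w + _) = (fun w => g1 w - g2 w))//;
  apply/funext => w; rewrite mulN1r.
Qed.

Lemma matches_sum I (s : seq I) (f g : I -> Omega -> R) :
  (forall i, matches (f i) (g i)) ->
  matches (fun w => \sum_(i <- s) f i w) (fun w => \sum_(i <- s) g i w).
Proof.
move=> H; elim: s => [|i s IH].
  rewrite (_ : (fun w => _) = (fun=> 0)); last by apply/funext => w; rewrite big_nil.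
  rewrite (_ : (fun w => \sum_(i <- _) g i w) = (fun=> 0)); first exact: matches0.
  by apply/funext => w; rewrite big_nil.
rewrite (_ : (fun w => _) = (fun w => f i w + \sum_(i <- s) f i w)); last first.
  by apply/funext => w; rewrite big_cons.
rewrite (_ : (fun w => \sum_(i <- _) g i w) = (fun w => g i w + \sum_(i <- s) g i w)).
  exact: matchesD.
by apply/funext => w; rewrite big_cons.
Qed.

End matching.

Section valuation.
Context d (Omega : measurableType d) (R : realType) (P : probability Omega R).
Variables (p : coco_params R) (X : drivers Omega R) (F : R -> set (set Omega)).
Variables (t0 : R) (Pf : R -> Omega -> cumulative R R) (Ef : R -> R -> Omega -> R).
Hypothesis adm : admissible p.
Hypothesis spec : drivers_spec P p X.
Hypothesis filt : filtration_spec P p X F.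
Hypothesis t0T : 0 <= t0 < expiry p.
Hypothesis cross : is_crossing_prob P p X (F t0) Pf.
Hypothesis str : is_survival_transform P p X (F t0) t0 Ef.

Let T := expiry p.
Let t00 : 0 <= t0. Proof. by case/andP: t0T. Qed.
Let t0lT : t0 < T. Proof. by case/andP: t0T. Qed.
Let sF : subsigma (F t0) := F_subsigma filt t00.
Let u n i := gridpt t0 T n i.

Let stays := stay p Pf.
Let quiets := quiet Ef.
Let corresponds := matches P (F t0) (zeroN p X t0).

Lemma corresponds_factor t t' : t0 <= t' -> t' <= t -> t0 < t ->
  corresponds (fun w => \1_(belowset p X t') w * \1_(zeroN p X t) w)
              (fun w => stays t' w * quiets t w).
Proof.
move=> t0t' t't t0t; have t'0 := le_trans t00 t0t'.
have mB := measurable_belowset adm spec filt t'0.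
have mN := measurable_zeroN filt (le_trans t'0 t't).
split.
- by apply: bfunM; exact: bfun_indic.
- apply: bfunM; apply: (gmeas_bfun sF).
  + exact: (gmeas_stay filt t00 cross).
  + exact: bounded_stay.
  + by apply: (gmeas_quiet filt t00 str); exact: ltW.
  + exact: bounded_clip01.
- by move=> A FA; exact: (Ex_factor adm spec filt t00 cross str).
Qed.

Definition fixed_paths w : R :=
  \sum_(i < ncoupon p) coupon p i * discount p t0 (coupon_date p i)
     * (t0 < coupon_date p i)%R%:R *
     (\1_(belowset p X (coupon_date p i)) w * \1_(zeroN p X (coupon_date p i)) w)
  + face p * discount p t0 T * (\1_(belowset p X T) w * \1_(zeroN p X T) w).

Definition fixed_value w : R :=
  \sum_(i < ncoupon p) coupon p i * discount p t0 (coupon_date p i)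
     * (t0 < coupon_date p i)%R%:R *
     (stays (coupon_date p i) w * quiets (coupon_date p i) w)
  + face p * discount p t0 T * (stays T w * quiets T w).

Definition recovery_paths n w : R := \sum_(i < n) disc p t0 (u n i.+1) *
  (\1_(belowset p X (u n i)) w * \1_(zeroN p X (u n i.+1)) w
   - \1_(belowset p X (u n i.+1)) w * \1_(zeroN p X (u n i.+1)) w).

Definition recovery_value n w : R := \sum_(i < n) disc p t0 (u n i.+1) *
  (stays (u n i) w * quiets (u n i.+1) w
   - stays (u n i.+1) w * quiets (u n i.+1) w).

Let mF := sF.2.
Let mN0 : measurable (zeroN p X t0) := measurable_zeroN filt t00.

Lemma corresponds_fixed : corresponds fixed_paths fixed_value.
Proof.
apply: (matchesD mF mN0); last first.
  by apply: (matchesZ mF mN0); apply: corresponds_factor => //; exact: ltW.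
apply: (matches_sum mF mN0) => i; have [t0i|_] := boolP (t0 < coupon_date p i).
  by apply: (matchesZ mF mN0); apply: corresponds_factor => //; exact: ltW.
rewrite (_ : (fun w => _) = (fun=> 0)); last by apply/funext => w; rewrite mulr0 mul0r.
rewrite (_ : (fun w => _ * (stays _ w * _)) = (fun=> 0)); first exact: matches0.
by apply/funext => w; rewrite mulr0 mul0r.
Qed.

Lemma u_itv n i : (i <= n)%N -> (0 < n)%N -> t0 <= u n i <= T.
Proof. by move=> i_n n0; apply: gridpt_itv => //; exact: ltW. Qed.

Lemma uS n i : (i < n)%N -> t0 <= u n i /\ u n i < u n i.+1.
Proof.
move=> i_n; have n0 : (0 < n)%N by exact: leq_ltn_trans i_n.
split; first by have /andP[] := u_itv (ltnW i_n) n0.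
by rewrite /u gridptS ltrDl divr_gt0 ?subr_gt0// ltr0n.
Qed.

Lemma corresponds_recovery n : corresponds (recovery_paths n) (recovery_value n).
Proof.
apply: (matches_sum mF mN0) => i; apply: (matchesZ mF mN0).
have [h1 h2] := uS (ltn_ord i); have h3 := le_lt_trans h1 h2.
by apply: (matchesB mF mN0); apply: corresponds_factor => //; exact: ltW.
Qed.

(** The total drop of [a] is at most 1, so the bound is uniform in [n]. It dominates both the
    pathwise sums and their conditional values. *)
Lemma norm_recovery M (c a : nat -> R) n : (forall s, t0 <= s -> `|disc p t0 s| <= M) -> 0 <= M ->
  (forall i, `|c i| <= 1) -> (forall i, 0 <= a i <= 1) ->
  (forall i, (i < n)%N -> a i.+1 <= a i) ->
  `|\sum_(i < n) disc p t0 (u n i.+1) * (a i * c i - a i.+1 * c i)| <= M.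
Proof.
move=> DM M0 c1 a01 ad.
have -> : \sum_(i < n) disc p t0 (u n i.+1) * (a i * c i - a i.+1 * c i) =
  \sum_(i < n) (disc p t0 (u n i.+1) * c i) * (a i - a i.+1).
  by apply: eq_bigr => i _; ring.
have h := @norm_sum_decr _ (fun i => disc p t0 (u n i.+1) * c i) a M n _ ad.
apply: le_trans (h _) _.
  move=> i i_n; rewrite mulrC; apply: norm_mul_le; first exact: c1.
  by apply: DM; have [h1 /ltW h2] := uS i_n; exact: le_trans h2.
have /andP[_ a0] := a01 0%N; have /andP[an _] := a01 n.
by rewrite ler_piMr// lerBlDr (le_trans a0)// lerDl.
Qed.

Lemma recovery_paths_bound M n w : (forall s, t0 <= s -> `|disc p t0 s| <= M) -> 0 <= M ->
  `|recovery_paths n w| <= M.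
Proof.
move=> DM M0; apply: (norm_recovery (c := fun i => \1_(zeroN p X (u n i.+1)) w)
  (a := fun i => \1_(belowset p X (u n i)) w)) => //.
- by move=> i; exact: norm_indic_le1.
- by move=> i; rewrite indicE; case: (_ \in _); rewrite ?lexx ?ler01.
- move=> i i_n; have [_ /ltW h] := uS i_n; rewrite !indicE.
  case: (boolP (w \in belowset p X (u n i.+1))) => [/set_mem b|_]; last by rewrite ler0n.
  by rewrite (_ : (w \in belowset p X (u n i)) = true)//; apply/mem_set; exact: below_le h b.
Qed.

Lemma recovery_value_bound M n w : (forall s, t0 <= s -> `|disc p t0 s| <= M) -> 0 <= M ->
  `|recovery_value n w| <= M.
Proof.
move=> DM M0; apply: (norm_recovery (c := fun i => quiets (u n i.+1) w)
  (a := fun i => stays (u n i) w)) => //.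
- by move=> i; exact: clip01_norm.
- move=> i; have /andP[h0 h1] := clip01_itv (Pf (barrier p) w (u n i)).
  by rewrite /stays /stay subr_ge0 h1 gerBl.
- move=> i i_n; have [_ /ltW h] := uS i_n; rewrite lerD2l lerN2.
  by apply: clip01_mono; exact: cumulative_is_nondecreasing.
Qed.

(** Differences of [stays] are the Stieltjes masses of the cells. The hypothesis speaks of grid
    points only, so that it can hold off one null set. *)
Lemma recovery_value_cvg w :
  (forall n i, (i <= n)%N -> (0 < n)%N -> Ef (u n i) 1 w = quiets (u n i) w /\
     Pf (barrier p) w (u n i) = clip01 (Pf (barrier p) w (u n i))) ->
  recovery_value n w @[n --> \oo] -->
  \int[lebesgue_stieltjes_measure (Pf (barrier p) w)]_(s in `]t0, T])
    (discount p t0 s * Ef s 1 w).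
Proof.
move=> H; have [M M0 DM] := disc_bounded adm t0T.
pose mu := lebesgue_stieltjes_measure (Pf (barrier p) w).
pose v n i := disc p t0 (u n i.+1) * Ef (u n i.+1) 1 w.
have [||||_ h] := @riemann_cvg R mu t0 T M v (fun s => disc p t0 s * Ef s 1 w).
- by rewrite [X in (X < _)%E](lebesgue_stieltjes_ocitv _ (ltW t0lT)) ltry.
- exact: M0.
- move=> n i i_n; rewrite /v (H n i.+1 i_n _).1; last exact: leq_ltn_trans i_n.
  rewrite mulrC; apply: norm_mul_le; first exact: clip01_norm.
  by apply: DM; have [h1 /ltW h2] := uS i_n; exact: le_trans h2.
- move=> y yT; apply: (stepfun_right_cvg (v := fun s => disc p t0 s * Ef s 1 w)) => //.
  apply: cvgM; first exact: (disc_rc adm t0T).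
  by apply: str.2 => //; case/andP: yT => /ltW.
rewrite (_ : \int[mu]_(s in _) (discount p t0 s * _) =
  \int[mu]_(s in `]t0, T]) (disc p t0 s * Ef s 1 w)); last first.
  by apply: eq_Rintegral => s /set_mem/=; rewrite in_itv/= => /andP[_ sT]; rewrite discE.
apply: cvg_trans h; apply: near_eq_cvg; apply: nearW => n; apply: eq_bigr => i _.
have n0 : (0 < n)%N by exact: leq_ltn_trans (ltn_ord i).
have [_ /ltW h2] := uS (ltn_ord i).
rewrite [X in fine X](lebesgue_stieltjes_ocitv _ h2)/=.
have [e1 e2] := H n i.+1 (ltn_ord i) n0; have [_ e3] := H n i (ltnW (ltn_ord i)) n0.
by rewrite /v e1 /stays /stay -e2 -e3; ring.
Qed.

Definition terminal_factor : R := varpi p * (1 - writedown p) * face p.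

Definition formula w : R :=
  face p * discount p t0 (expiry p)
    * (1 - Pf (barrier p) w (expiry p)) * Ef (expiry p) 1 w
  + \sum_(i < ncoupon p)
      coupon p i * discount p t0 (coupon_date p i)
      * (1 - Pf (barrier p) w (coupon_date p i)) * Ef (coupon_date p i) 1 w
      * (t0 < coupon_date p i)%R%:R
  + terminal_factor * \int[lebesgue_stieltjes_measure (Pf (barrier p) w)]_(s in `]t0, expiry p])
        (discount p t0 s * Ef s 1 w).

Lemma paths_cvg w : good_path p X w ->
  fixed_paths w + terminal_factor * recovery_paths n w @[n --> \oo] --> cash_flows p X t0 w.
Proof.
move=> g; have Tge : 0 <= T by rewrite (le_trans t00)// ltW.
rewrite /cash_flows (tau_gt_indic adm g); last by rewrite Tge lexx.
under eq_bigr => i _.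
  rewrite (tau_gt_indic adm g); last first.
    by have /andP[/ltW -> ->] := coupon_date_itv adm i.
  over.
apply: cvgD; first exact: cvg_cst.
rewrite (_ : face p * recovery p X w * _ * _ = terminal_factor *
   ((tau1 p X w < tau3 p X w)%E%:R * discount p t0 (fine (tau p X w))
     * (t0%:E < tau p X w <= T%:E)%E%:R)); last first.
  by rewrite /recovery /terminal_factor; ring.
apply: cvgM; first exact: cvg_cst.
exact: (recovery_cvg adm g t0T).
Qed.

Lemma value_cvg : {ae P, forall w,
  fixed_value w + terminal_factor * recovery_value n w @[n --> \oo] --> formula w}.
Proof.
have ce t : t0 <= t -> {ae P, forall w, Ef t 1 w = quiets t w /\
     Pf (barrier p) w t = clip01 (Pf (barrier p) w t)}.
  move=> t0t; apply: aeI.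
    exact: (survival_clip adm spec filt t00 str t0t).1.
  exact: (crossing_clip adm spec filt t00 cross (le_trans t00 t0t)).1.
have H1 : {ae P, forall w, forall n i, (i <= n)%N -> (0 < n)%N -> Ef (u n i) 1 w = quiets (u n i) w /\
     Pf (barrier p) w (u n i) = clip01 (Pf (barrier p) w (u n i))}.
  apply: ae_foralln => n; apply: ae_foralln => i.
  have [i_n|ni] := boolP ((i <= n)%N && (0 < n)%N); last first.
    by apply: aeW => w a b; move: ni; rewrite a b.
  case/andP: i_n => i_n n0; have /andP[h _] := u_itv i_n n0.
  by apply: filterS (ce _ h) => w.
have H2 : {ae P, forall w, forall i : 'I_(ncoupon p), t0 < coupon_date p i ->
    Ef (coupon_date p i) 1 w = quiets (coupon_date p i) w /\
    Pf (barrier p) w (coupon_date p i) = clip01 (Pf (barrier p) w (coupon_date p i))}.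
  apply: filter_forall => i; have [t0i|] := boolP (t0 < coupon_date p i); last first.
    by move=> /negP n0i; apply: aeW => w.
  by apply: filterS (ce _ (ltW t0i)) => w.
apply: filterS2 (ce _ (ltW t0lT)) (aeI H1 H2) => w [e1 e2] [h1 h2].
apply: cvgD; last by apply: cvgM; [exact: cvg_cst|exact: recovery_value_cvg].
rewrite (_ : _ + _ = fixed_value w); first exact: cvg_cst.
rewrite /fixed_value addrC; congr (_ + _).
  apply: eq_bigr => i _; have [t0i|_] := boolP (t0 < coupon_date p i).
    by have [f1 f2] := h2 i t0i; rewrite /stays /stay -f2 -f1; ring.
  by rewrite !mulr0 mul0r.
by rewrite /stays /stay -e2 -e1; ring.
Qed.

Lemma value_ae Pi : is_cond_exp P (F t0) (cash_flows p X t0) Pi ->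
  {ae P, forall w, (t0%:E < tau p X w)%E -> Pi w = formula w}.
Proof.
move=> ce; have [M M0 DM] := disc_bounded adm t0T.
have [[mfp [C1 fp1]] [mfv [C2 fv1]] _] := corresponds_fixed.
pose V n w := fixed_value w + terminal_factor * recovery_value n w.
pose L := C2 + `|terminal_factor| * M.
have VL n w : `|V n w| <= L.
  rewrite (le_trans (ler_normD _ _))// lerD// normrM ler_wpM2l//.
  exact: recovery_value_bound.
have L0 : 0 <= L by exact: le_trans (normr_ge0 _) (VL 0%N point).
(* The formula is bounded by [L] only almost surely; the clipped copy is bounded everywhere. *)
pose Q w := Order.max (- L) (Order.min (formula w) L).
have QL w : `|Q w| <= L.
  rewrite ler_norml /Q le_max lexx/= ge_max ge_min lexx orbT andbT.
  by rewrite (le_trans _ L0)// oppr_le0.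
have cV : {ae P, forall w, V n w @[n --> \oo] --> formula w} := value_cvg.
have formQ : {ae P, forall w, formula w = Q w}.
  apply: filterS cV => w h; have : `|formula w| <= L.
    by apply: cvg_norm_le h; apply: nearW => n; exact: VL.
  by rewrite ler_norml => /andP[h1 h2]; rewrite /Q min_l// max_r.
have cVQ : {ae P, forall w, V n w @[n --> \oo] --> Q w}.
  by apply: filterS2 cV formQ => w h <-.
have corr n : corresponds (fun w => fixed_paths w + terminal_factor * recovery_paths n w) (V n).
  apply: (matchesD mF mN0); first exact: corresponds_fixed.
  by apply: (matchesZ mF mN0); exact: corresponds_recovery.
have gstay t : t0 <= t -> gmeas (F t0) (stays t).
  by move=> t0t; apply: (gmeas_stay filt t00 cross); exact: le_trans t0t.
have gquiet t : t0 <= t -> gmeas (F t0) (quiets t) by exact: (gmeas_quiet filt t00 str).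
have gV n : gmeas (F t0) (V n).
  apply: measurable_funD.
    apply: measurable_funD; last first.
      apply: measurable_funM => //; apply: measurable_funM; [apply: gstay|apply: gquiet]; exact: ltW.
    apply: measurable_sum => i; have [t0i|_] := boolP (t0 < coupon_date p i).
      by apply: measurable_funM => //; apply: measurable_funM; [apply: gstay|apply: gquiet]; exact: ltW.
    rewrite (_ : (fun w => _) = (fun=> 0)); first exact: measurable_cst.
    by apply/funext => w; rewrite mulr0 mul0r.
  apply: measurable_funM => //; apply: measurable_sum => i; apply: measurable_funM => //.
  have [h1 /ltW h2] := uS (ltn_ord i); have h3 := le_trans h1 h2.
  by apply: measurable_funB; apply: measurable_funM; [exact: gstay|exact: gquiet|exact: gstay|exact: gquiet].
(* The formula integrates against a random measure; its measurability comes from the grid sums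
   [V n]. *)
have gQ : gmeas (F t0) Q.
  exact: (gmeas_ae_cvg sF.1 (F_negligible filt t00) gV cVQ).
have bfQ : bfun Q by apply: gmeas_bfun sF gQ _; exists L.
have bN : bfun (\1_(zeroN p X t0) : Omega -> R) by exact: bfun_indic.
have [icash iPi _ _] := ce.
have mcash : measurable_fun setT (cash_flows p X t0).
  by apply/measurable_EFinP; case/integrableP : icash.
(* The value vanishes almost surely once an intervention has occurred, while [tau > t0] forces the
   indicator to be 1. *)
suff h : {ae P, forall w, Pi w = \1_(zeroN p X t0) w * Q w}.
  apply: filterS2 (ae_good_path adm spec) (aeI h formQ) => w g [-> ->] t0tau.
  have := @tau_gt_indic _ _ _ p X w adm g t0; rewrite t0tau t00 (ltW t0lT) => /(_ isT).
  rewrite !indicE; case: (w \in zeroN p X t0) => /=; first by rewrite mul1r.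
  by rewrite mulr0 => /eqP; rewrite oner_eq0.
apply: (eq_ae_of_integrals sF iPi).
- exact/bfun_integrable/bfunM.
- exact: cond_exp_gmeas sF.1 ce.
- by apply: measurable_funM => //; exact: gmeas_indic sF.1 (F_zeroN filt t00).
move=> A FA; rewrite (cond_exp_integral ce FA) !RintegralE.
have bA : bfun (\1_A : Omega -> R) by apply: bfun_indic; exact: mF.
pose L' := C1 + `|terminal_factor| * M.
have step n : Ex P (fun w => \1_A w * (fixed_paths w + terminal_factor * recovery_paths n w)) =
    Ex P (fun w => \1_A w * (\1_(zeroN p X t0) w * V n w)).
  by have [_ _ h] := corr n; exact: h.
apply: (limits_eq step).
- apply: (@Ex_cvg _ _ _ _ _ _ L').
  + by move=> n; have [b _ _] := corr n; exact: (bfunM bA b).1.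
  + exact: measurable_funM bA.1 mcash.
  + move=> n w; apply: norm_mul_le; first exact: norm_indic_le1.
    rewrite (le_trans (ler_normD _ _))// lerD// normrM ler_wpM2l//.
    exact: recovery_paths_bound.
  + apply: filterS (ae_good_path adm spec) => w g.
    by apply: cvgM; [exact: cvg_cst|exact: paths_cvg].
- apply: (@Ex_cvg _ _ _ _ _ _ L).
  + by move=> n; have [_ b _] := corr n; exact: (bfunM bA (bfunM bN b)).1.
  + exact: (bfunM bA (bfunM bN bfQ)).1.
  + move=> n w; apply: norm_mul_le; first exact: norm_indic_le1.
    by apply: norm_mul_le; first exact: norm_indic_le1.
  + apply: filterS cVQ => w h.
    by do 2!(apply: cvgM; first exact: cvg_cst).
Qed.

End valuation.

Theorem theorem1 (d : measure_display) (Omega : measurableType d)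
  (R : realType) (P : probability Omega R)
  (p : coco_params R) (X : drivers Omega R) (F : R -> set (set Omega))
  (t0 : R) (Pf : R -> Omega -> cumulative R R) (Ef : R -> R -> Omega -> R)
  (Pi : Omega -> R) :
  admissible p ->
  drivers_spec P p X ->
  filtration_spec P p X F ->
  0 <= t0 < expiry p ->
  is_crossing_prob P p X (F t0) Pf ->
  is_survival_transform P p X (F t0) t0 Ef ->
  is_cond_exp P (F t0) (cash_flows p X t0) Pi ->
  {ae P, forall w, (t0%:E < tau p X w)%E ->
    Pi w =
      face p * discount p t0 (expiry p)
        * (1 - Pf (barrier p) w (expiry p)) * Ef (expiry p) 1 w
      + \sum_(i < ncoupon p)
          coupon p i * discount p t0 (coupon_date p i)
          * (1 - Pf (barrier p) w (coupon_date p i)) * Ef (coupon_date p i) 1 w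
          * (t0 < coupon_date p i)%R%:R
      + varpi p * (1 - writedown p) * face p
        * \int[lebesgue_stieltjes_measure (Pf (barrier p) w)]_(s in `]t0, expiry p])
            (discount p t0 s * Ef s 1 w)}.
Proof.
by move=> adm spec filt t0T cross str ce; exact: (value_ae adm spec filt t0T cross str ce).
Qed.
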